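(* Let $T,C_\kappa>0$ be given and let $(\rho,u)$ and $(\bar\rho,\bar u)$ be strong solutions on $[0,T]\times\mathbb T^3$ (in the regularity class given in the context) of $$\rho_t+\operatorname{div}(\rho u)=0,\qquad (\rho u)_t+\operatorname{div}(\rho u\otimes u)=-\rho\nabla\big(h'(\rho)-C_\kappa\triangle\rho\big),$$ corresponding to initial data $(\rho_0,u_0)$ and $(\bar\rho_0,\bar u_0)$, respectively; write $m=\rho u$, $\bar m=\bar\rho\bar u$, $m_0=\rho_0u_0$, $\bar m_0=\bar\rho_0\bar u_0$. Assume that there are constants $C_\rho,c_\rho,c_m>0$ with $$c_\rho\le\rho(t,x),\bar\rho(t,x)\le C_\rho\quad\forall t\in[0,T],\,x\in\mathbb T^3,\qquad c_m\ge\max\{\|m\|_{L^\infty((0,T)\times\mathbb T^3)},\|\bar m\|_{L^\infty((0,T)\times\mathbb T^3)}\},$$ and that $\int_{\mathbb T^3}(\rho_0-\bar\rho_0)\,dx=0$. Then there exists a constant $C=C(T,C_\kappa,\bar\rho_0,\bar u_0,c_\rho,C_\rho,c_m)>0$ such that $$\frac{C_\kappa}{2}\|\rho-\bar\rho\|^2_{L^\infty(0,T;H^1(\mathbb T^3))}+\frac{c_\rho}{2}\|u-\bar u\|^2_{L^\infty(0,T;L^2(\mathbb T^3))}\le C\int_{\mathbb T^3}\eta_{\mathrm R}(\rho_0,m_0\,|\,\bar\rho_0,\bar m_0)\,dx .$$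
   Context: $\mathbb T^3$ is the three-dimensional flat torus. $h\in C^3((0,\infty),[0,\infty))$ is a fixed function; no convexity of $h$ is assumed. Regularity class of strong solutions: $\rho\in C^0([0,T],C^3(\mathbb T^3,\mathbb R_+))\cap C^{3/2}((0,T),C^1(\mathbb T^3,\mathbb R_+))$, $u\in C^0([0,T],C^1(\mathbb T^3,\mathbb R^3))\cap C^1((0,T),C^0(\mathbb T^3,\mathbb R^3))$. Reduced relative energy: $$\eta_{\mathrm R}(\rho,m\,|\,\bar\rho,\bar m)=\frac{C_\kappa}{2}|\nabla(\rho-\bar\rho)|^2+\frac{\rho}{2}\Big|\frac m\rho-\frac{\bar m}{\bar\rho}\Big|^2 .$$ *)

(* Defs.v *)
From HB Require Import structures.
From mathcomp Require Import all_boot all_order all_algebra.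
From mathcomp Require Import all_classical all_reals all_analysis.

Set Implicit Arguments.
Unset Strict Implicit.
Unset Printing Implicit Defensive.

Import Order.TTheory GRing.Theory Num.Theory.
Import numFieldNormedType.Exports.

Local Open Scope classical_set_scope.
Local Open Scope ring_scope.

(* The flat torus is R^3 / Z^3: a function on it is a function on 'rV[R]_3 that
   is 1-periodic in each coordinate, and integrals over it are Lebesgue integrals
   over the unit cube. *)
Section Torus.
Context {R : realType}.
Local Notation E := 'rV[R]_3.

Definition basis_vec (i : 'I_3) : E := delta_mx 0 i.

Definition partial {V : normedModType R} (i : 'I_3) (f : E -> V) : E -> V :=
  'D_(basis_vec i) f.

Definition grad (f : E -> R) (x : E) : E := \row_i partial i f x.

Definition divergence (F : E -> E) (x : E) : R :=
  \sum_i partial i (fun y => F y 0 i) x.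

(* (div A)_i = \sum_j d_j A_ij *)
Definition divT (A : E -> 'M[R]_3) (x : E) : E :=
  \row_i \sum_j partial j (fun y => A y i j) x.

Definition laplacian (f : E -> R) : E -> R := divergence (grad f).

(* The library norm of 'rV[R]_3 is the max norm, hence these. *)
Definition sqnorm2 (v : E) : R := \sum_i v 0 i ^+ 2.
Definition norm2 (v : E) : R := Num.sqrt (sqnorm2 v).

(* The product measure lives on R * R * R. *)
Definition torus_point (x : R * R * R) : E := \row_i [:: x.1.1; x.1.2; x.2]`_i.

Local Notation leb := (@lebesgue_measure R).
Local Notation leb3 := (leb \x leb \x leb)%E.
Definition cube : set (R * R * R) := `[0, 1] `*` `[0, 1] `*` `[0, 1].

Definition integral_torus (f : E -> R) : \bar R :=
  (\int[leb3]_(x in cube) (f (torus_point x))%:E)%E.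

(* A norm over a subset is computed on the extension by 0. *)
Definition L2norm (f : E -> R) : \bar R :=
  'N[leb3]_(2%:E)[(fun x => (f (torus_point x))%:E) \_ cube].

Definition L2norm_vec (F : E -> E) : \bar R := L2norm (fun x => norm2 (F x)).

Definition H1norm (f : E -> R) : \bar R :=
  ((L2norm f ^+ 2 + L2norm_vec (grad f) ^+ 2) `^ 2^-1)%E.

(* L^oo(0,T; X) norm of f, where N is the norm of X *)
Definition Loo_time {X : Type} (T : R) (N : X -> \bar R) (f : R -> X) : \bar R :=
  'N[leb]_+oo[(fun t : R => N (f t)) \_ `]0, T[].

(* L^oo((0,T) x T^3) norm, with the factors in the order T^3 x (0,T) *)
Definition Loo_vec (T : R) (m : R -> E -> E) : \bar R :=
  'N[(leb3 \x leb)%E]_+oo[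
    (fun z : (R * R * R) * R => (norm2 (m z.2 (torus_point z.1)))%:E)
      \_ (cube `*` `]0, T[)].

End Torus.

Section FunctionSpaces.
Context {R : realType} {V : normedModType R}.
Local Notation E := 'rV[R]_3.

Definition partials (s : seq 'I_3) (f : E -> V) : E -> V := foldr partial f s.

Definition Ck (k : nat) (f : E -> V) : Prop :=
  [/\ forall i, periodic f (basis_vec i),
      forall s i x, (size s < k)%N -> derivable (partials s f) x (basis_vec i)
    & forall s, (size s <= k)%N -> continuous (partials s f)].

(* By periodicity, the supremum is over a bounded set when Ck k f holds. *)
Definition Ck_norm (k : nat) (f : E -> V) : R :=
  sup [set r | exists s x, (size s <= k)%N /\ r = `|partials s f x|].

(* f \in C^0([0,T], C^k) *)
Definition C0_Ck (T : R) (k : nat) (f : R -> E -> V) : Prop :=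
  (forall t : R, 0 <= t <= T -> Ck k (f t)) /\
  (forall t0 : R, 0 <= t0 <= T ->
    Ck_norm k (f t - f t0) @[t --> within `[0, T] (nbhs t0)] --> 0).

(* On (0,T), g is the derivative of f for the C^k norm. *)
Definition is_time_deriv (T : R) (k : nat) (f g : R -> E -> V) : Prop :=
  forall t : R, 0 < t < T ->
    [/\ Ck k (f t), Ck k (g t)
      & Ck_norm k (d^-1 *: (f (t + d) - f t) - g t) @[d --> 0^'] --> 0].

(* f \in C^1((0,T), C^k) *)
Definition C1_Ck (T : R) (k : nat) (f : R -> E -> V) : Prop :=
  exists2 g, is_time_deriv T k f g &
    forall t0 : R, 0 < t0 < T -> Ck_norm k (g t - g t0) @[t --> t0] --> 0.

(* f \in C^(1+alpha)((0,T), C^k), 0 < alpha < 1: the derivative is alpha-Hoelder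
   on the compact subintervals of the open interval (0,T). *)
Definition C1alpha_Ck (alpha T : R) (k : nat) (f : R -> E -> V) : Prop :=
  exists2 g, is_time_deriv T k f g &
    forall a b : R, 0 < a -> b < T -> exists L : R,
      forall s t : R, a <= s <= b -> a <= t <= b ->
        Ck_norm k (g s - g t) <= L * `|s - t| `^ alpha.

End FunctionSpaces.

Section Korteweg.
Context {R : realType}.
Local Notation E := 'rV[R]_3.

(* h \in C^3((0,oo), [0,oo)); the values of h on (-oo,0] play no role. *)
Definition C3_pos_nonneg (h : R -> R) : Prop :=
  forall r : R, 0 < r ->
    [/\ 0 <= h r,
        forall n, (n < 3)%N -> derivable (derive1n n h) r 1
      & {for r, continuous (derive1n 3 h)}].

Definition momentum (rho : E -> R) (u : E -> E) (x : E) : E := rho x *: u x.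

Definition strong_regularity (T : R) (rho : R -> E -> R) (u : R -> E -> E) : Prop :=
  [/\ C0_Ck T 3 rho /\ C1alpha_Ck (1 / 2) T 1 rho,
      forall (t : R) x, 0 <= t <= T -> 0 < rho t x
    & C0_Ck T 1 u /\ C1_Ck T 0 u].

Definition mass_eq (T : R) (rho : R -> E -> R) (u : R -> E -> E) : Prop :=
  forall (t : R) x, 0 < t < T ->
    derive1 (fun s => rho s x) t + divergence (momentum (rho t) (u t)) x = 0.

Definition momentum_eq (h : R -> R) (Ckappa T : R)
    (rho : R -> E -> R) (u : R -> E -> E) : Prop :=
  forall (t : R) x, 0 < t < T ->
    derive1 (fun s => momentum (rho s) (u s) x) t
      + divT (fun y => rho t y *: ((u t y)^T *m u t y)) x
    = - (rho t x *:
         grad (fun y => derive1 h (rho t y) - Ckappa * laplacian (rho t) y) x).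

Definition strong_solution (h : R -> R) (Ckappa T : R)
    (rho0 : E -> R) (u0 : E -> E) (rho : R -> E -> R) (u : R -> E -> E) : Prop :=
  [/\ strong_regularity T rho u,
      mass_eq T rho u,
      momentum_eq h Ckappa T rho u,
      forall x, rho 0 x = rho0 x
    & forall x, u 0 x = u0 x].

(* reduced relative energy *)
Definition etaR (Ckappa : R) (rho : E -> R) (m : E -> E)
    (rhob : E -> R) (mb : E -> E) (x : E) : R :=
  Ckappa / 2 * sqnorm2 (grad (rho - rhob) x)
  + rho x / 2 * sqnorm2 ((rho x)^-1 *: m x - (rhob x)^-1 *: mb x).

End Korteweg.

(* Main.v *)
Require Import Defs.
From HB Require Import structures.
From mathcomp Require Import all_boot all_order all_algebra.
From mathcomp Require Import all_classical all_reals all_analysis.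
From mathcomp Require Import measurable_realfun ess_sup_inf ring lra.

(** Stability in the reduced relative energy, for a pressure of arbitrary monotonicity.

    The obvious quantity to differentiate in time is the integral of the reduced
    relative energy itself. Its capillary part then produces
    $(\rho-\bar\rho)\,\nabla(\rho-\bar\rho)\cdot\nabla\operatorname{div}\bar u$, and
    second derivatives of $\bar u$ are not controlled by the regularity class up to the
    initial time. The proof works instead with the relative density
    $q=\rho/\bar\rho-1$, the relative velocity $w=u-\bar u$ and the energy
    $$F=\int_{\mathbb T^3}\frac{C_\kappa}2\bar\rho^2|\nabla q|^2
      +\frac\rho2|w|^2+\frac{\bar\rho}2q^2\,dx.$$
    The two mass balances give
    $q_t+\bar u\cdot\nabla q=-\bar\rho^{-1}\operatorname{div}(\rho w)$
    ([reldens_transport]), without a term $q\operatorname{div}\bar u$, while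
    $\bar\rho^{-1}\operatorname{div}(\bar\rho^2\nabla q)
      =\triangle(\rho-\bar\rho)-q\triangle\bar\rho$ ([div_flux]).
    Hence the highest-order exchange between capillarity and motion cancels, and after
    integrations by parts $F'$ is the integral of a quadratic form in $(\nabla q,w,q)$
    ([tint_energy_t]). Its coefficients involve three derivatives of $\bar\rho$, one
    derivative of $\bar u$, and $h''$ and its Lipschitz constant on
    $[c_\rho,C_\rho]$. So $F'\le KF$ ([remainder_le]), whatever the sign of $h''$: the
    pressure only contributes terms of lower order than the capillary energy. Gronwall's
    lemma then bounds $F(t)$ by a multiple of $F(0)$ ([energy_estimate]).

    At time zero, $F$ exceeds the reduced relative energy by a multiple of
    $\|\rho_0-\bar\rho_0\|_{L^2}^2$, which Poincare's inequality controls because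
    $\rho_0-\bar\rho_0$ has mean zero ([tint_energy_le_etaR]). At later times $F$
    dominates the squared distance of the solutions in $H^1\times L^2$
    ([distance2_le_energy]).

    The rate $K$ depends on the solution $(\bar\rho,\bar u)$, whereas the constant of the
    theorem may only depend on its initial data. So one solution with these data is
    fixed, $K$ is computed from it, and both $(\rho,u)$ and $(\bar\rho,\bar u)$ are
    compared with it: the second comparison starts from zero energy, hence gives zero
    distance, and the triangle inequality concludes ([stability]).

    Poincare's inequality and the vanishing of integrals of derivatives are obtained by
    averaging over one coordinate at a time. Differentiation under the integral rests on
    uniform convergence of the difference quotients, which is what the function spaces of
    the theorem provide. *)

Set Implicit Arguments.
Unset Strict Implicit.
Unset Printing Implicit Defensive.

Import Order.TTheory GRing.Theory Num.Theory.
Import numFieldNormedType.Exports.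

Local Open Scope classical_set_scope.
Local Open Scope ring_scope.

(** * Calculus of periodic $C^k$ functions *)

Section CkCalculus.
Context {R : realType} {V : normedModType R}.
Local Notation E := 'rV[R]_3.
Implicit Types (f g : E -> V) (i j : 'I_3) (k : nat).

Lemma partials_rcons (s : seq 'I_3) i f :
  partials (rcons s i) f = partials s (partial i f).
Proof. by rewrite /partials foldr_rcons. Qed.

Lemma partial_periodic i f (p : E) :
  periodic f p -> periodic (partial i f) p.
Proof.
move=> fp x; rewrite /partial /derive.
by under [X in lim (X @ _)]eq_fun do rewrite /= addrA !fp.
Qed.

Lemma Ck0P f : Ck 0 f <-> (forall i, periodic f (basis_vec i)) /\ continuous f.
Proof.
split=> [[pf _ cf]|[pf cf]]; first by split => //; exact: (cf [::] (leq0n _)).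
by split => // s; rewrite leqn0 => /nilP ->.
Qed.

(** This recursive description allows induction on $k$: the derivative of a sum,
    product or inverse is again built by these operations, from functions one order
    less regular. *)
Lemma CkSP k f : Ck k.+1 f <->
  Ck 0 f /\ forall i, (forall x, derivable f x (basis_vec i)) /\ Ck k (partial i f).
Proof.
split=> [[pf df cf]|[/Ck0P[pf cf] H]].
  split; first by apply/Ck0P; split => //; exact: (cf [::] (leq0n _)).
  move=> i; split=> [x|]; first exact: (df [::] _ _ (ltn0Sn _)).
  split=> [j|s j x ks|s ks]; first exact: partial_periodic.
    by rewrite -partials_rcons; apply: df; rewrite size_rcons.
  by rewrite -partials_rcons; apply: cf; rewrite size_rcons.
split=> // [s j x|s].
  case/lastP: s => [_|s i]; first by have [] := H j.
  rewrite size_rcons ltnS => sk; rewrite partials_rcons.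
  by have [_ [_ + _]] := H i; apply.
case/lastP: s => [_|s i]; first exact: cf.
rewrite size_rcons ltnS => sk; rewrite partials_rcons.
by have [_ [_ _ +]] := H i; apply.
Qed.

Lemma CkW k l f : (k <= l)%N -> Ck l f -> Ck k f.
Proof.
move=> kl [pf df cf]; split=> // s; first by move=> j x sk; apply: df; exact: leq_trans sk kl.
by move=> sk; apply: cf; exact: leq_trans sk kl.
Qed.

Lemma Ck_continuous k f : Ck k f -> continuous f.
Proof. by move=> [_ _ cf]; exact: (cf [::] (leq0n _)). Qed.

Lemma Ck_derivable k f x i : Ck k.+1 f -> derivable f x (basis_vec i).
Proof. by move=> /CkSP[_ /(_ i)[]]. Qed.

Lemma Ck_partial k f i : Ck k.+1 f -> Ck k (partial i f).
Proof. by move=> /CkSP[_ /(_ i)[]]. Qed.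

Lemma Ck_cst k (c : V) : Ck k (fun=> c).
Proof.
elim: k c => [|k ih] c.
  by apply/Ck0P; split=> //; exact: cst_continuous.
apply/CkSP; split; first by apply/Ck0P; split=> //; exact: cst_continuous.
move=> i; split=> [x|]; first exact: derivable_cst.
have -> : partial i (fun=> c) = (fun=> 0 : V).
  by apply/funext => x; rewrite /partial derive_cst.
exact: ih.
Qed.

Lemma partialD i f g x : derivable f x (basis_vec i) -> derivable g x (basis_vec i) ->
  partial i (fun y => f y + g y) x = partial i f x + partial i g x.
Proof. exact: deriveD. Qed.

Lemma partialN i f x : derivable f x (basis_vec i) ->
  partial i (fun y => - f y) x = - partial i f x.
Proof. exact: deriveN. Qed.

Lemma partialB i f g x : derivable f x (basis_vec i) -> derivable g x (basis_vec i) ->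
  partial i (fun y => f y - g y) x = partial i f x - partial i g x.
Proof. exact: deriveB. Qed.

Lemma partialZ i (c : R) f x : derivable f x (basis_vec i) ->
  partial i (fun y => c *: f y) x = c *: partial i f x.
Proof. exact: deriveZ. Qed.

Lemma CkD k f g : Ck k f -> Ck k g -> Ck k (fun x => f x + g x).
Proof.
elim: k f g => [|k ih] f g.
  move=> /Ck0P[pf cf] /Ck0P[pg cg]; apply/Ck0P; split=> [i x|x].
    by rewrite pf pg.
  exact: (cvgD (cf x) (cg x)).
move=> /CkSP[/Ck0P[pf cf] df] /CkSP[/Ck0P[pg cg] dg]; apply/CkSP; split.
  apply/Ck0P; split=> [i x|x]; first by rewrite pf pg.
  exact: (cvgD (cf x) (cg x)).
move=> i; have [dfi cfi] := df i; have [dgi cgi] := dg i.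
split=> [x|]; first exact: derivableD.
have -> : partial i (fun x => f x + g x) = (fun x => partial i f x + partial i g x).
  by apply/funext => x; rewrite partialD.
exact: ih.
Qed.

Lemma CkZ k (c : R) f : Ck k f -> Ck k (fun x => c *: f x).
Proof.
elim: k f => [|k ih] f.
  move=> /Ck0P[pf cf]; apply/Ck0P; split=> [i x|x]; first by rewrite pf.
  exact: (cvgZ (cvg_cst c) (cf x)).
move=> /CkSP[/Ck0P[pf cf] df]; apply/CkSP; split.
  apply/Ck0P; split=> [i x|x]; first by rewrite pf.
  exact: (cvgZ (cvg_cst c) (cf x)).
move=> i; have [dfi cfi] := df i.
split=> [x|]; first exact: derivableZ.
have -> : partial i (fun x => c *: f x) = (fun x => c *: partial i f x).
  by apply/funext => x; rewrite partialZ.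
exact: ih.
Qed.

Lemma CkN k f : Ck k f -> Ck k (fun x => - f x).
Proof.
move=> /(CkZ (-1)); congr (Ck k _).
by apply/funext => x; rewrite scaleN1r.
Qed.

Lemma CkB k f g : Ck k f -> Ck k g -> Ck k (fun x => f x - g x).
Proof. by move=> cf /CkN; exact: CkD. Qed.

(** Along a line a directional derivative is an ordinary one-variable derivative, to
    which the chain rule, the mean value theorem and the fundamental theorem of
    calculus apply. *)
Lemma is_derive_line f (v x : E) (h0 : R) : derivable f (h0 *: v + x) v ->
  is_derive h0 1 (fun h : R => f (h *: v + x)) ('D_v f (h0 *: v + x)).
Proof.
move=> df.
have e : (fun h : R => h^-1 *: (((fun h => f (h *: v + x)) \o shift h0) (h *: 1)
      - f (h0 *: v + x))) =
    (fun h => h^-1 *: ((f \o shift (h0 *: v + x)) (h *: v) - f (h0 *: v + x))).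
  by apply/funext => h /=; rewrite addrA -scalerDl -[h *: 1]/(h * 1) mulr1.
by apply: DeriveDef; rewrite /derivable /derive e.
Qed.

End CkCalculus.

Section CkScalar.
Context {R : realType}.
Local Notation E := 'rV[R]_3.
Implicit Types (f g : E -> R) (i j : 'I_3) (k : nat).

Lemma partialM i f g x : derivable f x (basis_vec i) -> derivable g x (basis_vec i) ->
  partial i (fun y => f y * g y) x = partial i f x * g x + f x * partial i g x.
Proof.
by move=> df dg; rewrite [LHS](deriveM df dg) addrC; congr (_ + _); exact: mulrC.
Qed.

Lemma partialV i f x : f x != 0 -> derivable f x (basis_vec i) ->
  partial i (fun y => (f y)^-1) x = - partial i f x / f x ^+ 2.
Proof.
by move=> f0 df; rewrite /partial deriveV// mulNr mulrC -mulNr.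
Qed.

Lemma partial_comp i f (g : R -> R) x : derivable f x (basis_vec i) ->
  derivable g (f x) 1 ->
  derivable (fun y => g (f y)) x (basis_vec i) /\
  partial i (fun y => g (f y)) x = derive1 g (f x) * partial i f x.
Proof.
move=> df dg; set v := basis_vec i.
have d1 := is_derive_line (x := x) (h0 := 0) (v := v) (f := f).
have d2 := is_derive_line (x := x) (h0 := 0) (v := v) (f := fun y => g (f y)).
rewrite !scale0r !add0r in d1 d2; have {}d1 := d1 df.
have dg0 : derivable g ((fun h : R => f (h *: v + x)) 0) 1.
  by rewrite scale0r add0r.
have dgf : derivable (fun y => g (f y)) x v.
  apply/derivable1P; apply/derivable1_diffP.
  apply: (@differentiable_comp _ _ _ _ (fun h : R => f (h *: v + x)) g).
    by apply/derivable1_diffP; exact: ex_derive.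
  exact/derivable1_diffP.
split=> //; rewrite /partial -(@derive_val _ _ _ _ _ _ _ (d2 dgf)) -derive1E.
rewrite -[X in derive1 X _]/(g \o (fun h : R => f (h *: v + x))).
have dl : derivable (fun h : R => f (h *: v + x)) 0 1 by case: d1.
rewrite (derive1_comp dl dg0).
rewrite scale0r add0r; congr (_ * _).
by rewrite derive1E (@derive_val _ _ _ _ _ _ _ d1).
Qed.

Lemma CkM k f g : Ck k f -> Ck k g -> Ck k (fun x => f x * g x).
Proof.
have base f' g' : Ck 0 f' -> Ck 0 g' -> Ck 0 (fun x => f' x * g' x).
  move=> /Ck0P[pf cf] /Ck0P[pg cg]; apply/Ck0P; split=> [i x|x].
    by rewrite pf pg.
  exact: (cvgM (cf x) (cg x)).
elim: k f g => [|k ih] f g; first exact: base.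
move=> Cf Cg; have Cf' := CkW (leqnSn k) Cf; have Cg' := CkW (leqnSn k) Cg.
apply/CkSP; split; first by apply: base; [exact: CkW Cf|exact: CkW Cg].
move=> i; have dfi x : derivable f x (basis_vec i) by exact: Ck_derivable Cf.
have dgi x : derivable g x (basis_vec i) by exact: Ck_derivable Cg.
split=> [x|]; first exact: derivableM.
have -> : partial i (fun x => f x * g x) =
    (fun x => partial i f x * g x + f x * partial i g x).
  by apply/funext => x; rewrite partialM.
by apply: CkD; apply: ih => //; exact: Ck_partial.
Qed.

Lemma Ck_sqr k f : Ck k f -> Ck k (fun x => f x ^+ 2).
Proof. by move=> cf; exact: CkM. Qed.

Lemma CkV k f : (forall x, f x != 0) -> Ck k f -> Ck k (fun x => (f x)^-1).
Proof.
move=> f0.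
have base : Ck 0 f -> Ck 0 (fun x => (f x)^-1).
  move=> /Ck0P[pf cf]; apply/Ck0P; split=> [i x|x]; first by rewrite pf.
  exact: (cvgV (f0 x) (cf x)).
elim: k => [|k ih] // Cf; have Cf' := CkW (leqnSn k) Cf.
apply/CkSP; split; first by apply: base; exact: CkW Cf.
move=> i; have dfi x : derivable f x (basis_vec i) by exact: Ck_derivable Cf.
split=> [x|]; first exact: derivableV.
have -> : partial i (fun x => (f x)^-1) =
    (fun x => - partial i f x * ((f x)^-1) ^+ 2).
  by apply/funext => x; rewrite partialV// exprVn.
by apply: CkM; [exact/CkN/Ck_partial|exact/Ck_sqr/ih].
Qed.

Lemma Ck_sum k n (F : 'I_n -> E -> R) : (forall l, Ck k (F l)) ->
  Ck k (fun x => \sum_l F l x).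
Proof.
elim: n F => [|n ih] F CF.
  have -> : (fun x => \sum_l F l x) = (fun=> 0); last exact: Ck_cst.
  by apply/funext => x; rewrite big_ord0.
have -> : (fun x => \sum_l F l x) =
    (fun x => F ord0 x + \sum_l F (lift ord0 l) x).
  by apply/funext => x; rewrite big_ord_recl.
by apply: CkD => //; exact: ih.
Qed.

Lemma partial_sum i n (F : 'I_n -> E -> R) x :
  (forall l, derivable (F l) x (basis_vec i)) ->
  partial i (fun y => \sum_l F l y) x = \sum_l partial i (F l) x.
Proof.
move=> dF; rewrite /partial -derive_sum//; congr ('D_ _ _ _).
by apply/funext => y; rewrite fct_sumE.
Qed.

Lemma Ck1_comp f (g : R -> R) : Ck 1 f -> (forall x, derivable g (f x) 1) ->
  (forall x, {for f x, continuous (derive1 g)}) ->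
  Ck 1 (fun x => g (f x)).
Proof.
move=> Cf dg cg; have /Ck0P[pf cf] : Ck 0 f by exact: CkW Cf.
have cont0 (g' : R -> R) : (forall x, {for f x, continuous g'}) ->
    Ck 0 (fun x => g' (f x)).
  move=> cg'; apply/Ck0P; split=> [i x|x]; first by rewrite pf.
  exact: continuous_comp (cf x) (cg' x).
apply/CkSP; split.
  apply: cont0 => x; apply: differentiable_continuous.
  exact/derivable1_diffP.
move=> i; have dfi x : derivable f x (basis_vec i) by exact: Ck_derivable Cf.
split=> [x|]; first by have [] := partial_comp (dfi x) (dg x).
have -> : partial i (fun x => g (f x)) = (fun x => derive1 g (f x) * partial i f x).
  by apply/funext => x; have [] := partial_comp (dfi x) (dg x).
exact: CkM (cont0 _ cg) (Ck_partial i Cf).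
Qed.

End CkScalar.

(** * Measurability and Fubini for continuous functions *)

(** Second countability by measurable sets, for a neighbourhood relation [nb] given
    apart from the $\sigma$-algebra: in this form it passes to products, whose
    $\sigma$-algebra is generated by rectangles rather than by open sets. *)
Definition measurable_base {d} (T : measurableType d) (nb : T -> set (set T)) :=
  exists B : nat -> set T, (forall n, measurable (B n)) /\
    forall x U, nb x U -> exists2 n, B n x & B n `<=` U.

Lemma measurable_base_real (R : realType) :
  @measurable_base _ (measurableTypeR R) (@nbhs R R).
Proof.
pose I := (rat * nat)%type.
pose B (n : nat) : set R :=
  if @unpickle I n is Some p then ball (ratr p.1 : R) (p.2.+1%:R^-1) else set0.
suff key (x : R) (U : set R) : nbhs x U -> exists2 n, B n x & B n `<=` U.
  exists B; split=> [n|]; last exact: key.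
  rewrite /B; case: unpickle => [p|//]; apply: open_measurable.
  exact: ball_open.
move=> /nbhs_ballP[e /= e0 xeU].
have [n n0 ne] : exists2 n : nat, true & n.+1%:R^-1 < e / 2.
  have e20 : 0 < e / 2 by rewrite divr_gt0.
  exists (Num.truncn (e / 2)^-1) => //.
  by rewrite invf_plt ?posrE// truncnS_gt.
have /rat_in_itvoo[q] : x - n.+1%:R^-1 < x + n.+1%:R^-1 :> R.
  by rewrite ltrBlDr -addrA ltrDl -mulr2n pmulrn_lgt0 ?invr_gt0.
rewrite in_itv/= => /andP[q1 q2].
have xq : `|ratr q - x| < n.+1%:R^-1 by rewrite ltr_norml ltrBrDl q1 ltrBlDl q2.
exists (pickle (q, n)).
  by rewrite /B pickleK /= /ball/= .
rewrite /B pickleK /= => y /=; rewrite /ball/= => yq.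
apply: xeU; rewrite /ball/=.
have -> : x - y = - (ratr q - x) + (ratr q - y) by ring.
rewrite (le_lt_trans (ler_normD _ _))// normrN.
by rewrite (lt_trans (ltrD xq yq))// (splitr e) ltrD.
Qed.

Lemma measurable_base_prod d1 d2 (T1 : measurableType d1) (T2 : measurableType d2)
    nb1 nb2 : measurable_base (T := T1) nb1 -> measurable_base (T := T2) nb2 ->
  measurable_base (T := (T1 * T2)%type)
    (fun x U => exists2 V, nb1 x.1 V.1 /\ nb2 x.2 V.2 & V.1 `*` V.2 `<=` U).
Proof.
move=> [B1 [mB1 bB1]] [B2 [mB2 bB2]].
pose B (n : nat) := if @unpickle (nat * nat)%type n is Some p
  then B1 p.1 `*` B2 p.2 else set0.
exists B; split=> [n|[x y] U [V [/= Vx Vy] VU]].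
  by rewrite /B; case: unpickle => // p; exact: measurableX.
have [n nx nV] := bB1 _ _ Vx; have [m my mV] := bB2 _ _ Vy.
exists (pickle (n, m)); rewrite /B pickleK//=.
by apply: subset_trans VU => -[a b] /= [/nV ? /mV].
Qed.

(** The preimage of an open interval is the countable union of the members of the
    base contained in it. *)
Lemma continuous_measurable_base (R : realType) d (T : measurableType d) nb
    (f : T -> R) : measurable_base (T := T) nb ->
  (forall x (V : set R), nbhs (f x) V -> nb x (f @^-1` V)) ->
  measurable_fun setT f.
Proof.
move=> [B [mB bB]] cf; apply: (measurability _ (RGenOpens.measurableE R)).
move=> _ [_ [a [b ->] <-]]; rewrite setTI.
set U := `]a, b[%classic.
have -> : f @^-1` U = \bigcup_(n in [set n | B n `<=` f @^-1` U]) B n.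
  apply/seteqP; split=> [x Ux|x [n nU nx]]; last exact: nU.
  have /cf/bB[n nx nU] : nbhs (f x) U.
    by apply: open_nbhs_nbhs; split=> //; exact: interval_open.
  by exists n.
by apply: bigcup_measurable.
Qed.

Lemma continuous2_measurable (R : realType) (f : R * R -> R) :
  continuous f ->
  measurable_fun [set: measurableTypeR R * measurableTypeR R] f.
Proof.
move=> cf; have := measurable_base_prod (@measurable_base_real R) (@measurable_base_real R).
move=> /(@continuous_measurable_base R _ _ _ f); apply=> x V /cf.
by move=> [W [/= W1 W2] WV]; exists W.
Qed.

Lemma continuous3_measurable (R : realType) (f : R * R * R -> R) :
  continuous f ->
  measurable_fun [set: measurableTypeR R * measurableTypeR R * measurableTypeR R] f.
Proof.
move=> cf; have := measurable_base_prod (measurable_base_prod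
  (@measurable_base_real R) (@measurable_base_real R)) (@measurable_base_real R).
move=> /(@continuous_measurable_base R _ _ _ f); apply=> x V /cf.
move=> [W [/= [W' [W1 W1'] W1W] W2] WV]; exists W => //; split=> //.
by exists W'.
Qed.

Section RFubini.
Context d1 d2 (T1 : measurableType d1) (T2 : measurableType d2) (R : realType).
Variable m1 : {sigma_finite_measure set T1 -> \bar R}.
Variable m2 : {sigma_finite_measure set T2 -> \bar R}.
Variables (D1 : set T1) (D2 : set T2) (f : T1 * T2 -> R).
Hypothesis mD1 : measurable D1.
Hypothesis mD2 : measurable D2.
Hypothesis int_f : (m1 \x m2)%E.-integrable (D1 `*` D2) (EFin \o f).

Let patchX x y : ((f \_ (D1 `*` D2)) (x, y)) =
  ((fun x => ((fun y => f (x, y)) \_ D2) y) \_ D1) x.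
Proof.
rewrite !patchE in_setX/=; by case: (x \in D1) => //=.
Qed.

Let int_patch : (m1 \x m2)%E.-integrable setT (EFin \o (f \_ (D1 `*` D2))).
Proof.
by move: int_f; rewrite integrable_mkcond ?restrict_EFin//; exact: measurableX.
Qed.

(** Extension by zero outside the rectangle reduces to the whole product. *)
Lemma Rfubini12 :
  (forall x, D1 x -> m2.-integrable D2 (EFin \o (fun y => f (x, y)))) ->
  \int[(m1 \x m2)%E]_(z in D1 `*` D2) f z =
  \int[m1]_(x in D1) \int[m2]_(y in D2) f (x, y).
Proof.
move=> i2; rewrite Rintegral_mkcond /Rintegral -(integral12_prod_meas1 int_patch).
congr fine; rewrite [RHS]integral_mkcond; apply: eq_integral => x _.
rewrite [RHS]patchE; case: ifPn => [xD|xD].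
  rewrite fineK; last by apply: integrable_fin_num => //; apply: i2; exact/set_mem.
  rewrite [RHS]integral_mkcond; apply: eq_integral => y _ /=.
  by rewrite patchX !patchE xD; case: ifP.
rewrite [LHS](eq_integral (cst 0%E)); first by rewrite integral0.
by move=> y _ /=; rewrite patchX patchE (negbTE xD).
Qed.

Lemma Rfubini21 :
  (forall y, D2 y -> m1.-integrable D1 (EFin \o (fun x => f (x, y)))) ->
  \int[(m1 \x m2)%E]_(z in D1 `*` D2) f z =
  \int[m2]_(y in D2) \int[m1]_(x in D1) f (x, y).
Proof.
move=> i1; rewrite Rintegral_mkcond /Rintegral -(integral21_prod_meas1 int_patch).
congr fine; rewrite [RHS]integral_mkcond; apply: eq_integral => y _.
rewrite [RHS]patchE; case: ifPn => [yD|yD].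
  rewrite fineK; last by apply: integrable_fin_num => //; apply: i1; exact/set_mem.
  rewrite [RHS]integral_mkcond; apply: eq_integral => x _ /=.
  by rewrite !patchE in_setX/= yD andbT; case: ifP.
rewrite [LHS](eq_integral (cst 0%E)); first by rewrite integral0.
by move=> x _ /=; rewrite !patchE in_setX/= (negbTE yD) andbF.
Qed.

End RFubini.

Section SigmaFiniteProduct.
Context d1 d2 (T1 : measurableType d1) (T2 : measurableType d2) (R : realType).
Variable m1 : {sigma_finite_measure set T1 -> \bar R}.
Variable m2 : {sigma_finite_measure set T2 -> \bar R}.

(** An alias of the product measure that carries its $\sigma$-finiteness, so
    that it can in turn be a factor in Fubini's theorem. *)
Definition sfprod : set (T1 * T2) -> \bar R := (m1 \x m2)%E.

HB.instance Definition _ := Measure.copy sfprod (m1 \x m2)%E.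

Let sfprod_sigma_finite : sigma_finite setT sfprod.
Proof.
have [F TF Foo] := sigma_finiteT m1; have [G TG Goo] := sigma_finiteT m2.
exists (fun n => if @unpickle (nat * nat)%type n is Some p
  then F p.1 `*` G p.2 else set0) => [|n].
  apply/esym; rewrite -subTset => -[x y] _.
  have [i _ Fx] : (\bigcup_i F i) x by rewrite -TF.
  have [j _ Gy] : (\bigcup_j G j) y by rewrite -TG.
  by exists (pickle (i, j)) => //; rewrite pickleK.
case: unpickle => [[i j]|]; last by rewrite measure0.
have [? ?] := Foo i; have [? ?] := Goo j; split; first exact: measurableX.
by rewrite /sfprod product_measure1E// lte_mul_pinfty// ge0_fin_numE.
Qed.

HB.instance Definition _ :=
  Measure_isSigmaFinite.Build _ _ _ sfprod sfprod_sigma_finite.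

Lemma Rfubini12_prod d3 (T3 : measurableType d3)
    (m3 : {sigma_finite_measure set T3 -> \bar R})
    (D : set (T1 * T2)) (D3 : set T3) (f : T1 * T2 * T3 -> R) :
  measurable D -> measurable D3 ->
  (m1 \x m2 \x m3)%E.-integrable (D `*` D3) (EFin \o f) ->
  (forall x, D x -> m3.-integrable D3 (EFin \o (fun y => f (x, y)))) ->
  \int[(m1 \x m2 \x m3)%E]_(z in D `*` D3) f z =
  \int[(m1 \x m2)%E]_(x in D) \int[m3]_(y in D3) f (x, y).
Proof.
move=> mD mD3 intf i3.
exact: (@Rfubini12 _ _ (T1 * T2)%type T3 R sfprod m3 D D3 f mD mD3 intf i3).
Qed.

End SigmaFiniteProduct.

(** * Integrals over the unit interval and the unit cube *)

Section UnitInterval.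
Context {R : realType}.
Local Notation leb := (@lebesgue_measure R).
Implicit Types g : R -> R.

Definition int01 g : R := \int[leb]_(s in `[0, 1]) g s.

Lemma lebesgue01 : leb `[0, 1]%classic = 1%E.
Proof. by rewrite lebesgue_measure_itv/= lte_fin ltr01 -EFinD subr0. Qed.

Lemma int01_integrable g : continuous g ->
  leb.-integrable `[0, 1]%classic (EFin \o g).
Proof.
move=> cg; apply: continuous_compact_integrable; first exact: segment_compact.
exact: continuous_subspaceT.
Qed.

Lemma int01D g1 g2 : continuous g1 -> continuous g2 ->
  int01 (fun s => g1 s + g2 s) = int01 g1 + int01 g2.
Proof. by move=> c1 c2; apply: RintegralD => //; exact: int01_integrable. Qed.

Lemma int01Z c g : continuous g -> int01 (fun s => c * g s) = c * int01 g.
Proof. by move=> cg; apply: RintegralZl => //; exact: int01_integrable. Qed.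

Lemma int01_cst (c : R) : int01 (fun=> c) = c.
Proof. by rewrite /int01 Rintegral_cst//= lebesgue01 mulr1. Qed.

Lemma le_int01 g1 g2 : continuous g1 -> continuous g2 ->
  (forall s : R, 0 <= s <= 1 -> g1 s <= g2 s) -> int01 g1 <= int01 g2.
Proof.
move=> c1 c2 g12; apply: le_Rintegral => //; try exact: int01_integrable.
Qed.

Lemma eq_int01 g1 g2 : (forall s : R, 0 <= s <= 1 -> g1 s = g2 s) ->
  int01 g1 = int01 g2.
Proof.
move=> g12; apply: eq_Rintegral => s; rewrite inE/= in_itv/=; exact: g12.
Qed.

Lemma int01N g : continuous g -> int01 (fun s => - g s) = - int01 g.
Proof.
move=> cg; rewrite -mulN1r -int01Z//; apply: eq_int01 => s _; exact: esym (mulN1r _).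
Qed.

Lemma continuous_normr g : continuous g -> continuous (fun s => `|g s|).
Proof. by move=> cg s; exact: (cvg_norm (cg s)). Qed.

Lemma normr_int01 g : continuous g -> `|int01 g| <= int01 (fun s => `|g s|).
Proof. by move=> cg; apply: le_normr_Rintegral => //; exact: int01_integrable. Qed.

(** The variance of $g$ is nonnegative. *)
Lemma int01_sqr g : continuous g -> int01 g ^+ 2 <= int01 (fun s => g s ^+ 2).
Proof.
move=> cg; set c := int01 g.
have cg2 : continuous (fun s => g s ^+ 2) by move=> s; exact: (cvgM (cg s) (cg s)).
have ccg : continuous (fun s => - (2 * c) * g s).
  by move=> s; apply: cvgM; [exact: cvg_cst|exact: cg].
have cc : continuous (fun s => g s ^+ 2 + - (2 * c) * g s).
  by move=> s; exact: (cvgD (cg2 s) (ccg s)).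
have : int01 (fun=> - c ^+ 2) <= int01 (fun s => g s ^+ 2 + - (2 * c) * g s).
  apply: le_int01 => // [s|s _]; first exact: cvg_cst.
  by have := sqr_ge0 (g s - c); rewrite sqrrB; lra.
rewrite int01_cst int01D// int01Z// -/c; lra.
Qed.

(** On a compact interval, continuity in the parameter is uniform. *)
Lemma near01 (X : topologicalType) (x : X) (g : R -> X -> R) (e : R) : 0 < e ->
  continuous (fun p : R * X => g p.1 p.2) ->
  \forall y \near x, forall s, `[0, 1]%classic s -> `|g s x - g s y| <= e.
Proof.
move=> e0 cg.
have [] := @compact_near_coveringP R `[0, 1]%classic.
move=> /(_ (@segment_compact _ 0 1)) nc _.
apply: (nc X (nbhs x) (fun y s => `|g s x - g s y| <= e)) => s _.
have e20 : 0 < e / 2 by rewrite divr_gt0.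
have /cvgrPdist_le/(_ _ e20) := cg (s, x).
rewrite near_simpl => -[[U V]] /= [Us Vx UV].
exists (U, V) => //= -[s' y] /= [Us' Vy].
have h1 := UV (s', x) (conj Us' (nbhs_singleton Vx)).
have h2 := UV (s', y) (conj Us' Vy).
rewrite /= in h1 h2; rewrite -(subrKA (g s x)) (splitr e).
by rewrite (le_trans (ler_normD _ _))// lerD// distrC.
Qed.

Lemma continuous_slice (X : topologicalType) (g : R -> X -> R) (y : X) :
  continuous (fun p : R * X => g p.1 p.2) -> continuous (g ^~ y).
Proof.
move=> cg s; apply: (@continuous_comp _ _ _ (fun s => (s, y)) (fun p => g p.1 p.2)).
  exact: (cvg_pair cvg_id (cvg_cst y)).
exact: cg.
Qed.

Lemma continuous_int01 (X : topologicalType) (g : R -> X -> R) :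
  continuous (fun p : R * X => g p.1 p.2) ->
  continuous (fun x => int01 (g ^~ x)).
Proof.
move=> cg x; apply/cvgrPdist_le => e e0.
apply: filterS (near01 x e0 cg) => y gxy.
have c1 y' := continuous_slice (y := y') cg.
have c2 : continuous (fun s => - g s y) by move=> s; exact: (cvgN (c1 y s)).
rewrite -int01N// -int01D//.
have c3 : continuous (fun s => g s x + - g s y).
  by move=> s; exact: (cvgD (c1 x s) (c2 s)).
rewrite (le_trans (normr_int01 c3))// -[leRHS]int01_cst.
apply: le_int01 => [||s s01]; [exact: continuous_normr|exact: cst_continuous|].
by apply: gxy; rewrite /= in_itv.
Qed.

Lemma compact_bounded_fun (X : topologicalType) (A : set X) (g : X -> R) :
  compact A -> continuous g -> [bounded g x | x in A].
Proof.
move=> cA cg; have /compact_bounded[M [Mr H]] : compact (g @` A).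
  by apply: continuous_compact => //; exact: continuous_subspaceT.
by exists M; split=> // y /H; move=> h x Ax; apply: h; exists x.
Qed.

Lemma square_integrable (g : R * R -> R) : continuous g ->
  (leb \x leb)%E.-integrable (`[0, 1] `*` `[0, 1]) (EFin \o g).
Proof.
move=> cg; apply: measurable_bounded_integrable.
- exact: measurableX.
- rewrite [X in (X < _)%E](_ : _ = (leb `[0%R, 1%R] * leb `[0%R, 1%R])%E).
    by rewrite lebesgue01 mule1 ltry.
  exact: (@product_measure1E _ _ _ _ R leb leb).
- by apply: measurable_funS (continuous2_measurable cg).
- apply: compact_bounded_fun => //.
  by apply: compact_setX; exact: segment_compact.
Qed.

Lemma continuous_swap_args (X Y : topologicalType) (f : Y -> X -> R) :
  continuous (fun p : Y * X => f p.1 p.2) -> continuous (fun p : X * Y => f p.2 p.1).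
Proof.
move=> cf p; apply: (@continuous_comp _ _ _ (fun p : X * Y => (p.2, p.1)) (fun p => f p.1 p.2)).
  by apply: cvg_pair; [exact: cvg_snd|exact: cvg_fst].
exact: cf.
Qed.

Lemma int01_square (g : R -> R -> R) : continuous (fun p => g p.1 p.2) ->
  \int[(leb \x leb)%E]_(z in `[0, 1] `*` `[0, 1]) g z.1 z.2 =
  int01 (fun s => int01 (fun t => g s t)).
Proof.
move=> cg; apply: (@Rfubini12 _ _ (measurableTypeR R) (measurableTypeR R) R leb leb
  _ _ (fun z => g z.1 z.2)) => //.
  exact: square_integrable.
move=> x _; apply: int01_integrable => /=.
exact: (@continuous_slice R (fun t s => g s t) x (continuous_swap_args cg)).
Qed.

Lemma int01C (g : R -> R -> R) : continuous (fun p => g p.1 p.2) ->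
  int01 (fun s => int01 (fun t => g s t)) = int01 (fun t => int01 (fun s => g s t)).
Proof.
move=> cg; rewrite -int01_square//.
apply: (@Rfubini21 _ _ (measurableTypeR R) (measurableTypeR R) R leb leb
  _ _ (fun z => g z.1 z.2)) => //.
  exact: square_integrable.
by move=> y _; apply: int01_integrable => /=; exact: continuous_slice.
Qed.

Lemma cube_compact : compact (@cube R).
Proof. by apply: compact_setX; [apply: compact_setX|]; exact: segment_compact. Qed.

Lemma measurable_cube :
  measurable (@cube R : set (measurableTypeR R * measurableTypeR R * measurableTypeR R)).
Proof. by apply: measurableX => //; exact: measurableX. Qed.

Lemma measure_cube : (leb \x leb \x leb)%E (@cube R) = 1%E.
Proof.
transitivity ((leb \x leb) (`[0%R, 1%R] `*` `[0%R, 1%R]) * leb `[0%R, 1%R])%E.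
  by apply: (@product_measure1E _ _ _ _ R (leb \x leb)%E leb) => //; exact: measurableX.
rewrite lebesgue01 mule1.
transitivity (leb `[0%R, 1%R] * leb `[0%R, 1%R])%E.
  exact: (@product_measure1E _ _ _ _ R leb leb).
by rewrite lebesgue01 mule1.
Qed.

Lemma cube_integrable (g : R * R * R -> R) : continuous g ->
  (leb \x leb \x leb)%E.-integrable (@cube R) (EFin \o g).
Proof.
move=> cg; apply: measurable_bounded_integrable.
- exact: measurable_cube.
- by rewrite [X in (X < _)%E]measure_cube ltry.
- by apply: measurable_funS (continuous3_measurable cg).
- by apply: compact_bounded_fun => //; exact: cube_compact.
Qed.

Lemma int01_cube (g : R * R * R -> R) : continuous g ->
  \int[(leb \x leb \x leb)%E]_(z in @cube R) g z =
  int01 (fun s => int01 (fun t => int01 (fun r => g (s, t, r)))).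
Proof.
move=> cg; transitivity (\int[(leb \x leb)%E]_(x in `[0, 1] `*` `[0, 1])
    \int[leb]_(y in `[0, 1]) g (x, y)).
  apply: (@Rfubini12_prod _ _ (measurableTypeR R) (measurableTypeR R) R leb leb
    _ (measurableTypeR R) leb _ _ g) => //.
  - exact: measurableX.
  - exact: cube_integrable.
  move=> [s t] _; apply: int01_integrable => r /=.
  apply: (@continuous_comp _ _ _ (fun r : R => (s, t, r)) g); last exact: cg.
  exact: (cvg_pair (cvg_cst (s, t)) cvg_id).
rewrite -(int01_square (g := fun s t => int01 (fun r => g (s, t, r)))).
  by apply: eq_Rintegral => -[s t].
  have c' : continuous (fun p : R * (R * R) => g (p.2.1, p.2.2, p.1)).
    move=> p; apply: (@continuous_comp _ _ _ (fun p : R * (R * R) => (p.2.1, p.2.2, p.1)) g).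
      have c2 : (fun q : R * (R * R) => q.2) @ p --> p.2 by exact: cvg_snd.
      have c21 : (fun q : R * (R * R) => q.2.1) @ p --> p.2.1.
        exact: (cvg_comp _ _ c2 cvg_fst).
      have c22 : (fun q : R * (R * R) => q.2.2) @ p --> p.2.2.
        exact: (cvg_comp _ _ c2 cvg_snd).
      exact: (cvg_pair (cvg_pair c21 c22) cvg_fst).
    exact: cg.
  exact: (continuous_int01 (g := fun r (p : R * R) => g (p.1, p.2, r))).
Qed.

End UnitInterval.

(** * Averages along coordinate lines *)

Definition o0 : 'I_3 := @Ordinal 3 0 isT.
Definition o1 : 'I_3 := @Ordinal 3 1 isT.
Definition o2 : 'I_3 := @Ordinal 3 2 isT.

Lemma ord3P (P : 'I_3 -> Prop) : P o0 -> P o1 -> P o2 -> forall i, P i.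
Proof.
move=> P0 P1 P2 [[|[|[|//]]] h].
- by rewrite (_ : Ordinal h = o0)//; exact: val_inj.
- by rewrite (_ : Ordinal h = o1)//; exact: val_inj.
- by rewrite (_ : Ordinal h = o2)//; exact: val_inj.
Qed.

Lemma sum3 (V : nmodType) (F : 'I_3 -> V) : \sum_i F i = F o0 + F o1 + F o2.
Proof.
rewrite !big_ord_recl big_ord0 addr0 addrA; congr (F _ + F _ + F _);
  exact: val_inj.
Qed.

Section Averages.
Context {R : realType}.
Local Notation E := 'rV[R]_3.
Local Notation leb := (@lebesgue_measure R).
Implicit Types (f g : E -> R) (i j : 'I_3) (x y : E).
Local Notation bv := (@basis_vec R).

(** The base point of the line through $x$ in direction $i$: its $i$-th coordinate
    is zero. *)
Definition pr i x : E := x - x 0 i *: bv i.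

Lemma prE i x j : pr i x 0 j = if i == j then 0 else x 0 j.
Proof.
rewrite !mxE eqxx/= (eq_sym j); case: eqP => [->|_]; first by rewrite mulr1 subrr.
by rewrite mulr0 subr0.
Qed.

Lemma prK i x : x 0 i *: bv i + pr i x = x.
Proof. by rewrite /pr addrC subrK. Qed.

Lemma pr_line i s x : pr i (s *: bv i + pr i x) = pr i x.
Proof.
by apply/rowP => j; rewrite !prE; case: eqP => // /eqP ij;
  rewrite mxE prE (negbTE ij) !mxE eqxx/= eq_sym (negbTE ij) mulr0 add0r.
Qed.

Lemma pr_lineN i j s x : i != j -> pr j (s *: bv i + x) = s *: bv i + pr j x.
Proof.
move=> ij; apply/rowP => k; rewrite !(prE, mxE) eqxx/=.
by case: eqP => // <-; rewrite eq_sym (negbTE ij) mulr0 add0r.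
Qed.

Lemma prC i j x : pr i (pr j x) = pr j (pr i x).
Proof. by apply/rowP => k; rewrite !prE; case: eqP => //; case: eqP. Qed.

Lemma pr_shift i j x : pr i (x + bv j) = pr i x + (if i == j then 0 else bv j).
Proof.
apply/rowP => k; rewrite !(prE, mxE).
have [->|ij] := eqVneq i j; rewrite !mxE ?eqxx/=.
  by case: eqVneq => _; rewrite !addr0.
by have [<-|//] := eqVneq i k; rewrite (negbTE ij) addr0.
Qed.

(** For a periodic function, this average over a unit segment is the average over
    the whole line. *)
Definition avg i f x : R := int01 (fun s => f (s *: bv i + pr i x)).

Lemma continuous_pr i : continuous (pr i).
Proof.
have c0 : continuous (fun y : E => y 0 i) := @coord_continuous R 1 3 0 i.
have c : continuous (fun y : E => y 0 i *: bv i).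
  move=> x; apply: (@continuous_comp _ _ _ (fun y : E => y 0 i) ( *:%R^~ (bv i))).
    exact: c0.
  exact: scalel_continuous.
by move=> x; exact: (cvgB cvg_id (c x)).
Qed.

Lemma continuous_line i x : continuous (fun s : R => s *: bv i + x).
Proof.
move=> s; apply: cvgD; last exact: cvg_cst.
by apply: cvgZr_tmp; exact: cvg_id.
Qed.

Lemma continuous_on_line f i x : continuous f -> continuous (fun s : R => f (s *: bv i + x)).
Proof.
move=> cf s; apply: (@continuous_comp _ _ _ (fun s : R => s *: bv i + x) f).
  exact: continuous_line.
exact: cf.
Qed.

Lemma continuous_lines f i (X : topologicalType) (h : X -> E) : continuous h ->
  continuous f -> continuous (fun p : R * X => f (p.1 *: bv i + h p.2)).
Proof.
move=> ch cf p; apply: (@continuous_comp _ _ _ (fun p : R * X => p.1 *: bv i + h p.2) f).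
  apply: cvgD; first by apply: cvgZr_tmp; exact: cvg_fst.
  have c2 : (fun q : R * X => q.2) @ p --> p.2 by exact: cvg_snd.
  exact: (cvg_comp _ _ c2 (ch p.2)).
exact: cf.
Qed.

Lemma Ck_avg i f : Ck 0 f -> Ck 0 (avg i f).
Proof.
move=> /Ck0P[pf cf]; apply/Ck0P; split=> [j x|].
  rewrite /avg; apply: eq_int01 => s _; rewrite pr_shift addrA.
  by case: ifP => _; [rewrite addr0|rewrite pf].
apply: (@continuous_int01 _ _ (fun s x => f (s *: bv i + pr i x))).
by apply: continuous_lines => //; exact: continuous_pr.
Qed.

Lemma avgD i f g x : Ck 0 f -> Ck 0 g ->
  avg i (fun y => f y + g y) x = avg i f x + avg i g x.
Proof.
move=> /Ck_continuous cf /Ck_continuous cg.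
by apply: int01D; exact: continuous_on_line.
Qed.

Lemma avgN i f x : Ck 0 f -> avg i (fun y => - f y) x = - avg i f x.
Proof. by move=> /Ck_continuous cf; apply: int01N; exact: continuous_on_line. Qed.

Lemma le_avg i f g x : Ck 0 f -> Ck 0 g -> (forall y, f y <= g y) ->
  avg i f x <= avg i g x.
Proof.
move=> /Ck_continuous cf /Ck_continuous cg fg.
by apply: le_int01 => //; exact: continuous_on_line.
Qed.

Lemma avg_cst i (c : R) x : avg i (fun=> c) x = c.
Proof. exact: int01_cst. Qed.

Lemma normr_avg i f x : Ck 0 f -> `|avg i f x| <= avg i (fun y => `|f y|) x.
Proof. by move=> /Ck_continuous cf; apply: normr_int01; exact: continuous_on_line. Qed.

Lemma avg_sqr i f x : Ck 0 f -> avg i f x ^+ 2 <= avg i (fun y => f y ^+ 2) x.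
Proof.
by move=> /Ck_continuous cf; apply: (int01_sqr (g := fun s => f (s *: bv i + pr i x)));
  exact: continuous_on_line.
Qed.

Lemma avg_idem i f : avg i (avg i f) = avg i f.
Proof.
apply/funext => x; rewrite {1}/avg.
by under eq_fun do rewrite /avg pr_line; rewrite int01_cst.
Qed.

Lemma avgC i j f : Ck 0 f -> avg i (avg j f) = avg j (avg i f).
Proof.
move=> /Ck_continuous cf; have [->//|ij] := eqVneq i j.
apply/funext => x.
have e k l : k != l -> avg k (avg l f) x =
    int01 (fun s => int01 (fun t => f (t *: bv l + (s *: bv k + pr l (pr k x))))).
  by move=> kl; apply: eq_int01 => s _; apply: eq_int01 => t _; rewrite pr_lineN.
have ji : j != i by rewrite eq_sym.
apply: etrans (e i j ij) _; apply: esym; apply: etrans (e j i ji) _; apply: esym.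
set y := pr i (pr j x); rewrite prC -/y.
apply: etrans (int01C (g := fun s t => f (t *: bv j + (s *: bv i + y))) _) _.
  apply: (@continuous_swap_args R R R (fun t s : R => f (t *: bv j + (s *: bv i + y)))).
  apply: (continuous_lines (i := j) (h := fun s : R => s *: bv i + y)) => //.
  exact: continuous_line.
by apply: eq_int01 => t _; apply: eq_int01 => s _; rewrite addrCA.
Qed.

Lemma periodic_intmul f (p : E) (m : int) x :
  periodic f p -> f (x + m%:~R *: p) = f x.
Proof.
move=> pf; case: m => n; first by rewrite scaler_nat periodicn.
rewrite NegzE mulrNz scaleNr.
by rewrite -[LHS](periodicn pf n.+1) scaler_nat subrK.
Qed.

(** The values of $f$ at the two ends of a period agree. *)
Lemma avg_partial i f x : Ck 1 f -> avg i (partial i f) x = 0.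
Proof.
move=> Cf; rewrite /avg /int01 /Rintegral.
rewrite (@continuous_FTC2 _ _ (fun s => f (s *: bv i + pr i x)) 0 1)//.
- have /Ck0P[pf _] : Ck 0 f by exact: CkW Cf.
  by rewrite scale1r scale0r add0r [bv i + _]addrC pf -EFinB subrr.
- apply: continuous_subspaceT; apply: continuous_on_line.
  exact/Ck_continuous/Ck_partial/Cf.
- have c : continuous (fun s : R => f (s *: bv i + pr i x)).
    by apply: continuous_on_line; exact: Ck_continuous Cf.
  split; last 2 first.
  + exact/cvg_at_right_filter/c.
  + exact/cvg_at_left_filter/c.
  by move=> s _; have [] := is_derive_line (Ck_derivable (x := s *: bv i + pr i x) (i := i) Cf).
- move=> s _; rewrite derive1E.
  by have [_ ->] := is_derive_line (Ck_derivable (x := s *: bv i + pr i x) (i := i) Cf).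
Qed.

Lemma line_increment i f (a b : R) y : Ck 1 f -> 0 <= a -> a <= b -> b <= 1 ->
  `|f (b *: bv i + y) - f (a *: bv i + y)| <=
  int01 (fun s => `|partial i f (s *: bv i + y)|).
Proof.
move=> Cf a0 ab b1.
have cg : continuous (fun s : R => partial i f (s *: bv i + y)).
  by apply: continuous_on_line; exact/Ck_continuous/Ck_partial/Cf.
have cng : continuous (fun s : R => `|partial i f (s *: bv i + y)|).
  exact: continuous_normr.
have := ab; rewrite le_eqVlt => /predU1P[->|{}ab].
  by rewrite subrr normr0; apply: Rintegral_ge0.
have c : continuous (fun s : R => f (s *: bv i + y)).
  by apply: continuous_on_line; exact: Ck_continuous Cf.
rewrite -lee_fin -abse_EFin EFinB.
rewrite -(@continuous_FTC2 _ (fun s => partial i f (s *: bv i + y))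
  (fun s => f (s *: bv i + y)) a b)//.
- rewrite /int01 /Rintegral fineK; last first.
    by apply: integrable_fin_num => //; exact: int01_integrable.
  apply: le_trans (le_abse_integral _ _ _) _ => //.
    apply/measurable_EFinP; apply: measurable_funTS.
    exact: continuous_measurable_fun.
  apply: ge0_subset_integral => //.
    apply/measurable_EFinP; apply: measurable_funTS.
    exact: continuous_measurable_fun.
  by apply: subset_itv; rewrite bnd_simp.
- exact: continuous_subspaceT.
- split; last 2 first.
  + exact/cvg_at_right_filter/c.
  + exact/cvg_at_left_filter/c.
  by move=> s _; have [] := is_derive_line (Ck_derivable (x := s *: bv i + y) (i := i) Cf).
- move=> s _; rewrite derive1E.
  by have [_ ->] := is_derive_line (Ck_derivable (x := s *: bv i + y) (i := i) Cf).
Qed.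

Lemma Ck_normr f : Ck 0 f -> Ck 0 (fun x => `|f x|).
Proof.
move=> /Ck0P[pf cf]; apply/Ck0P; split=> [i x|x]; first by rewrite pf.
exact: (cvg_norm (cf x)).
Qed.

(** By periodicity the $i$-th coordinate of $x$ may be taken in $[0,1]$; the
    increments of $f$ along that segment are then bounded by [line_increment]. *)
Lemma sub_avg i f x : Ck 1 f ->
  `|f x - avg i f x| <= avg i (fun y => `|partial i f y|) x.
Proof.
move=> Cf; have C0f : Ck 0 f by exact: CkW Cf.
have [pf cf] := (Ck0P _).1 C0f.
pose m := Num.floor (x 0 i); pose a := x 0 i - m%:~R.
have a01 : 0 <= a <= 1.
  have := floor_itv (x 0 i); rewrite -/m intrD => /andP[m1 m2].
  by rewrite /a subr_ge0 m1/= lerBlDl ltW.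
have -> : f x = f (a *: bv i + pr i x).
  have -> : a *: bv i + pr i x = x + (- m)%:~R *: bv i.
    by rewrite -[in RHS](prK i x) /a scalerBl mulrNz scaleNr addrAC.
  by rewrite periodic_intmul.
set y := pr i x.
have cl : continuous (fun s : R => f (s *: bv i + y)) by exact: continuous_on_line.
have cc : continuous (fun s : R => f (a *: bv i + y) + - f (s *: bv i + y)).
  move=> s; apply: cvgD; first exact: cvg_cst.
  exact: (cvgN (cl s)).
have -> : f (a *: bv i + y) - avg i f x =
    int01 (fun s => f (a *: bv i + y) + - f (s *: bv i + y)).
  rewrite int01D ?int01_cst ?int01N//; first exact: cst_continuous.
  by move=> s; exact: (cvgN (cl s)).
rewrite (le_trans (normr_int01 cc))// -[leRHS]int01_cst.
apply: le_int01 => [||s /andP[s0 s1]]; first exact: continuous_normr.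
  exact: cst_continuous.
move: a01 => /andP[a0 a1]; have [sa|/ltW as_] := leP s a.
  exact: line_increment.
by rewrite distrC; exact: line_increment.
Qed.

End Averages.

(** * Integration on the torus and Poincare's inequality *)

Section TorusIntegral.
Context {R : realType}.
Local Notation E := 'rV[R]_3.
Local Notation leb := (@lebesgue_measure R).
Local Notation leb3 := (leb \x leb \x leb)%E.
Implicit Types (f g : E -> R) (i j : 'I_3) (x y : E).
Local Notation bv := (@basis_vec R).

(** The real value of [integral_torus], on continuous functions. *)
Definition tint f : R := \int[leb3]_(z in @cube R) f (torus_point z).

Lemma torus_pointE (z : R * R * R) :
  torus_point z = z.2 *: bv o2 + (z.1.2 *: bv o1 + z.1.1 *: bv o0).
Proof.
apply/rowP => j; rewrite !mxE eqxx/=.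
by elim/ord3P: j => /=; rewrite !(mulr1, mulr0, add0r, addr0).
Qed.

Lemma continuous_torus_point : continuous (@torus_point R).
Proof.
move=> z; have -> : @torus_point R = (fun z : R * R * R =>
    z.2 *: bv o2 + (z.1.2 *: bv o1 + z.1.1 *: bv o0)).
  by apply/funext => y; exact: torus_pointE.
have c1 : (fun q : R * R * R => q.1) @ z --> z.1 by exact: cvg_fst.
apply: cvgD; first by apply: cvgZr_tmp; exact: cvg_snd.
apply: cvgD; apply: cvgZr_tmp; first exact: (cvg_comp _ _ c1 cvg_snd).
exact: (cvg_comp _ _ c1 cvg_fst).
Qed.

Lemma continuous_on_cube f : continuous f -> continuous (f \o @torus_point R).
Proof.
by move=> cf z; apply: continuous_comp; [exact: continuous_torus_point|exact: cf].
Qed.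

(** Fubini's theorem; the mean of $f$ is reached by averaging one coordinate at a
    time. *)
Lemma tint_avg f x : Ck 0 f -> tint f = avg o0 (avg o1 (avg o2 f)) x.
Proof.
move=> /Ck_continuous cf; rewrite /tint.
rewrite (int01_cube (g := f \o @torus_point R)); last exact: continuous_on_cube.
apply: eq_int01 => s _; apply: eq_int01 => t _; apply: eq_int01 => r _ /=.
congr f; rewrite torus_pointE; congr (_ + _) => /=.
apply/rowP => j; rewrite !(prE, mxE) eqxx/=.
by elim/ord3P: j => /=; rewrite !(mulr1, mulr0, add0r, addr0, eqxx).
Qed.

Lemma tint_integrable f : Ck 0 f ->
  leb3.-integrable (@cube R) (EFin \o (f \o @torus_point R)).
Proof.
by move=> /Ck_continuous cf; apply: cube_integrable; exact: continuous_on_cube.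
Qed.

Lemma integral_torusE f : Ck 0 f -> integral_torus f = (tint f)%:E.
Proof.
move=> Cf; rewrite /tint /Rintegral fineK//.
by apply: integrable_fin_num (tint_integrable Cf); exact: measurable_cube.
Qed.

Lemma tintD f g : Ck 0 f -> Ck 0 g -> tint (fun x => f x + g x) = tint f + tint g.
Proof.
move=> /tint_integrable cf /tint_integrable cg.
exact: (RintegralD measurable_cube cf cg).
Qed.

Lemma tintZ (c : R) f : Ck 0 f -> tint (fun x => c * f x) = c * tint f.
Proof.
move=> /tint_integrable cf.
exact: (RintegralZl _ measurable_cube cf).
Qed.

Lemma tintN f : Ck 0 f -> tint (fun x => - f x) = - tint f.
Proof.
move=> Cf; rewrite -mulN1r -tintZ//; congr tint.
by apply/funext => x; rewrite mulN1r.
Qed.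

Lemma tintB f g : Ck 0 f -> Ck 0 g -> tint (fun x => f x - g x) = tint f - tint g.
Proof. by move=> Cf Cg; rewrite tintD ?tintN//; exact: CkN. Qed.

Lemma le_tint f g : Ck 0 f -> Ck 0 g -> (forall x, f x <= g x) -> tint f <= tint g.
Proof.
move=> /tint_integrable cf /tint_integrable cg fg.
by apply: (le_Rintegral measurable_cube cf cg) => x _; exact: fg.
Qed.

Lemma tint_ge0 f : (forall x, 0 <= f x) -> 0 <= tint f.
Proof. by move=> f0; apply: Rintegral_ge0. Qed.

Lemma tint_cst (c : R) : tint (fun=> c) = c.
Proof.
rewrite (tint_avg 0 (Ck_cst 0 c)).
have a i : avg i (fun=> c) = (fun=> c) by apply/funext => x; exact: avg_cst.
by rewrite !a.
Qed.

Lemma normr_tint f (M : R) : Ck 0 f -> (forall x, `|f x| <= M) -> `|tint f| <= M.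
Proof.
move=> Cf fM; rewrite ler_norml; apply/andP; split.
  rewrite -[leLHS]tint_cst; apply: le_tint => // [|x]; first exact: Ck_cst.
  by have := fM x; rewrite ler_norml => /andP[].
rewrite -[leRHS]tint_cst; apply: le_tint => // [|x]; first exact: Ck_cst.
by have := fM x; rewrite ler_norml => /andP[].
Qed.

Lemma tint_of_avg i f : Ck 0 f -> tint (avg i f) = tint f.
Proof.
move=> Cf; rewrite (tint_avg 0 (Ck_avg i Cf)) (tint_avg 0 Cf).
elim/ord3P: i.
- by rewrite (avgC o2 o0 Cf) (avgC o1 o0 (Ck_avg o2 Cf)) avg_idem.
- by rewrite (avgC o2 o1 Cf) avg_idem.
- by rewrite avg_idem.
Qed.

(** The derivative of a periodic function has mean zero along each line. *)
Lemma tint_partial i f : Ck 1 f -> tint (partial i f) = 0.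
Proof.
move=> Cf; rewrite -(tint_of_avg i); last exact: Ck_partial.
have -> : avg i (partial i f) = (fun=> 0) by apply/funext => x; exact: avg_partial.
exact: tint_cst.
Qed.

Lemma tint_by_parts i f g : Ck 1 f -> Ck 1 g ->
  tint (fun x => f x * partial i g x) = - tint (fun x => partial i f x * g x).
Proof.
move=> Cf Cg; apply/eqP; rewrite -addr_eq0; apply/eqP.
have C0f := CkW (leqnSn 0) Cf; have C0g := CkW (leqnSn 0) Cg.
rewrite -tintD; last 2 first.
- by apply: CkM => //; exact: Ck_partial.
- by apply: CkM => //; exact: Ck_partial.
rewrite -[RHS](tint_partial i (CkM Cf Cg)); congr tint; apply/funext => x.
by rewrite (partialM (Ck_derivable Cf) (Ck_derivable Cg)) addrC.
Qed.

(** Every point has a translate in the unit cube, which is compact. *)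
Lemma Ck0_bounded f : Ck 0 f -> exists2 M : R, 0 <= M & forall x, `|f x| <= M.
Proof.
move=> Cf; have [pf cf] := (Ck0P _).1 Cf.
pose K := [set v : E | forall i, v ord0 i \in `[0, 1]%R].
have cK : compact K.
  apply: (@rV_compact _ _ (fun=> `[(0 : R), 1]%classic)).
  by move=> _; apply: segment_compact.
have [M [Mr HM]] := compact_bounded_fun cK cf.
exists (`|M| + 1) => [|x]; first by rewrite addr_ge0.
pose m i := Num.floor (x 0 i).
pose y := x + (- m o0)%:~R *: bv o0 + (- m o1)%:~R *: bv o1 + (- m o2)%:~R *: bv o2.
have -> : f x = f y by rewrite !periodic_intmul.
apply: HM; first by rewrite ltr_pwDr// ler_norm.
move=> i; rewrite /= in_itv/=.
have -> : y ord0 i = x 0 i - (m i)%:~R.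
  rewrite !mxE eqxx/=; elim/ord3P: i => /=;
  by rewrite !(mulr1, mulr0, add0r, addr0) mulrNz.
have := floor_itv (x 0 i); rewrite -/(m i) intrD => /andP[m1 m2].
by rewrite subr_ge0 m1/= lerBlDl ltW.
Qed.

(** Replacing the coordinates by their averages one at a time changes $f$ at
    each step by at most the average of a partial derivative. *)
Lemma poincare f : Ck 1 f -> tint f = 0 ->
  tint (fun x => f x ^+ 2) <= 3 * tint (fun x => \sum_i partial i f x ^+ 2).
Proof.
move=> Cf tf0; have C0f := CkW (leqnSn 0) Cf.
have Cd i : Ck 0 (partial i f) by exact: Ck_partial.
have Cn i : Ck 0 (fun x => `|partial i f x|) by exact: Ck_normr.
have Cd2 i : Ck 0 (fun x => partial i f x ^+ 2) by exact: Ck_sqr.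
have Ca i : Ck 0 (avg i f) by exact: Ck_avg.
have sub_mean j (g h : E -> R) x : Ck 0 g -> Ck 0 h ->
    avg j g x - avg j h x = avg j (fun y => g y - h y) x.
  by move=> Cg Ch; rewrite avgD ?avgN//; exact: CkN.
pose G0 := avg o0 (fun y => `|partial o0 f y|).
pose G1 := avg o0 (avg o1 (fun y => `|partial o1 f y|)).
pose G2 := avg o0 (avg o1 (avg o2 (fun y => `|partial o2 f y|))).
have f_le x : `|f x| <= G0 x + G1 x + G2 x.
  have {1}-> : f x = (f x - avg o0 f x) + (avg o0 f x - avg o0 (avg o1 f) x)
      + (avg o0 (avg o1 f) x - avg o0 (avg o1 (avg o2 f)) x).
    by rewrite -(tint_avg x C0f) tf0; ring.
  have step j (g h k : E -> R) : Ck 0 g -> Ck 0 h -> Ck 0 k ->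
      (forall y, `|g y - h y| <= k y) ->
      forall y, `|avg j g y - avg j h y| <= avg j k y.
    move=> Cg Ch Ck' H y; rewrite sub_mean//.
    rewrite (le_trans (normr_avg _ _ (CkB Cg Ch)))//.
    by apply: le_avg => //; exact/Ck_normr/CkB.
  rewrite (le_trans (ler_normD _ _))// lerD//.
    rewrite (le_trans (ler_normD _ _))// lerD//; first exact: sub_avg.
    by apply: (step _ _ _ _ C0f (Ca o1) (Ck_avg o1 (Cn o1))) => y; exact: sub_avg.
  apply: (step _ _ _ _ (Ca o1) (Ck_avg o1 (Ca o2)) (Ck_avg o1 (Ck_avg o2 (Cn o2)))).
  by apply: (step _ _ _ _ C0f (Ca o2) (Ck_avg o2 (Cn o2))) => y; exact: sub_avg.
have sqr_step j (g h : E -> R) : Ck 0 g -> Ck 0 h ->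
    (forall y, g y ^+ 2 <= h y) -> forall y, avg j g y ^+ 2 <= avg j h y.
  move=> Cg Ch gh y; rewrite (le_trans (avg_sqr _ _ Cg))//.
  by apply: le_avg => //; exact: Ck_sqr.
pose H0 := avg o0 (fun y => partial o0 f y ^+ 2).
pose H1 := avg o0 (avg o1 (fun y => partial o1 f y ^+ 2)).
pose H2 := avg o0 (avg o1 (avg o2 (fun y => partial o2 f y ^+ 2))).
have nsq i y : `|partial i f y| ^+ 2 <= partial i f y ^+ 2 by rewrite real_normK ?num_real.
have GH0 x : G0 x ^+ 2 <= H0 x := sqr_step _ _ _ (Cn o0) (Cd2 o0) (nsq o0) x.
have GH1 x : G1 x ^+ 2 <= H1 x.
  apply: (sqr_step _ _ _ (Ck_avg o1 (Cn o1)) (Ck_avg o1 (Cd2 o1))).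
  exact: (sqr_step _ _ _ (Cn o1) (Cd2 o1) (nsq o1)).
have GH2 x : G2 x ^+ 2 <= H2 x.
  apply: (sqr_step _ _ _ (Ck_avg o1 (Ck_avg o2 (Cn o2))) (Ck_avg o1 (Ck_avg o2 (Cd2 o2)))).
  apply: (sqr_step _ _ _ (Ck_avg o2 (Cn o2)) (Ck_avg o2 (Cd2 o2))).
  exact: (sqr_step _ _ _ (Cn o2) (Cd2 o2) (nsq o2)).
have CH0 : Ck 0 H0 := Ck_avg o0 (Cd2 o0).
have CH1 : Ck 0 H1 := Ck_avg o0 (Ck_avg o1 (Cd2 o1)).
have CH2 : Ck 0 H2 := Ck_avg o0 (Ck_avg o1 (Ck_avg o2 (Cd2 o2))).
have CH01 : Ck 0 (fun x => H0 x + H1 x) := CkD CH0 CH1.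
have CH : Ck 0 (fun x => H0 x + H1 x + H2 x) := CkD CH01 CH2.
(* The factor 3 comes from (a + b + c)^2 <= 3 (a^2 + b^2 + c^2). *)
have key x : f x ^+ 2 <= 3 * (H0 x + H1 x + H2 x).
  have := GH0 x; have := GH1 x; have := GH2 x => h2 h1 h0.
  have fs : f x ^+ 2 <= (G0 x + G1 x + G2 x) ^+ 2.
    have := f_le x; move: (G0 x + _ + _) => c fc.
    by rewrite -[f x ^+ 2]real_normK ?num_real// lerXn2r ?nnegrE// (le_trans _ fc).
  move: fs h0 h1 h2; move: (G0 x) (G1 x) (G2 x) (H0 x) (H1 x) (H2 x) (f x ^+ 2).
  move=> a b c A B C F hF hA hB hC.
  have := sqr_ge0 (a - b); have := sqr_ge0 (a - c); have := sqr_ge0 (b - c); lra.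
have CH3 : Ck 0 (fun x => 3 * (H0 x + H1 x + H2 x)) by apply: CkZ.
have /le_trans := le_tint (Ck_sqr C0f) CH3 key; apply.
rewrite (tintZ _ CH) ler_pM2l ?ltr0n// (tintD CH01 CH2) (tintD CH0 CH1).
rewrite /H0 /H1 /H2 (tint_of_avg _ (Cd2 o0)).
rewrite (tint_of_avg _ (Ck_avg o1 (Cd2 o1))) (tint_of_avg _ (Cd2 o1)).
rewrite (tint_of_avg _ (Ck_avg o1 (Ck_avg o2 (Cd2 o2)))).
rewrite (tint_of_avg _ (Ck_avg o2 (Cd2 o2))) (tint_of_avg _ (Cd2 o2)).
rewrite -(tintD (Cd2 o0) (Cd2 o1)) -(tintD (CkD (Cd2 o0) (Cd2 o1)) (Cd2 o2)).
by under [X in _ <= tint X]eq_fun do rewrite sum3.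
Qed.

End TorusIntegral.

(** * Symmetry of second derivatives, and a derivative calculator *)

Section Schwarz.
Context {R : realType}.
Local Notation E := 'rV[R]_3.
Implicit Types (f : E -> R) (i j : 'I_3) (x y : E) (h : R).
Local Notation bv := (@basis_vec R).

Lemma dist_le_halves (a b c e : R) :
  `|a - c| <= e / 2 -> `|b - c| <= e / 2 -> `|b - a| <= e.
Proof.
move=> ac bc; have -> : b - a = (b - c) - (a - c) by ring.
by rewrite (le_trans (ler_normB _ _))// (splitr e) lerD.
Qed.

Lemma line_MVT f i y h : 0 < h -> Ck 1 f ->
  exists2 s, 0 < s < h & f (h *: bv i + y) - f y = partial i f (s *: bv i + y) * h.
Proof.
move=> h0 Cf.
have cl : continuous (fun s : R => f (s *: bv i + y)).
  by apply: continuous_on_line; exact: Ck_continuous Cf.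
have dl s : s \in `]0, h[%R -> is_derive s 1 (fun s : R => f (s *: bv i + y))
    (partial i f (s *: bv i + y)).
  by move=> _; exact: (is_derive_line (Ck_derivable (i := i) Cf)).
have [s + ] := MVT h0 dl (continuous_subspaceT cl).
rewrite in_itv/= scale0r add0r subr0 => s0h e.
by exists s.
Qed.

(** The mean value theorem is applied to $y\mapsto f(y+he_j)-f(y)$ in direction $i$,
    then to $\partial_if$ in direction $j$. *)
Lemma second_difference f i j x h : 0 < h -> Ck 2 f ->
  exists s t, [/\ 0 < s < h, 0 < t < h &
  f (h *: bv i + (h *: bv j + x)) - f (h *: bv j + x) - (f (h *: bv i + x) - f x)
    = partial j (partial i f) (t *: bv j + (s *: bv i + x)) * h * h].
Proof.
move=> h0 Cf.
pose g y := f (h *: bv j + y) - f y.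
have Cs k (F : E -> R) (p : E) : Ck k F -> Ck k (fun y => F (p + y)).
  have base (F' : E -> R) : Ck 0 F' -> Ck 0 (fun y => F' (p + y)).
    move=> /Ck0P[pF cF]; apply/Ck0P; split=> [l y|y]; first by rewrite addrA pF.
    apply: (@continuous_comp _ _ _ (fun y : E => p + y) F'); last exact: cF.
    apply: (@cvgD R E E (nbhs y) _ (cst p) id p y); first exact: cvg_cst.
    exact: cvg_id.
  elim: k F => [|k ih] F; first exact: base.
  move=> CF; apply/CkSP; split; first by apply: base; exact: CkW CF.
  have e l y : (fun d : R => d^-1 *: (((fun z => F (p + z)) \o shift y) (d *: bv l)
      - F (p + y))) = (fun d : R => d^-1 *: ((F \o shift (p + y)) (d *: bv l) - F (p + y))).
    by apply/funext => d /=; rewrite addrCA.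
  move=> l; split=> [y|].
    by have := Ck_derivable (x := p + y) (i := l) CF; rewrite /derivable e.
  have -> : partial l (fun y => F (p + y)) = (fun y => partial l F (p + y)).
    by apply/funext => y; rewrite /partial /derive e.
  exact/ih/Ck_partial.
have Cf1 : Ck 1 f by exact: CkW Cf.
have Csf : Ck 1 (fun y => f (h *: bv j + y)) by exact: Cs.
have Cg : Ck 1 g by exact: (CkB Csf Cf1).
have [s s0h e1] := line_MVT i x h0 Cg.
have pg y : partial i g y = partial i f (h *: bv j + y) - partial i f y.
  apply: etrans (partialB (Ck_derivable (x := y) (i := i) Csf)
    (Ck_derivable (x := y) (i := i) Cf1)) _.
  have -> // : partial i (fun y => f (h *: bv j + y)) y = partial i f (h *: bv j + y).
  rewrite /partial /derive.
  by under [X in lim (X @ _) = _]eq_fun do rewrite /= addrCA.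
have [t t0h e2] := line_MVT j (s *: bv i + x) h0 (Ck_partial i Cf).
exists s, t; split=> //.
by rewrite -e2 -pg -e1 /g addrCA; ring.
Qed.

(** Both mixed derivatives are limits of the same second difference quotient. *)
Lemma partialC f i j : Ck 2 f -> partial i (partial j f) = partial j (partial i f).
Proof.
move=> Cf; apply/funext => x.
have cont k l : continuous (fun p : R * R =>
    partial l (partial k f) (p.1 *: bv l + (p.2 *: bv k + x))).
  apply: (continuous_lines (h := fun t : R => t *: bv k + x)).
    exact: continuous_line.
  by apply: Ck_continuous (Ck_partial l (Ck_partial k Cf)).
apply/eqP; rewrite -subr_eq0 -normr_le0; apply/ler_addgt0Pr => e e0; rewrite add0r.
have e20 : 0 < e / 2 by rewrite divr_gt0.
have at0 k l : exists2 d : R, 0 < d & forall s t, 0 < s < d -> 0 < t < d ->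
    `|partial l (partial k f) x - partial l (partial k f) (t *: bv l + (s *: bv k + x))|
    <= e / 2.
  have /cvgrPdist_le/(_ _ e20) := cont k l (0, 0).
  rewrite near_simpl => /nbhs_ballP[d /= d0 H]; exists d => // s t /andP[s0 sd] /andP[t0 td].
  have := H (t, s); rewrite /= !scale0r !add0r; apply.
  by split; rewrite /ball/= sub0r normrN gtr0_norm.
have [d1 d10 H1] := at0 i j; have [d2 d20 H2] := at0 j i.
pose h := Num.min d1 d2; have h0 : 0 < h by rewrite lt_min d10.
have [s [t [/andP[s0 sh] /andP[t0 th] e1]]] := second_difference i j x h0 Cf.
have [s' [t' [/andP[s'0 s'h] /andP[t'0 t'h] e2]]] := second_difference j i x h0 Cf.
have k1 := H1 s t; have k2 := H2 s' t'.
move: sh th s'h t'h; rewrite !lt_min => /andP[sd1 sd2] /andP[td1 td2] /andP[s'd1 s'd2] /andP[t'd1 t'd2].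
rewrite s0 t0 sd1 td1 in k1; rewrite s'0 t'0 s'd2 t'd2 in k2.
have {}k1 := k1 isT isT; have {}k2 := k2 isT isT.
have eq12 : partial j (partial i f) (t *: bv j + (s *: bv i + x)) =
    partial i (partial j f) (t' *: bv i + (s' *: bv j + x)).
  have hh : h != 0 by rewrite gt_eqF.
  have alg (a b c d P Q : R) :
      a - b - (c - d) = P * h * h -> a - c - (b - d) = Q * h * h -> P = Q.
    by move=> eP eQ; apply: (mulIf hh); apply: (mulIf hh); rewrite -eP -eQ; ring.
  by rewrite addrCA in e2; exact: alg e1 e2.
rewrite eq12 in k1.
exact: dist_le_halves k1 k2.
Qed.

End Schwarz.

Section VectorFields.
Context {R : realType}.
Local Notation E := 'rV[R]_3.
Implicit Types (u : E -> E) (i j : 'I_3).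

Lemma Ck_coord k u j : Ck k u -> Ck k (fun x => u x 0 j) /\
  forall s x, (size s <= k)%N -> partials s (fun x => u x 0 j) x = partials s u x 0 j.
Proof.
have base u' : Ck 0 u' -> Ck 0 (fun x => u' x 0 j).
  move=> /Ck0P[pu cu]; apply/Ck0P; split=> [i x|x]; first by rewrite pu.
  apply: (@continuous_comp _ _ _ u' (fun y : E => y 0 j)); first exact: cu.
  exact: coord_continuous.
elim: k u => [|k ih] u Cu.
  by split=> [|s x]; [exact: base|rewrite leqn0 => /nilP ->].
have C0u : Ck 0 u by exact: CkW Cu.
have pj i : partial i (fun x => u x 0 j) = (fun x => partial i u x 0 j).
  by apply/funext => x; rewrite /partial [in RHS](derive_mx (Ck_derivable Cu)) mxE.
split.
  apply/CkSP; split; first exact: base.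
  move=> i; split=> [x|].
    exact: ((derivable_mxP u x (basis_vec i)).1 (Ck_derivable Cu)).
  by rewrite pj; have [] := ih _ (Ck_partial i Cu).
move=> s x; case/lastP: s => [//|s i]; rewrite size_rcons ltnS => sk.
by rewrite !partials_rcons pj; have [_ ->] := ih _ (Ck_partial i Cu).
Qed.

Lemma partial_coord u i j x : Ck 1 u ->
  partial i (fun x => u x 0 j) x = partial i u x 0 j.
Proof. by move=> /(Ck_coord j)[_ /(_ [:: i] x isT)]. Qed.

End VectorFields.

Section HasPartial.
Context {R : realType}.
Local Notation E := 'rV[R]_3.
Implicit Types (f g : E -> R) (i : 'I_3).

(** Differentiability together with the value of the derivative: the rules below
    then follow the syntax of an expression and produce both. An inductive type
    keeps unification from unfolding the derivatives. *)
Variant has_partial i f f' : Prop := HasPartial of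
  forall x, derivable f x (basis_vec i) /\ partial i f x = f' x.

Lemma has_partialE i f f' x : has_partial i f f' -> partial i f x = f' x.
Proof. by case=> H; have [] := H x. Qed.

Lemma has_partialW i f : Ck 1 f -> has_partial i f (partial i f).
Proof. by move=> Cf; split=> x; split=> //; exact: Ck_derivable Cf. Qed.

Lemma has_partial_eq i f f' g' : has_partial i f f' -> (forall x, f' x = g' x) ->
  has_partial i f g'.
Proof. by case=> H e; split=> x; have [? ->] := H x. Qed.

Lemma has_partial_cst i (c : R) : has_partial i (fun=> c) (fun=> 0).
Proof. by split=> x; split; [exact: derivable_cst|exact: derive_cst]. Qed.

Lemma has_partialD i f g f' g' : has_partial i f f' -> has_partial i g g' ->
  has_partial i (fun x => f x + g x) (fun x => f' x + g' x).
Proof.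
case=> Hf [Hg]; split=> x; have [df ef] := Hf x; have [dg eg] := Hg x.
by split; [exact: derivableD|rewrite (partialD df dg) ef eg].
Qed.

Lemma has_partialN i f f' : has_partial i f f' ->
  has_partial i (fun x => - f x) (fun x => - f' x).
Proof.
case=> Hf; split=> x; have [df ef] := Hf x.
by split; [exact: derivableN|rewrite (partialN df) ef].
Qed.

Lemma has_partialM i f g f' g' : has_partial i f f' -> has_partial i g g' ->
  has_partial i (fun x => f x * g x) (fun x => f' x * g x + f x * g' x).
Proof.
case=> Hf [Hg]; split=> x; have [df ef] := Hf x; have [dg eg] := Hg x.
by split; [exact: (derivableM df dg)|rewrite (partialM df dg) ef eg].
Qed.

Lemma has_partial_sqr i f f' : has_partial i f f' ->
  has_partial i (fun x => f x ^+ 2) (fun x => 2 * f x * f' x).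
Proof.
move=> Hf; apply: has_partial_eq (has_partialM Hf Hf) _ => x; ring.
Qed.

Lemma has_partialV i f f' : (forall x, f x != 0) -> has_partial i f f' ->
  has_partial i (fun x => (f x)^-1) (fun x => - f' x * (f x)^-1 ^+ 2).
Proof.
move=> f0 [Hf]; split=> x; have [df ef] := Hf x.
by split; [exact: derivableV|rewrite (partialV (f0 x) df) ef exprVn].
Qed.

Lemma has_partial_sum i n (F F' : 'I_n -> E -> R) :
  (forall l, has_partial i (F l) (F' l)) ->
  has_partial i (fun x => \sum_l F l x) (fun x => \sum_l F' l x).
Proof.
move=> HF; split=> x; split.
  have -> : (fun y => \sum_l F l y) = \sum_l F l.
    by apply/funext => y; rewrite fct_sumE.
  by apply: derivable_sum => l; have [H] := HF l; have [] := H x.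
rewrite partial_sum; last by move=> l; have [H] := HF l; have [] := H x.
by apply: eq_bigr => l _; have [H] := HF l; have [] := H x.
Qed.

End HasPartial.

(** [ck] proves that an expression is $C^k$ by following its syntax down to
    hypotheses of at least that order; [hp] computes its partial derivatives in the
    same way. *)
Ltac ck_atom := match goal with
  | H : Ck ?k ?f |- Ck ?k ?f => exact H
  | H : Ck _ ?f |- Ck _ ?f => refine (CkW _ H); exact (erefl true)
  | H : forall i, Ck _ (?F i) |- Ck _ (?F ?j) => refine (CkW _ (H j)); exact (erefl true)
  end.

Ltac ck := lazymatch goal with
  | |- forall _, Ck _ _ => intro; ck
  | |- @Ck ?R ?V ?k (fun x => ?f x) => change (@Ck R V k f); ck
  | |- Ck _ (fun x => @?f x + @?g x) => apply (@CkD _ _ _ f g); ck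
  | |- Ck _ (fun x => - @?f x) => apply (@CkN _ _ _ f); ck
  | |- Ck _ (fun x => @?f x * @?g x) => apply (@CkM _ _ f g); ck
  | |- Ck _ (fun x => @?f x ^+ 2) => first [ck_atom | apply (@Ck_sqr _ _ f); ck]
  | |- Ck _ (fun x => bigop _ _ (@?b x)) => apply: Ck_sum => ?; ck
  | |- Ck _ (fun=> ?c) => apply Ck_cst
  | |- Ck _ (partial ?i ?f) => first [ck_atom | apply (Ck_partial i); ck]
  | |- _ => ck_atom
  end.

Ltac hp := lazymatch goal with
  | |- @has_partial ?R ?i (fun x => ?f x) ?g => change (@has_partial R i f g); hp
  | |- has_partial _ (fun x => @?f x + @?g x) _ => apply (@has_partialD _ _ f g); hp
  | |- has_partial _ (fun x => - @?f x) _ => apply (@has_partialN _ _ f); hp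
  | |- has_partial _ (fun x => @?f x * @?g x) _ => apply (@has_partialM _ _ f g); hp
  | |- has_partial _ (fun x => @?f x ^+ 2) _ => apply (@has_partial_sqr _ _ f); hp
  | |- has_partial _ (fun=> ?c) _ => apply has_partial_cst
  | |- has_partial _ (fun x => bigop _ _ (@?b x)) _ => apply: has_partial_sum => ?; hp
  | |- _ => match goal with
     | H : has_partial ?i ?f _ |- has_partial ?i ?f _ => exact H
     | H : forall i, has_partial i ?f _ |- has_partial _ ?f _ => apply H
     | H : forall i j, has_partial i (?F j) _ |- has_partial _ (?F _) _ => apply H
     | _ => apply has_partialW; ck
     end
  end.

(** Deciding ring equalities compares atoms up to conversion, which is costly for
    derivatives: name them first. *)
Ltac gen_partials := repeat match goal with
  | |- context [partial ?i ?f ?x] => generalize (partial i f x); intro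
  end.

(** * The energy identity at a fixed time *)

Section Divergence.
Context {R : realType}.
Local Notation E := 'rV[R]_3.

Lemma tint_sum n (F : 'I_n -> E -> R) : (forall l, Ck 0 (F l)) ->
  tint (fun x => \sum_l F l x) = \sum_l tint (F l).
Proof.
elim: n F => [|n ih] F CF.
  rewrite big_ord0; under eq_fun do rewrite big_ord0.
  exact: tint_cst.
rewrite big_ord_recl; under eq_fun do rewrite big_ord_recl.
by rewrite tintD ?ih//; ck.
Qed.

Definition divv (V : 'I_3 -> E -> R) (x : E) := \sum_i partial i (V i) x.

Definition lap (f : E -> R) (x : E) := \sum_i partial i (partial i f) x.

(** The divergence theorem, for the field $\varphi V$. *)
Lemma tint_div (V : 'I_3 -> E -> R) phi : (forall i, Ck 1 (V i)) -> Ck 1 phi ->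
  tint (fun x => \sum_i V i x * partial i phi x + divv V x * phi x) = 0.
Proof.
move=> CV Cphi.
have C1 i : Ck 0 (fun x => V i x * partial i phi x) by ck.
have C2 i : Ck 0 (fun x => partial i (V i) x * phi x) by ck.
rewrite /divv tintD; [|ck|ck]; rewrite -/divv.
rewrite tint_sum//.
have -> : (fun x => divv V x * phi x) = (fun x => \sum_i partial i (V i) x * phi x).
  by apply/funext => x; rewrite /divv mulr_suml.
rewrite tint_sum// -big_split big1// => i _ /=.
by rewrite tint_by_parts// addrC subrr.
Qed.

(** Subtracting $u_j$ times the mass balance from the momentum balance leaves
    $\rho$ times the transport equation for $u_j$. *)
Lemma velocity_eq (rho sig : E -> R) (u v : 'I_3 -> E -> R) (F : 'I_3 -> E -> R) x j :
  Ck 1 rho -> (forall i, Ck 1 (u i)) -> rho x != 0 ->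
  sig x + divv (fun i y => rho y * u i y) x = 0 ->
  sig x * u j x + rho x * v j x
    + \sum_i partial i (fun y => rho y * u j y * u i y) x = - (rho x * F j x) ->
  v j x = - \sum_i u i x * partial i (u j) x - F j x.
Proof.
move=> Crho Cu r0 mass mom.
have e i : partial i (fun y => rho y * u j y * u i y) x =
    partial i (fun y => rho y * u i y) x * u j x + rho x * (u i x * partial i (u j) x).
  eassert (h1 : has_partial i (fun y => rho y * u j y * u i y) _) by hp.
  eassert (h2 : has_partial i (fun y => rho y * u i y) _) by hp.
  rewrite (has_partialE x h1); rewrite (has_partialE x h2); ring.
move: mom; under eq_bigr do rewrite e.
rewrite big_split/= -mulr_suml -mulr_sumr -/(divv (fun i y => rho y * u i y) x).
have -> : divv (fun i y => rho y * u i y) x = - sig x by apply/eqP; rewrite -addr_eq0 addrC mass.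
move=> mom; apply: (mulfI r0); move: mom.
move: (\sum_i _) => s H; apply: (addrI (sig x * u j x)); apply: (addIr (- sig x * u j x + rho x * s)).
rewrite [LHS](_ : _ = - (rho x * F j x)); first ring.
by rewrite -H; ring.
Qed.

End Divergence.

Section StaticIdentity.
Context {R : realType}.
Local Notation E := 'rV[R]_3.
Variables (Ckappa : R) (rho rhob sig sigb P Pb : E -> R) (u ub v vb : 'I_3 -> E -> R).
Hypotheses (Crho : Ck 3 rho) (Crhob : Ck 3 rhob) (Csig : Ck 1 sig) (Csigb : Ck 1 sigb).
Hypotheses (CP : Ck 1 P) (CPb : Ck 1 Pb).
Hypotheses (Cu : forall j, Ck 1 (u j)) (Cub : forall j, Ck 1 (ub j)).
Hypotheses (Cv : forall j, Ck 0 (v j)) (Cvb : forall j, Ck 0 (vb j)).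
Hypotheses (r0 : forall x, rho x != 0) (rb0 : forall x, rhob x != 0).
Hypotheses (mass : forall x, sig x + divv (fun i y => rho y * u i y) x = 0).
Hypotheses (massb : forall x, sigb x + divv (fun i y => rhob y * ub i y) x = 0).
Hypotheses (mom : forall x j, sig x * u j x + rho x * v j x
    + \sum_i partial i (fun y => rho y * u j y * u i y) x
  = - (rho x * (partial j P x - Ckappa * partial j (lap rho) x))).
Hypotheses (momb : forall x j, sigb x * ub j x + rhob x * vb j x
    + \sum_i partial i (fun y => rhob y * ub j y * ub i y) x
  = - (rhob x * (partial j Pb x - Ckappa * partial j (lap rhob) x))).

(** The relative density $q=\rho/\bar\rho-1$ replaces $\rho-\bar\rho$ because, next
    to the divergence of $\rho(u-\bar u)$, its evolution contains no derivative of
    $\bar u$, whereas that of $\rho-\bar\rho$ contains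
    $(\rho-\bar\rho)\operatorname{div}\bar u$. *)
Definition reldens x := rho x * (rhob x)^-1 - 1.
Definition dvel j x := u j x - ub j x.
Definition rdvel j x := rho x * dvel j x.
(** This is $\bar\rho^2\partial_iq$; this form is a polynomial in the densities and
    their gradients, whose time derivatives are known. *)
Definition flux i x := rhob x * partial i rho x - rho x * partial i rhob x.
(** [reldens_t] and [flux_t] are the time derivatives of [reldens] and [flux] when
    $\rho$ and $\bar\rho$ have time derivatives [sig] and [sigb]. *)
Definition reldens_t x := sig x * (rhob x)^-1 - rho x * sigb x * (rhob x)^-1 ^+ 2.
Definition flux_t i x := sigb x * partial i rho x + rhob x * partial i sig x
  - sig x * partial i rhob x - rho x * partial i sigb x.

Local Notation q := reldens.
Local Notation w := dvel.
Local Notation W := rdvel.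
Local Notation Z := flux.
Local Notation k x := (rhob x)^-1.

Let Ckk : Ck 3 (fun x => k x). Proof. exact: CkV. Qed.
Let Cq : Ck 3 q. Proof. rewrite /reldens; ck. Qed.
Let Cqt : Ck 1 reldens_t. Proof. rewrite /reldens_t; ck. Qed.
Let Cw j : Ck 1 (w j). Proof. rewrite /dvel; ck. Qed.
Let CW j : Ck 1 (W j). Proof. rewrite /rdvel; ck. Qed.
Let CZ i : Ck 2 (Z i). Proof. rewrite /flux; ck. Qed.
Let Clap (f : E -> R) : Ck 3 f -> Ck 1 (lap f). Proof. by move=> Cf; rewrite /lap; ck. Qed.

Let hk i : has_partial i (fun x => k x) (fun x => - partial i rhob x * k x ^+ 2).
Proof. by apply: has_partialV => //; hp. Qed.

Lemma partial_reldens i x : partial i q x = k x ^+ 2 * Z i x.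
Proof.
eassert (h : has_partial i q _) by (rewrite /reldens; hp).
rewrite (has_partialE x h); rewrite /flux; field; exact: rb0.
Qed.

(** The product rule for $\frac12(\bar\rho\,\partial_iq)^2$, in which $\partial_t$
    and $\partial_i$ are exchanged on $q$. *)
Lemma capillary_identity i x :
  k x * Z i x * (- k x ^+ 2 * sigb x * Z i x + k x * flux_t i x) =
  rhob x * sigb x * partial i q x ^+ 2 + Z i x * partial i reldens_t x.
Proof.
eassert (h : has_partial i reldens_t _) by (rewrite /reldens_t; hp).
rewrite (has_partialE x h); rewrite partial_reldens /flux_t /flux; field; exact: rb0.
Qed.

(** Both mass balances enter. The density ratio is carried by $\bar u$, and only the
    relative flux $\rho(u-\bar u)$ changes it. *)
Lemma reldens_transport x :
  reldens_t x = - (\sum_j ub j x * partial j q x) - k x * divv W x.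
Proof.
have h1 i : has_partial i (fun y => rho y * u i y)
    (fun y => partial i rho y * u i y + rho y * partial i (u i) y) by hp.
have h2 i : has_partial i (fun y => rhob y * ub i y)
    (fun y => partial i rhob y * ub i y + rhob y * partial i (ub i) y) by hp.
have h3 i : has_partial i (W i) (fun y => partial i rho y * w i y
    + rho y * (partial i (u i) y - partial i (ub i) y)) by rewrite /rdvel /dvel; hp.
have e1 : sig x = - divv (fun i y => rho y * u i y) x.
  by apply/eqP; rewrite -addr_eq0 mass.
have e2 : sigb x = - divv (fun i y => rhob y * ub i y) x.
  by apply/eqP; rewrite -addr_eq0 massb.
have per i : - partial i (fun y => rho y * u i y) x * k x
    + rho x * partial i (fun y => rhob y * ub i y) x * k x ^+ 2 =
    - (ub i x * partial i q x) - k x * partial i (W i) x.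
  rewrite partial_reldens (has_partialE x (h1 i)) (has_partialE x (h2 i)).
  rewrite (has_partialE x (h3 i)) /flux /dvel; field; exact: rb0.
rewrite /reldens_t e1 e2 /divv !sum3.
have := per o0; have := per o1; have := per o2; gen_partials; lra.
Qed.

(** This explains the weight in the capillary energy: the divergence of
    $\bar\rho^2\nabla q$ reproduces $\triangle(\rho-\bar\rho)$, so that the
    contribution of $\operatorname{div}(\rho(u-\bar u))$ to the energy balance
    cancels the work of the capillary force, up to a term with $q\triangle\bar\rho$. *)
Lemma div_flux x :
  k x * divv Z x = (lap rho x - lap rhob x) - q x * lap rhob x.
Proof.
have h i : has_partial i (Z i) (fun y =>
    (partial i rhob y * partial i rho y + rhob y * partial i (partial i rho) y)
    - (partial i rho y * partial i rhob y + rho y * partial i (partial i rhob) y)).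
  by rewrite /flux; hp.
have per i : partial i (Z i) x =
    rhob x * partial i (partial i rho) x - rho x * partial i (partial i rhob) x.
  by rewrite (has_partialE x (h i)); gen_partials; ring.
have -> : divv Z x = rhob x * lap rho x - rho x * lap rhob x.
  rewrite /divv /lap !mulr_sumr -sumrB.
  by apply: eq_bigr => i _; exact: per.
rewrite /reldens; move: (lap rho x) (lap rhob x) => a b; field; exact: rb0.
Qed.

Definition transport x := \sum_j ub j x * partial j q x.
Definition reldens_grad2 x := \sum_i partial i q x ^+ 2.
Definition strain x :=
  \sum_i \sum_j Z i x * partial i (ub j) x * partial j q x.

Let CS : Ck 1 transport. Proof. rewrite /transport; ck. Qed.
Let CQ : Ck 1 reldens_grad2. Proof. rewrite /reldens_grad2; ck. Qed.

(** By symmetry of second derivatives, $\sum_{i,j}\bar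
    u_j\,\partial_iq\,\partial_i\partial_jq$ is a transport term for $|\nabla q|^2$.
    An integration by parts will move its derivative to $\bar\rho^2\bar u$, so that
    only first derivatives of $\bar u$ remain. *)
Lemma flux_transport x : \sum_i Z i x * partial i transport x =
  strain x + 1 / 2 * \sum_j (rhob x ^+ 2 * ub j x) * partial j reldens_grad2 x.
Proof.
have h1 i : has_partial i transport (fun x => \sum_j
    (partial i (ub j) x * partial j q x + ub j x * partial i (partial j q) x)).
  by rewrite /transport; hp.
have h2 j : has_partial j reldens_grad2 (fun x => \sum_i
    (2 * partial i q x * partial j (partial i q) x)).
  by rewrite /reldens_grad2; hp.
have ZE i : Z i x = rhob x ^+ 2 * partial i q x.
  by rewrite partial_reldens; field; exact: rb0.
under eq_bigr do rewrite (has_partialE x (h1 _)) mulr_sumr.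
rewrite /strain mulr_sumr.
under [X in _ = _ + X]eq_bigr do rewrite (has_partialE x (h2 _)) !mulr_sumr.
rewrite [X in _ + X]exchange_big/= -big_split/=.
apply: eq_bigr => i _; rewrite -big_split/=; apply: eq_bigr => j _.
have C2q : Ck 2 q by exact: CkW Cq.
by rewrite (partialC j i C2q) ZE; gen_partials; field.
Qed.

Definition speed2 x := \sum_j w j x ^+ 2.
Let CN : Ck 1 speed2. Proof. rewrite /speed2; ck. Qed.

Let LL x := lap rho x - lap rhob x.
Let CLL : Ck 1 LL. Proof. by rewrite /LL; apply: CkB; exact: Clap. Qed.

(** In the difference of the velocity equations the convection of $u-\bar u$ by $u$
    is kept apart from the stretching by $\nabla\bar u$: with the mass balance, the
    former is a total divergence. *)
Lemma velocity_work x : \sum_j W j x * (v j x - vb j x) =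
  - (1 / 2 * \sum_i (rho x * u i x) * partial i speed2 x)
  - \sum_j W j x * (\sum_i w i x * partial i (ub j) x)
  - \sum_j W j x * (partial j P x - partial j Pb x)
  + Ckappa * \sum_j W j x * partial j LL x.
Proof.
have Cr1 : Ck 1 rho by exact: CkW Crho.
have Crb1 : Ck 1 rhob by exact: CkW Crhob.
have vE j : v j x = - \sum_i u i x * partial i (u j) x
    - (partial j P x - Ckappa * partial j (lap rho) x).
  exact: (velocity_eq (F := fun j x => partial j P x - Ckappa * partial j (lap rho) x)
    Cr1 Cu (r0 x) (mass x) (mom x j)).
have vbE j : vb j x = - \sum_i ub i x * partial i (ub j) x
    - (partial j Pb x - Ckappa * partial j (lap rhob) x).
  exact: (velocity_eq (F := fun j x => partial j Pb x - Ckappa * partial j (lap rhob) x)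
    Crb1 Cub (rb0 x) (massb x) (momb x j)).
have hN i : has_partial i speed2 (fun x => \sum_j 2 * w j x * partial i (w j) x).
  by rewrite /speed2; hp.
have hw i j : has_partial i (w j) (fun x => partial i (u j) x - partial i (ub j) x).
  by rewrite /dvel; hp.
have Cl := Clap Crho; have Clb := Clap Crhob.
have hL j : has_partial j LL (fun x => partial j (lap rho) x - partial j (lap rhob) x).
  exact: (has_partialD (has_partialW j Cl) (has_partialN (has_partialW j Clb))).
have -> : \sum_i (rho x * u i x) * partial i speed2 x =
    2 * \sum_j W j x * (\sum_i u i x * (partial i (u j) x - partial i (ub j) x)).
  rewrite mulr_sumr; under eq_bigr do rewrite (has_partialE x (hN _)) mulr_sumr.
  rewrite exchange_big; apply: eq_bigr => j _ /=; rewrite !mulr_sumr.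
  by apply: eq_bigr => i _; rewrite (has_partialE x (hw i j)) /rdvel; ring.
have <- : \sum_j W j x * (partial j (lap rho) x - partial j (lap rhob) x) =
    \sum_j W j x * partial j LL x.
  by apply: eq_bigr => j _; rewrite (has_partialE x (hL j)).
rewrite mulrA (_ : 1 / 2 * 2 = 1) ?mul1r; last by field.
rewrite mulr_sumr -!sumrN -!big_split/=; apply: eq_bigr => j _.
rewrite vE vbE !sum3 /rdvel /dvel; gen_partials; ring.
Qed.

(** The formal time derivative of the energy density, computed with the product
    rule from those of the fields. *)
Definition energy_t x :=
  Ckappa * \sum_i k x * Z i x * (- k x ^+ 2 * sigb x * Z i x + k x * flux_t i x)
  + sig x / 2 * speed2 x + \sum_j W j x * (v j x - vb j x)
  + sigb x / 2 * q x ^+ 2 + rhob x * q x * reldens_t x.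

(** What remains of [energy_t] after removing total divergences. *)
Definition remainder x :=
  Ckappa * (rhob x * sigb x * reldens_grad2 x - strain x
         + 1 / 2 * (divv (fun j y => rhob y ^+ 2 * ub j y) x * reldens_grad2 x)
         + \sum_j W j x * partial j (fun y => q y * lap rhob y) x)
  - \sum_j W j x * (\sum_i w i x * partial i (ub j) x)
  - \sum_j W j x * (partial j P x - partial j Pb x)
  + \sum_j W j x * partial j q x.

(* The divergence of phi V, expanded. *)
Let dvg (V : 'I_3 -> E -> R) (phi : E -> R) (x : E) : R := \sum_i V i x * partial i phi x + divv V x * phi x.

Lemma energy_t_decomposition x : energy_t x = remainder x
  + Ckappa * (dvg Z reldens_t x + dvg W LL x - dvg W (fun y => q y * lap rhob y) x
           + dvg Z transport x
           - 1 / 2 * dvg (fun j y => rhob y ^+ 2 * ub j y) reldens_grad2 x)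
  - 1 / 2 * dvg (fun j y => rho y * u j y) speed2 x
  - 1 / 2 * dvg (fun j y => rhob y * ub j y) (fun y => q y ^+ 2) x
  - dvg W q x.
Proof.
have hq2 j : has_partial j (fun y => q y ^+ 2) (fun x => 2 * q x * partial j q x) by hp.
rewrite /energy_t /remainder /dvg.
under [X in Ckappa * X + _]eq_bigr do rewrite capillary_identity.
rewrite big_split/= -mulr_sumr -/(reldens_grad2 x) velocity_work flux_transport.
have -> : \sum_i rhob x * ub i x * partial i (fun y => q y ^+ 2) x =
    2 * rhob x * q x * transport x.
  rewrite /transport mulr_sumr; apply: eq_bigr => j _; rewrite (has_partialE x (hq2 j)); ring.
have e3 := div_flux x; have e1 := reldens_transport x; rewrite -/(transport x) in e1.
have m1 := mass x; have m2 := massb x.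
have {}m1 : divv (fun i y => rho y * u i y) x = - sig x.
  by apply/eqP; rewrite -addr_eq0 addrC m1.
have {}m2 : divv (fun i y => rhob y * ub i y) x = - sigb x.
  by apply/eqP; rewrite -addr_eq0 addrC m2.
rewrite m1 m2.
have {}e3 : divv Z x = rhob x * (LL x - q x * lap rhob x).
  by rewrite -e3 mulrA mulfV ?mul1r.
rewrite e3 e1.
have kr : rhob x * k x = 1 by rewrite mulfV.
set K := k x; rewrite -/K in kr.
set DW := divv W x; set Lx := LL x; set qq := q x; set T := transport x.
set Lb := lap rhob x.
have -> : rhob x * (Lx - qq * Lb) * (- T - K * DW) =
    - rhob x * (Lx - qq * Lb) * T - (Lx - qq * Lb) * DW.
  have -> : rhob x * (Lx - qq * Lb) * (- T - K * DW) =
    - rhob x * (Lx - qq * Lb) * T - (rhob x * K) * ((Lx - qq * Lb) * DW) by ring.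
  by rewrite kr mul1r.
have -> : rhob x * qq * (- T - K * DW) = - rhob x * qq * T - qq * DW.
  have -> : rhob x * qq * (- T - K * DW) = - rhob x * qq * T - (rhob x * K) * (qq * DW) by ring.
  by rewrite kr mul1r.
by field.
Qed.

Lemma Ck_remainder : Ck 0 remainder.
Proof.
have Clb := Clap Crhob; have Cq1 : Ck 1 q by ck.
have CqL : Ck 1 (fun y => q y * lap rhob y) by ck.
rewrite /remainder /strain /divv; ck.
Qed.

(** The divergences of [energy_t_decomposition] have mean zero. *)
Lemma tint_energy_t : tint energy_t = tint remainder.
Proof.
have Clb := Clap Crhob.
have Cqt0 : Ck 0 reldens_t by exact: CkW Cqt.
have CZ1 i : Ck 1 (Z i) by exact: CkW (CZ i).
have Cdvg V phi : (forall i, Ck 1 (V i)) -> Ck 1 phi -> Ck 0 (dvg V phi).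
  by move=> CV Cphi; rewrite /dvg /divv; ck.
pose null (f : E -> R) := Ck 0 f /\ tint f = 0.
have nD f g : null f -> null g -> null (fun x => f x + g x).
  by move=> [Cf f0] [Cg g0]; split; [exact: CkD|rewrite tintD// f0 g0 addr0].
have nZ c f : null f -> null (fun x => c * f x).
  by move=> [Cf f0]; split; [exact: (CkZ c Cf)|rewrite tintZ// f0 mulr0].
have ZZ V phi : (forall i, Ck 1 (V i)) -> Ck 1 phi -> null (dvg V phi).
  by move=> CV Cphi; split; [exact: Cdvg|exact: tint_div].
have CY5 j : Ck 1 (fun y => rhob y ^+ 2 * ub j y) by ck.
have CY6 j : Ck 1 (fun y => rho y * u j y) by ck.
have CY7 j : Ck 1 (fun y => rhob y * ub j y) by ck.
have Cq2 : Ck 1 (fun y => q y ^+ 2) by ck.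
have Cq1 : Ck 1 q by ck.
have CqL : Ck 1 (fun y => q y * lap rhob y) by ck.
have n1 := nZ Ckappa _ (ZZ Z reldens_t CZ1 Cqt).
have n2 := nZ Ckappa _ (ZZ W LL CW CLL).
have n3 := nZ (- Ckappa) _ (ZZ W _ CW CqL).
have n4 := nZ Ckappa _ (ZZ Z transport CZ1 CS).
have n5 := nZ (- (Ckappa / 2)) _ (ZZ _ reldens_grad2 CY5 CQ).
have n6 := nZ (- (1 / 2)) _ (ZZ _ speed2 CY6 CN).
have n7 := nZ (- (1 / 2)) _ (ZZ _ _ CY7 Cq2).
have n8 := nZ (- 1) _ (ZZ W q CW Cq1).
have [Cn tn] := nD _ _ n1 (nD _ _ n2 (nD _ _ n3 (nD _ _ n4 (nD _ _ n5 (nD _ _ n6 (nD _ _ n7 n8)))))).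
have Crem := Ck_remainder.
rewrite -[RHS]addr0 -[X in _ = _ + X]tn -tintD//; congr tint.
by apply/funext => x; rewrite energy_t_decomposition; field.
Qed.

End StaticIdentity.

(** * Quadratic bound on the energy production *)

Section PointwiseBound.
Context {R : realType}.
Local Notation E := 'rV[R]_3.

(** Compared with the reduced relative energy, the capillary part is
    $\frac{C_\kappa}2\bar\rho^2|\nabla q|^2$ instead of
    $\frac{C_\kappa}2|\nabla(\rho-\bar\rho)|^2$, and $\frac12\bar\rho q^2$ is added
    to dominate the terms of lower order. *)
Definition energy (Ckappa : R) (rho rhob : E -> R) (u ub : 'I_3 -> E -> R) (x : E) : R :=
  Ckappa / 2 * \sum_i ((rhob x)^-1 * flux rho rhob i x) ^+ 2
  + rho x / 2 * speed2 u ub x + rhob x / 2 * reldens rho rhob x ^+ 2.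

Lemma le_mul3_sqr (B c K a b : R) : a ^+ 2 <= B -> b ^+ 2 <= B -> `|c| <= K ->
  `|c * a * b| <= K * B.
Proof.
move=> aB bB cK; rewrite -mulrA normrM.
apply: ler_pM => //; rewrite ?normr_ge0//.
have : (`|a| - `|b|) ^+ 2 >= 0 by exact: sqr_ge0.
have ea : `|a| ^+ 2 = a ^+ 2 by rewrite real_normK ?num_real.
have eb : `|b| ^+ 2 = b ^+ 2 by rewrite real_normK ?num_real.
rewrite normrM sqrrB ea eb; move: aB bB; move: (`|a|) (`|b|) (a ^+ 2) (b ^+ 2).
by move=> p r A C; rewrite -mulr_natr; lra.
Qed.

Lemma le_normr_sum3 (F : 'I_3 -> R) (K : R) : (forall i, `|F i| <= K) ->
  `|\sum_i F i| <= 3 * K.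
Proof.
move=> FK; rewrite (le_trans (ler_norm_sum _ _ _))// sum3.
by have := FK o0; have := FK o1; have := FK o2; lra.
Qed.

Lemma le_normrM (a b K L : R) : `|a| <= K -> `|b| <= L -> `|a * b| <= K * L.
Proof. by move=> aK bL; rewrite normrM ler_pM. Qed.

Lemma le_normrD2 (a b K L : R) : `|a| <= K -> `|b| <= L -> `|a + b| <= K + L.
Proof. by move=> aK bL; rewrite (le_trans (ler_normD _ _))// lerD. Qed.

Lemma le_sum3_sqr (F : 'I_3 -> R) j : F j ^+ 2 <= \sum_i F i ^+ 2.
Proof.
by rewrite sum3; elim/ord3P: j; have := sqr_ge0 (F o0); have := sqr_ge0 (F o1);
  have := sqr_ge0 (F o2); lra.
Qed.

Variables (Ckappa c C M H : R).
Hypotheses (Ckappa0 : 0 < Ckappa) (c0 : 0 < c) (H0 : 0 <= H).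

(** The first factor collects the coefficients of [remainder], the second is the
    constant in the coercivity of the energy. *)
Definition growth_rate : R :=
  (Ckappa * (C * M + 9 * (C ^+ 2 * M) + 1 / 2 * (3 * (2 * C * M * M + C ^+ 2 * M))
          + 3 * (C * (3 * M) + C * (3 * M))) + 3 * (3 * (C * M)) + 3 * (C * H + C * H) + 3 * C)
  * (2 / (Ckappa * c ^+ 2) + 2 / c).

Variables (rho rhob sigb P Pb : E -> R) (u ub : 'I_3 -> E -> R) (x : E).
Hypotheses (Crho : Ck 3 rho) (Crhob : Ck 3 rhob) (Cub : forall j, Ck 1 (ub j)).
Hypothesis rb0 : forall y, rhob y != 0.
Hypothesis rho_bnd : c <= rho x <= C.
Hypothesis rhob_bnd : c <= rhob x <= C.
Hypothesis sigb_bnd : `|sigb x| <= M.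
Hypothesis ub_bnd : forall j, `|ub j x| <= M.
Hypothesis dub_bnd : forall i j, `|partial i (ub j) x| <= M.
Hypothesis drhob_bnd : forall i, `|partial i rhob x| <= M.
Hypothesis d2rhob_bnd : forall i, `|partial i (partial i rhob) x| <= M.
Hypothesis d3rhob_bnd : forall i j, `|partial j (partial i (partial i rhob)) x| <= M.
Hypothesis dP_bnd : forall j, `|partial j P x - partial j Pb x| <=
  H * (`|partial j (reldens rho rhob) x| + `|reldens rho rhob x|).

Local Notation q := (reldens rho rhob).
Local Notation w := (dvel u ub).
Local Notation Q := (reldens_grad2 rho rhob x).
Local Notation N := (speed2 u ub x).

Let B := Q + N + q x ^+ 2.

Let Q0 : 0 <= Q. Proof. by apply: sumr_ge0 => i _; exact: sqr_ge0. Qed.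
Let N0 : 0 <= N. Proof. by apply: sumr_ge0 => i _; exact: sqr_ge0. Qed.
Let q20 : 0 <= q x ^+ 2. Proof. exact: sqr_ge0. Qed.
Let B0 : 0 <= B. Proof. by rewrite !addr_ge0. Qed.

Let aB i : partial i q x ^+ 2 <= B.
Proof.
apply: (@le_trans _ _ Q); first exact: (le_sum3_sqr (fun i => partial i q x) i).
by rewrite /B -addrA lerDl addr_ge0.
Qed.
Let wB i : w i x ^+ 2 <= B.
Proof.
apply: (@le_trans _ _ N); first exact: (le_sum3_sqr (fun i => w i x) i).
by rewrite /B -addrA addrCA lerDl addr_ge0.
Qed.
Let qB : q x ^+ 2 <= B. Proof. by rewrite /B lerDr addr_ge0. Qed.

Let rho_abs : `|rho x| <= C.
Proof. by case/andP: rho_bnd => h1 h2; rewrite ger0_norm// (le_trans (ltW c0)). Qed.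
Let rhob_abs : `|rhob x| <= C.
Proof. by case/andP: rhob_bnd => h1 h2; rewrite ger0_norm// (le_trans (ltW c0)). Qed.
Let C0 : 0 <= C. Proof. exact: le_trans (normr_ge0 _) rho_abs. Qed.
Let rhob2_abs : `|rhob x ^+ 2| <= C ^+ 2.
Proof. by rewrite normrX lerXn2r// nnegrE. Qed.
Let Clap_rhob : Ck 1 (lap rhob). Proof. rewrite /lap; ck. Qed.
Let Cq : Ck 3 q.
Proof. rewrite /reldens; have := CkV rb0 Crhob => Ck'; ck. Qed.

Let lap_abs : `|lap rhob x| <= 3 * M. Proof. exact: le_normr_sum3. Qed.
Let dlap_abs j : `|partial j (lap rhob) x| <= 3 * M.
Proof.
have h : has_partial j (lap rhob) (fun y => \sum_i partial j (partial i (partial i rhob)) y).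
  by rewrite /lap; hp.
by rewrite (has_partialE x h); apply: le_normr_sum3 => i; exact: d3rhob_bnd.
Qed.

Let strain_le : `|strain rho rhob ub x| <= 9 * (C ^+ 2 * M) * B.
Proof.
have -> : 9 * (C ^+ 2 * M) * B = 3 * (3 * ((C ^+ 2 * M) * B)) by ring.
apply: le_normr_sum3 => i; apply: le_normr_sum3 => j.
have -> : flux rho rhob i x * partial i (ub j) x * partial j q x =
    (rhob x ^+ 2 * partial i (ub j) x) * partial i q x * partial j q x.
  rewrite (partial_reldens Crho Crhob rb0 i x); move: (partial i (ub j) x) (partial j q x) (flux _ _ _ _).
  by move=> a b f; field; exact: rb0.
by apply: le_mul3_sqr; [exact: aB|exact: aB|exact: le_normrM].
Qed.

Let div_le : `|divv (fun j y => rhob y ^+ 2 * ub j y) x| <=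
  3 * (2 * C * M * M + C ^+ 2 * M).
Proof.
apply: le_normr_sum3 => j.
have h : has_partial j (fun y => rhob y ^+ 2 * ub j y) (fun y =>
  2 * rhob y * partial j rhob y * ub j y + rhob y ^+ 2 * partial j (ub j) y) by hp.
rewrite (has_partialE x h); apply: le_normrD2; last exact: le_normrM.
do 3 ! (apply: le_normrM => //).
by rewrite ger0_norm.
Qed.

Let pressure_le : `|\sum_j rdvel rho u ub j x * (partial j P x - partial j Pb x)| <=
  3 * (C * H + C * H) * B.
Proof.
have -> : 3 * (C * H + C * H) * B = 3 * (C * H * B + C * H * B) by ring.
apply: le_normr_sum3 => j.
have nH : `|H| <= H by rewrite ger0_norm.
have s1 := le_mul3_sqr (wB j) (aB j) (le_normrM rho_abs nH).
have s2 := le_mul3_sqr (wB j) qB (le_normrM rho_abs nH).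
have e y : `|rho x * H * w j x * y| = `|rdvel rho u ub j x| * (H * `|y|).
  by rewrite /rdvel !normrM (ger0_norm H0); move: (`|w j x|) => W; ring.
rewrite e in s1; rewrite e in s2; rewrite normrM.
apply: le_trans (ler_wpM2l (normr_ge0 _) (dP_bnd j)) _.
move: s1 s2; move: (`|rdvel _ _ _ _ _|) (`|partial j q x|) (`|q x|) => W a b.
by rewrite [H * (a + b)]mulrDr [W * (H * a + _)]mulrDr; exact: lerD.
Qed.

Let stretch_le : `|\sum_j rdvel rho u ub j x * (\sum_i w i x * partial i (ub j) x)| <=
  3 * (3 * (C * M)) * B.
Proof.
have -> : 3 * (3 * (C * M)) * B = 3 * (3 * ((C * M) * B)) by ring.
apply: le_normr_sum3 => j; rewrite mulr_sumr; apply: le_normr_sum3 => i.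
have -> : rdvel rho u ub j x * (w i x * partial i (ub j) x) =
  (rho x * partial i (ub j) x) * w j x * w i x.
  by rewrite /rdvel; gen_partials; ring.
by apply: le_mul3_sqr; [exact: wB|exact: wB|exact: le_normrM].
Qed.

Let capillary_le :
  `|\sum_j rdvel rho u ub j x * partial j (fun y => q y * lap rhob y) x| <=
  3 * (C * (3 * M) + C * (3 * M)) * B.
Proof.
have -> : 3 * (C * (3 * M) + C * (3 * M)) * B =
  3 * ((C * (3 * M)) * B + (C * (3 * M)) * B) by ring.
apply: le_normr_sum3 => j.
have h : has_partial j (fun y => q y * lap rhob y) (fun y =>
  partial j q y * lap rhob y + q y * partial j (lap rhob) y) by hp.
have -> : rdvel rho u ub j x * partial j (fun y => q y * lap rhob y) x =
    (rho x * lap rhob x) * w j x * partial j q x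
    + (rho x * partial j (lap rhob) x) * w j x * q x.
  by rewrite (has_partialE x h) /rdvel; gen_partials; move: (lap rhob x) => l; ring.
exact: (le_normrD2 (le_mul3_sqr (wB j) (aB j) (le_normrM rho_abs lap_abs))
  (le_mul3_sqr (wB j) qB (le_normrM rho_abs (dlap_abs j)))).
Qed.

Let gradient_le : `|\sum_j rdvel rho u ub j x * partial j q x| <= 3 * C * B.
Proof.
rewrite -mulrA; apply: le_normr_sum3 => j.
exact: (le_mul3_sqr (wB j) (aB j) rho_abs).
Qed.

Let coercive : B <= (2 / (Ckappa * c ^+ 2) + 2 / c) * energy Ckappa rho rhob u ub x.
Proof.
have [h1 _] := andP rho_bnd; have [h2 _] := andP rhob_bnd.
have e i : ((rhob x)^-1 * flux rho rhob i x) ^+ 2 = rhob x ^+ 2 * partial i q x ^+ 2.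
  rewrite (partial_reldens Crho Crhob rb0 i x).
  by move: (flux _ _ _ _) => f; field; exact: rb0.
have -> : energy Ckappa rho rhob u ub x =
    Ckappa / 2 * (rhob x ^+ 2 * Q) + rho x / 2 * N + rhob x / 2 * q x ^+ 2.
  rewrite /energy /reldens_grad2 mulr_sumr; congr (_ * _ + _ + _).
  by apply: eq_bigr => i _; exact: e.
set En := (X in _ <= _ * X).
have lowE : Ckappa / 2 * (c ^+ 2 * Q) + c / 2 * (N + q x ^+ 2) <= En.
  rewrite /En mulrDr addrA; apply: lerD; last by rewrite ler_wpM2r// ler_pM2r.
  apply: lerD; last by rewrite ler_wpM2r// ler_pM2r.
  rewrite ler_wpM2l ?divr_ge0 ?(ltW Ckappa0)// ler_wpM2r//.
  by rewrite lerXn2r// ?nnegrE ?(ltW c0)// (le_trans (ltW c0)).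
apply: le_trans (ler_wpM2l _ lowE); last first.
  by rewrite addr_ge0// divr_ge0// ?mulr_ge0 ?(ltW Ckappa0) ?(ltW c0) ?exprn_ge0 ?(ltW c0).
have -> : (2 / (Ckappa * c ^+ 2) + 2 / c) *
    (Ckappa / 2 * (c ^+ 2 * Q) + c / 2 * (N + q x ^+ 2)) =
  B + (Ckappa * c * Q + (N + q x ^+ 2) / (Ckappa * c)).
  by rewrite /B; field; rewrite !gt_eqF.
have Ckappa_c : 0 <= Ckappa * c by rewrite mulr_ge0// ltW.
rewrite lerDl; apply: addr_ge0; first exact: mulr_ge0.
by apply: divr_ge0 => //; exact: addr_ge0.
Qed.

(** Each term of the remainder is a bounded coefficient times the product of two
    quantities among $\partial_iq$, $u_j-\bar u_j$ and $q$. *)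
Lemma remainder_le : remainder Ckappa rho rhob sigb P Pb u ub x <=
  growth_rate * energy Ckappa rho rhob u ub x.
Proof.
set K0 := Ckappa * (C * M + 9 * (C ^+ 2 * M) + 1 / 2 * (3 * (2 * C * M * M + C ^+ 2 * M))
  + 3 * (C * (3 * M) + C * (3 * M))) + 3 * (3 * (C * M)) + 3 * (C * H + C * H) + 3 * C.
have M0 : 0 <= M by exact: le_trans (normr_ge0 _) sigb_bnd.
have K00 : 0 <= K0.
  by rewrite /K0; repeat (apply: addr_ge0 || apply: mulr_ge0 || exact: ltW Ckappa0 ||
    exact: exprn_ge0 || by []).
apply: (@le_trans _ _ (K0 * B)); last first.
  by rewrite /growth_rate -/K0 -mulrA; apply: ler_wpM2l => //; exact: coercive.
have QB : Q <= B by rewrite /B -addrA lerDl addr_ge0.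
have t1 : `|rhob x * sigb x * Q| <= C * M * B.
  apply: le_normrM; first exact: le_normrM.
  by rewrite ger0_norm.
have t3 : `|divv (fun j y => rhob y ^+ 2 * ub j y) x * Q| <=
    3 * (2 * C * M * M + C ^+ 2 * M) * B.
  by apply: le_normrM => //; rewrite ger0_norm.
rewrite /remainder -/Q /K0.
move: t1 t3 strain_le pressure_le stretch_le capillary_le gradient_le.
move: (rhob x * sigb x * Q) (divv _ _ * Q) (strain _ _ _ _) (\sum_j _) (\sum_j _)
  (\sum_j _) (\sum_j _) => a1 a3 a2 a7 a4 a5 a6.
move=> /ler_normlW k1 /ler_normlW k3.
move=> /ler_normlP[k2 _] /ler_normlP[k6 _] /ler_normlP[k5 _] /ler_normlW k4 /ler_normlW k7.
have kk : Ckappa * (a1 - a2 + 1 / 2 * a3 + a4) <= Ckappa * (C * M * B + 9 * (C ^+ 2 * M) * B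
    + 1 / 2 * (3 * (2 * C * M * M + C ^+ 2 * M) * B) + 3 * (C * (3 * M) + C * (3 * M)) * B).
  rewrite ler_pM2l//; move: k1 k2 k3 k4.
  move: (C * M * B) (9 * (C ^+ 2 * M) * B) (3 * (2 * C * M * M + C ^+ 2 * M) * B)
    (3 * (C * (3 * M) + C * (3 * M)) * B) => b1 b2 b3 b4; lra.
move: kk k5 k6 k7; move: (Ckappa * (a1 - _ + _ + _)) => z; lra.
Qed.

End PointwiseBound.

(** * Uniform limits and uniform derivatives in time *)

Section UniformLimits.
Context {R : realType} {X : Type}.
Implicit Types (f g : R -> X -> R) (lf lg : X -> R).

Definition bounded_on (lf : X -> R) := exists M : R, forall x, `|lf x| <= M.

(** Uniform convergence to a bounded limit: under it the limits of sums and
    products, hence Leibniz' rule, need no domination argument. *)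
Variant ulim (F : set_system R) f lf : Prop := ULim of
  bounded_on lf & forall e : R, 0 < e -> \forall d \near F, forall x, `|f d x - lf x| <= e.

Section Rules.
Variables (F : set_system R).
Context {FF : Filter F}.

Lemma ulim_cst lf : bounded_on lf -> ulim F (fun=> lf) lf.
Proof.
move=> b0; split=> // e e0; apply: nearW => d x.
by rewrite subrr normr0 ltW.
Qed.

Lemma ulim_near f g lf : (\forall d \near F, forall x, f d x = g d x) ->
  ulim F f lf -> ulim F g lf.
Proof.
move=> fg [b0 H]; split=> // e e0; have {}H := H e e0.
by apply: filterS2 fg H => d fgd Hd x; rewrite -fgd.
Qed.

Lemma ulim_eq f lf lg : (forall x, lf x = lg x) -> ulim F f lf -> ulim F f lg.
Proof. by move=> /funext ->. Qed.

Lemma ulim_bounded f lf : ulim F f lf ->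
  exists2 M, 0 < M & (forall x, `|lf x| <= M) /\ \forall d \near F, forall x, `|f d x| <= M.
Proof.
move=> [[M b0] H]; exists (`|M| + 1); first by rewrite ltr_wpDl.
split=> [x|].
  by rewrite (le_trans (b0 x))// (le_trans (ler_norm M))// lerDl.
have {}H := H 1 ltr01; near=> d => x.
rewrite -(subrK (lf x) (f d x)) (le_trans (ler_normD _ _))// addrC lerD//.
  by rewrite (le_trans (b0 x))// ler_norm.
by move: x; near: d.
Unshelve. all: by end_near. Qed.

Lemma ulimD f g lf lg : ulim F f lf -> ulim F g lg ->
  ulim F (fun d x => f d x + g d x) (fun x => lf x + lg x).
Proof.
move=> [[M bf] Hf] [[N bg] Hg]; split.
  by exists (M + N) => x; rewrite (le_trans (ler_normD _ _))// lerD.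
move=> e e0; have e20 : 0 < e / 2 by rewrite divr_gt0.
have {}Hf := Hf _ e20; have {}Hg := Hg _ e20; near=> d => x.
rewrite (_ : f d x + g d x - _ = (f d x - lf x) + (g d x - lg x)); last by ring.
rewrite (le_trans (ler_normD _ _))// (splitr e) lerD//; move: x; by near: d.
Unshelve. all: by end_near. Qed.

Lemma ulimM f g lf lg : ulim F f lf -> ulim F g lg ->
  ulim F (fun d x => f d x * g d x) (fun x => lf x * lg x).
Proof.
move=> uf ug; have [M M0 [bf bf']] := ulim_bounded uf.
have [N N0 [bg bg']] := ulim_bounded ug.
case: uf ug => _ Hf [_ Hg]; split.
  by exists (M * N) => x; rewrite normrM ler_pM.
move=> e e0.
have e1 : 0 < e / (2 * N) by rewrite divr_gt0// mulr_gt0.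
have e2 : 0 < e / (2 * M) by rewrite divr_gt0// mulr_gt0.
have {}Hf := Hf _ e1; have {}Hg := Hg _ e2; near=> d => x.
have -> : f d x * g d x - lf x * lg x =
  (f d x - lf x) * g d x + lf x * (g d x - lg x) by ring.
rewrite (le_trans (ler_normD _ _))// !normrM.
have -> : e = e / (2 * N) * N + M * (e / (2 * M)) by field; rewrite !gt_eqF.
apply: lerD; apply: ler_pM => //; move: x; by near: d.
Unshelve. all: by end_near. Qed.

Lemma ulimN f lf : ulim F f lf -> ulim F (fun d x => - f d x) (fun x => - lf x).
Proof.
move=> [[M bf] Hf]; split; first by exists M => x; rewrite normrN.
move=> e e0; have {}Hf := Hf e e0; near=> d => x.
by rewrite -opprD normrN; move: x; near: d.
Unshelve. all: by end_near. Qed.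

Lemma ulimV f lf (c : R) : 0 < c -> (forall x, c <= lf x) ->
  (\forall d \near F, forall x, c <= f d x) ->
  ulim F f lf -> ulim F (fun d x => (f d x)^-1) (fun x => (lf x)^-1).
Proof.
move=> c0 cf0 cf [_ Hf].
have inv_le a : c <= a -> `|a^-1| <= c^-1.
  move=> ca; have a0 : 0 < a by exact: lt_le_trans ca.
  by rewrite ger0_norm ?invr_ge0 ?(ltW a0)// lef_pV2.
split; first by exists c^-1 => x; exact: inv_le.
move=> e e0; have ec0 : 0 < e * c ^+ 2 by rewrite mulr_gt0// exprn_gt0.
have {}Hf := Hf _ ec0; near=> d => x.
have cd : c <= f d x by move: x; near: d.
have h : `|f d x - lf x| <= e * c ^+ 2 by move: x {cd}; near: d.
have -> : (f d x)^-1 - (lf x)^-1 = - (f d x - lf x) * ((f d x)^-1 * (lf x)^-1).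
  by field; rewrite !gt_eqF// (lt_le_trans c0).
rewrite normrM normrN (_ : e = e * c ^+ 2 * (c^-1 * c^-1)); last by field; rewrite gt_eqF.
by apply: ler_pM => //; rewrite normrM; apply: ler_pM => //; exact: inv_le.
Unshelve. all: by end_near. Qed.

Lemma ulim_sum n (f : 'I_n -> R -> X -> R) (lf : 'I_n -> X -> R) :
  (forall l, ulim F (f l) (lf l)) ->
  ulim F (fun d x => \sum_l f l d x) (fun x => \sum_l lf l x).
Proof.
elim: n f lf => [|n ih] f lf H.
  apply: (@ulim_near (fun _ _ => 0)); first by apply: nearW => d x; rewrite big_ord0.
  apply: (@ulim_eq _ (fun=> 0)); first by move=> x; rewrite big_ord0.
  by apply: ulim_cst; exists 0 => x; rewrite normr0.
apply: (@ulim_near (fun d x => f ord0 d x + \sum_l f (lift ord0 l) d x)).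
  by apply: nearW => d x; rewrite big_ord_recl.
apply: (@ulim_eq _ (fun x => lf ord0 x + \sum_l lf (lift ord0 l) x)).
  by move=> x; rewrite big_ord_recl.
by apply: ulimD => //; exact: ih.
Qed.

End Rules.

(** Differentiability in time for the supremum norm in space. *)
Variant udiff (f : R -> X -> R) (t : R) (df : X -> R) : Prop := UDiff of
  bounded_on (f t) & ulim 0^' (fun d x => d^-1 * (f (t + d) x - f t x)) df.

Implicit Types df dg : X -> R.

Lemma udiff_eq f t df dg : udiff f t df -> (forall x, df x = dg x) -> udiff f t dg.
Proof. by move=> + /funext <-. Qed.

Lemma udiff_ulim f t df : udiff f t df -> ulim 0^' (fun d => f (t + d)) (f t).
Proof.
move=> [bf uf].
have u0 : ulim 0^' (fun d (x : X) => d) (fun=> 0).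
  split; first by exists 0 => x; rewrite normr0.
  move=> e e0; near=> d => x; rewrite subr0.
  by near: d; apply: dnbhs0_le.
apply: (@ulim_near _ _ (fun d x => f t x + d * (d^-1 * (f (t + d) x - f t x)))).
  near=> d => x; rewrite mulVKf; last by near: d; exact: nbhs_dnbhs_neq.
  by rewrite addrC subrK.
apply: (@ulim_eq _ _ (fun x => f t x + 0 * df x)); first by move=> x; rewrite mul0r addr0.
by apply: ulimD; [exact: ulim_cst|exact: ulimM].
Unshelve. all: by end_near. Qed.

Lemma udiff_cst t lf : bounded_on lf -> udiff (fun=> lf) t (fun=> 0).
Proof.
move=> b0; split=> //.
apply: (@ulim_near _ _ (fun _ _ => 0)).
  by apply: nearW => d x; rewrite subrr mulr0.
by apply: ulim_cst; exists 0 => x; rewrite normr0.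
Qed.

Lemma udiffD f g t df dg : udiff f t df -> udiff g t dg ->
  udiff (fun s x => f s x + g s x) t (fun x => df x + dg x).
Proof.
move=> [[M bf] uf] [[N bg] ug]; split.
  by exists (M + N) => x; rewrite (le_trans (ler_normD _ _))// lerD.
apply: ulim_near (ulimD uf ug); apply: nearW => d x; ring.
Qed.

Lemma udiffN f t df : udiff f t df -> udiff (fun s x => - f s x) t (fun x => - df x).
Proof.
move=> [[M bf] uf]; split; first by exists M => x; rewrite normrN.
apply: ulim_near (ulimN uf); apply: nearW => d x; ring.
Qed.

Lemma udiffM f g t df dg : udiff f t df -> udiff g t dg ->
  udiff (fun s x => f s x * g s x) t (fun x => df x * g t x + f t x * dg x).
Proof.
move=> hf hg; have ugt := udiff_ulim hg; case: hf hg => [bf uf] [bg ug]; split.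
  have [M bM] := bf; have [N bN] := bg.
  by exists (M * N) => x; rewrite normrM ler_pM.
have FF : Filter (0^' : set_system R) by typeclasses eauto.
have H1 : ulim 0^' _ _ := @ulimM _ FF _ _ _ _ uf ugt.
have H2 : ulim 0^' _ _ := @ulimM _ FF _ _ _ _ (@ulim_cst _ FF _ bf) ug.
have : ulim 0^' _ _ := @ulimD _ FF _ _ _ _ H1 H2.
move=> H; apply: ulim_near H; apply: nearW => d x; ring.
Qed.

Lemma udiff_sqr f t df : udiff f t df ->
  udiff (fun s x => f s x ^+ 2) t (fun x => 2 * f t x * df x).
Proof.
move=> hf; apply: udiff_eq (udiffM hf hf) _ => x; ring.
Qed.

Lemma udiffV f t df (c : R) : 0 < c -> (forall x, c <= f t x) ->
  (\forall d \near 0^', forall x, c <= f (t + d) x) ->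
  udiff f t df -> udiff (fun s x => (f s x)^-1) t (fun x => - df x * (f t x)^-1 ^+ 2).
Proof.
move=> c0 cf cft hf; have ugt := udiff_ulim hf; case: hf => bf uf.
have FF : Filter (0^' : set_system R) by typeclasses eauto.
have uk : ulim 0^' _ _ := @ulimV _ FF _ _ _ c0 cf cft ugt.
have [b0 _] := uk; split=> //.
have H1 : ulim 0^' _ _ := @ulimM _ FF _ _ _ _ uk (@ulim_cst _ FF _ b0).
have H2 : ulim 0^' _ _ := @ulimN _ FF _ _ uf.
have : ulim 0^' _ _ := @ulimM _ FF _ _ _ _ H2 H1.
move/(@ulim_eq _ _ _ (fun x => - df x * (f t x)^-1 ^+ 2)) => /(_ (fun=> erefl)) H.
apply: ulim_near H.
near=> d => x.
have cd : c <= f (t + d) x by move: x; near: d.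
have d0 : d != 0 by near: d; exact: nbhs_dnbhs_neq.
by field; rewrite d0 !gt_eqF// (lt_le_trans c0).
Unshelve. all: by end_near. Qed.

Lemma udiff_sum n (f : 'I_n -> R -> X -> R) t (df : 'I_n -> X -> R) :
  (forall l, udiff (f l) t (df l)) ->
  udiff (fun s x => \sum_l f l s x) t (fun x => \sum_l df l x).
Proof.
move=> H; split.
  have [] : ulim 0^' (fun d x => \sum_l f l (t + d) x) (fun x => \sum_l f l t x); last by [].
  by apply: ulim_sum => l; exact: udiff_ulim (H l).
have H' l : ulim 0^' (fun d x => d^-1 * (f l (t + d) x - f l t x)) (df l) by have [] := H l.
apply: ulim_near (ulim_sum H'); apply: nearW => d x.
by rewrite -mulr_sumr sumrB.
Qed.

End UniformLimits.

(** * Spaces of functions of time *)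

Lemma near_shift_itv (R : realType) (t T : R) : 0 < t < T ->
  \forall d \near 0^', 0 < t + d < T.
Proof.
case/andP=> t0 tT; near=> d.
have dt : `|d| < t by near: d; apply: dnbhs0_lt.
have dT : `|d| < T - t by near: d; apply: dnbhs0_lt; rewrite subr_gt0.
by move: dt dT; rewrite !ltr_norml => /andP[? ?] /andP[? ?]; apply/andP; split; lra.
Unshelve. all: by end_near. Qed.

Section CkNorm.
Context {R : realType} {V : normedModType R}.
Local Notation E := 'rV[R]_3.
Implicit Types (f g : E -> V) (s : seq 'I_3) (k : nat).

Lemma partialsD k f g s x : Ck k f -> Ck k g -> (size s <= k)%N ->
  partials s (fun y => f y + g y) x = partials s f x + partials s g x.
Proof.
elim: k f g s => [|k ih] f g s Cf Cg; first by rewrite leqn0 => /nilP ->.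
case/lastP: s => [//|s i]; rewrite size_rcons ltnS => sk; rewrite !partials_rcons.
have -> : partial i (fun y => f y + g y) = (fun y => partial i f y + partial i g y).
  apply/funext => y.
  exact: (partialD (Ck_derivable (x := y) (i := i) Cf) (Ck_derivable (x := y) (i := i) Cg)).
exact: (ih _ _ _ (Ck_partial i Cf) (Ck_partial i Cg) sk).
Qed.

Lemma partialsZ k f s x (c : R) : Ck k f -> (size s <= k)%N ->
  partials s (fun y => c *: f y) x = c *: partials s f x.
Proof.
elim: k f s => [|k ih] f s Cf; first by rewrite leqn0 => /nilP ->.
case/lastP: s => [//|s i]; rewrite size_rcons ltnS => sk; rewrite !partials_rcons.
have -> : partial i (fun y => c *: f y) = (fun y => c *: partial i f y).
  apply/funext => y; exact: (partialZ c (Ck_derivable (x := y) (i := i) Cf)).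
exact: (ih _ _ (Ck_partial i Cf) sk).
Qed.

Lemma partialsB k f g s x : Ck k f -> Ck k g -> (size s <= k)%N ->
  partials s (fun y => f y - g y) x = partials s f x - partials s g x.
Proof.
move=> Cf Cg sk.
have e : (fun y => f y - g y) = (fun y => f y + (-1) *: g y).
  by apply/funext => y; rewrite scaleN1r.
by rewrite e (partialsD x Cf (CkZ (-1) Cg) sk) (partialsZ x (-1) Cg sk) scaleN1r.
Qed.

(** This makes the supremum in [Ck_norm] finite, hence an upper bound. *)
Lemma Ck_bounded k f : Ck k f ->
  exists M : R, forall s x, (size s <= k)%N -> `|partials s f x| <= M.
Proof.
have base g : Ck 0 g -> exists2 M : R, 0 <= M & forall x, `|g x| <= M.
  move=> /Ck0P[pg cg].
  have Cn : Ck 0 (fun x => `|g x|).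
    apply/Ck0P; split=> [i x|x]; first by rewrite pg.
    exact: (cvg_norm (cg x)).
  have [M M0 H] := Ck0_bounded Cn; exists M => // x.
  by have := H x; rewrite normr_id.
elim: k f => [|k ih] f Cf.
  have [M _ H] := base _ Cf; exists M => s x.
  by rewrite leqn0 => /nilP ->.
have [M0 M00 H0] := base _ (CkW (leq0n _) Cf).
have HM i := ih _ (Ck_partial i Cf).
have [[N0 h0] [N1 h1] [N2 h2]] := And3 (HM o0) (HM o1) (HM o2).
exists (M0 + `|N0| + `|N1| + `|N2|) => s x.
have n0 := ler_norm N0; have n1 := ler_norm N1; have n2 := ler_norm N2.
have p0 := normr_ge0 N0; have p1 := normr_ge0 N1; have p2 := normr_ge0 N2.
case/lastP: s => [_|s i]; first by apply: le_trans (H0 x) _; lra.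
rewrite size_rcons ltnS => sk; rewrite partials_rcons.
elim/ord3P: i.
- by apply: le_trans (h0 s x sk) _; lra.
- by apply: le_trans (h1 s x sk) _; lra.
- by apply: le_trans (h2 s x sk) _; lra.
Qed.

Lemma le_Ck_norm k f s x : Ck k f -> (size s <= k)%N ->
  `|partials s f x| <= Ck_norm k f.
Proof.
move=> Cf sk; have [M HM] := Ck_bounded Cf.
apply: ub_le_sup; last by exists s, x.
by exists M => _ [s' [x' [s'k ->]]]; exact: HM.
Qed.

(** The fields have values in the line or in space: [phi] is the identity in the first
    case, a coordinate in the second. *)
Variable phi : V -> R.
Hypothesis phiB : forall a b, phi (a - b) = phi a - phi b.
Hypothesis phiZ : forall (c : R) a, phi (c *: a) = c * phi a.
Hypothesis phi_le : forall a, `|phi a| <= `|a|.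

Lemma udiff_time_deriv T k (f g : R -> E -> V) t s : is_time_deriv T k f g ->
  0 < t < T -> (size s <= k)%N ->
  udiff (fun t x => phi (partials s (f t) x)) t (fun x => phi (partials s (g t) x)).
Proof.
move=> H tT sk; have [Cf Cg lim0] := H t tT.
have bnd h : Ck k h -> bounded_on (fun x => phi (partials s h x)).
  by move=> /Ck_bounded[M HM]; exists M => x; rewrite (le_trans (phi_le _))// HM.
split; first exact: bnd.
split=> [|e e0]; first exact: bnd.
have /cvgr0Pnorm_le/(_ e e0) lime := lim0.
have Tnear := near_shift_itv tT.
near=> d => x.
have Cfd : Ck k (f (t + d)).
  have tdT : 0 < t + d < T by near: d.
  by have [] := H _ tdT.
have CB := CkB Cfd Cf; have CZ := CkZ d^-1 CB.
have Ch := CkB CZ Cg.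
have <- : phi (partials s (fun y => d^-1 *: (f (t + d) y - f t y) - g t y) x) =
   d^-1 * (phi (partials s (f (t + d)) x) - phi (partials s (f t) x)) - phi (partials s (g t) x).
  by rewrite (partialsB x CZ Cg sk) (partialsZ x _ CB sk) (partialsB x Cfd Cf sk)
    phiB phiZ phiB.
rewrite (le_trans (phi_le _))// (le_trans (le_Ck_norm x Ch sk))//.
by apply: le_trans (ler_norm _) _; near: d.
Unshelve. all: by end_near. Qed.

Lemma ulim_C0_Ck T k (f : R -> E -> V) t0 s : C0_Ck T k f -> 0 <= t0 <= T ->
  (size s <= k)%N ->
  ulim (within `[0, T] (nbhs t0)) (fun t x => phi (partials s (f t) x))
    (fun x => phi (partials s (f t0) x)).
Proof.
move=> [C lim0] t0T sk; have Cf0 := C _ t0T.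
split; first by have [M HM] := Ck_bounded Cf0; exists M => x; rewrite (le_trans (phi_le _))// HM.
move=> e e0; have /cvgr0Pnorm_le/(_ e e0) lime := lim0 _ t0T.
have Tin : \forall t \near within `[0, T] (nbhs t0), `[0, T]%classic t by exact: withinT.
near=> t => x.
have Cft : Ck k (f t).
  apply: C; have : `[0, T]%classic t by near: t.
  by rewrite /= in_itv.
have CB := CkB Cft Cf0.
rewrite -phiB -(partialsB x Cft Cf0 sk).
rewrite (le_trans (phi_le _))// (le_trans (le_Ck_norm x CB sk))//.
by apply: le_trans (ler_norm _) _; near: t.
Unshelve. all: by end_near. Qed.

End CkNorm.

Section TimeBounds.
Context {R : realType} {V : normedModType R}.
Local Notation E := 'rV[R]_3.

(** Continuity in time gives a bound near each time, and $[0,T]$ is compact. *)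
Lemma C0_Ck_bounded T k (f : R -> E -> V) : C0_Ck T k f ->
  exists M : R, forall t s x, 0 <= t <= T -> (size s <= k)%N -> `|partials s (f t) x| <= M.
Proof.
move=> [C lim0].
have [] := @compact_near_coveringP R `[0, T]%classic.
move=> /(_ (@segment_compact _ 0 T)) nc _.
have := nc R (pinfty_nbhs R) (fun M t => 0 <= t <= T -> forall s x, (size s <= k)%N ->
  `|partials s (f t) x| <= M).
case.
  move=> t0; rewrite /= in_itv/= => t0T.
  have /cvgr0Pnorm_le/(_ 1 ltr01) lime := lim0 _ t0T.
  have {}lime : \forall t \near t0, 0 <= t <= T -> `|Ck_norm k (f t - f t0)| <= 1.
    have {}lime : nbhs t0 [set t | `[0, T]%classic t -> `|Ck_norm k (f t - f t0)| <= 1]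
      := lime.
    by apply: filterS lime => t /= H tT; apply: H; rewrite in_itv.
  exists ([set t | 0 <= t <= T -> `|Ck_norm k (f t - f t0)| <= 1],
    [set M | Ck_norm k (f t0) + 1 <= M]); first split => //=.
    by exists (Ck_norm k (f t0) + 1); split; [exact: num_real|move=> M /= /ltW].
  move=> [t M] /= [Ht HM] tT s x sk.
  have Cft := C _ tT; have Cf0 := C _ t0T; have CB := CkB Cft Cf0.
  apply: le_trans HM.
  have -> : partials s (f t) x = partials s (f t0) x + partials s (fun y => f t y - f t0 y) x.
    by rewrite (partialsB x Cft Cf0 sk) addrC subrK.
  rewrite (le_trans (ler_normD _ _))// lerD//; first exact: le_Ck_norm.
  apply: le_trans (le_Ck_norm x CB sk) _.
  by apply: le_trans (ler_norm _) (Ht tT).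
move=> A [_ HA]; exists (A + 1) => t s x tT sk.
apply: (HA (A + 1)) => //=; first by rewrite ltrDl.
Qed.

Lemma tint_cvg (F : set_system R) {FF : Filter F} (f : R -> E -> R) (lf : E -> R) :
  ulim F f lf -> (\forall d \near F, Ck 0 (f d)) -> Ck 0 lf ->
  tint (f d) @[d --> F] --> tint lf.
Proof.
move=> [_ H] Cf Cl; apply/cvgrPdist_le => e e0; have {}H := H e e0.
near=> d; have Cfd : Ck 0 (f d) by near: d.
rewrite -(tintB Cl Cfd); apply: normr_tint; first exact: CkB.
by move=> x; rewrite distrC; move: x; near: d.
Unshelve. all: by end_near. Qed.

(** Leibniz' rule. *)
Lemma is_derive_tint (f : R -> E -> R) t (df : E -> R) : udiff f t df ->
  Ck 0 (f t) -> Ck 0 df -> (\forall d \near 0^', Ck 0 (f (t + d))) ->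
  is_derive t 1 (fun s => tint (f s)) (tint df).
Proof.
move=> [_ H] Cft Cdf Cf.
have c : (fun h : R => h^-1 *: (((fun s => tint (f s)) \o shift t) (h *: 1) - tint (f t)))
    @ 0^' --> tint df.
  apply: cvg_trans (tint_cvg H _ Cdf); last first.
    near=> d; have Cfd : Ck 0 (f (t + d)) by near: d.
    by apply: (CkZ d^-1); exact: CkB.
  apply: near_eq_cvg; near=> d => /=.
  have Cfd : Ck 0 (f (t + d)) by near: d.
  rewrite tintZ; last exact: CkB.
  by rewrite tintB// -[d *: 1]/(d * 1) mulr1 [d + t]addrC.
split; first by apply/cvg_ex; exists (tint df).
exact: cvg_lim c.
Unshelve. all: by end_near. Qed.

(** The function $t\mapsto e^{-Kt}F(t)$ is nonincreasing. Only continuity is asked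
    at the initial time, where strong solutions need not be differentiable. *)
Lemma gronwall (F dF : R -> R) (K T : R) :
  (forall t, 0 < t < T -> is_derive t 1 F (dF t)) ->
  (forall t, 0 < t < T -> dF t <= K * F t) ->
  F @ within `[0, T] (nbhs 0) --> F 0 ->
  forall t, 0 < t < T -> F t <= expR (K * t) * F 0.
Proof.
move=> dFP dFle F0 t /andP[t0 tT].
pose G s := expR (- K * s) * F s.
have hG s : 0 < s < T -> is_derive s 1 G (expR (- K * s) * (dF s - K * F s)).
  move=> sT; have hF := dFP s sT.
  have hE : is_derive s 1 (fun s => expR (- K * s)) (expR (- K * s) * - K).
    have hl : is_derive s 1 (fun s : R => - K * s) (- K).
      have := @is_deriveZ _ _ _ id (- K) s 1 1 (is_derive_id s 1).
      by rewrite -[_ *: 1]/(_ * 1) mulr1.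
    exact: (is_derive1_comp (is_derive_expR _) hl).
  apply: (is_derive_eq (is_deriveM hE hF)).
  by rewrite -![_ *: _]/(_ * _); ring.
have cG s : 0 < s < T -> {for s, continuous G}.
  move=> sT; apply: differentiable_continuous; apply/derivable1_diffP.
  by case: (hG s sT).
have Gle : G t <= G 0.
  apply: (@ler0_derive1_le_cc _ G 0 t); rewrite ?bound_itvE ?(ltW t0) ?lexx//.
  - by move=> s; rewrite in_itv/= => /andP[s0 st]; case: (hG s _) => //; rewrite s0 (lt_trans st).
  - move=> s; rewrite in_itv/= => /andP[s0 st].
    have sT : 0 < s < T by rewrite s0 (lt_trans st).
    rewrite derive1E (@derive_val _ _ _ _ _ _ _ (hG s sT)).
    by rewrite mulr_ge0_le0 ?expR_ge0// subr_le0 dFle.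
  apply/continuous_within_itvP => //; split.
  - by move=> s; rewrite in_itv/= => /andP[s0 st]; apply: cG; rewrite s0 (lt_trans st).
  - apply: cvgM.
      apply: cvg_at_right_filter.
      have : continuous (fun s => expR (- K * s)).
        by move=> s; apply: continuous_comp; [exact: mulrl_continuous|exact: continuous_expR].
      exact.
    apply: cvg_trans F0; apply: cvg_app.
    move=> A [e /= e0 HA]; near=> s; apply: HA => /=.
      by rewrite /ball/= sub0r normrN gtr0_norm//; near: s; exact: nbhs_right_lt.
    rewrite in_itv/= ltW//=.
    by apply: ltW; near: s; apply: nbhs_right_lt; exact: lt_trans tT.
  - by apply: cvg_at_left_filter; apply: cG; rewrite t0.
move: Gle; rewrite /G mulr0 expR0 mul1r mulNr expRN => H.
by rewrite -ler_pdivrMl ?expR_gt0.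
Unshelve. all: by end_near. Qed.

End TimeBounds.

(** * Strong solutions in components *)

Section SolutionFields.
Context {R : realType}.
Local Notation E := 'rV[R]_3.

Lemma udiff_is_derive {X : Type} (f : R -> X -> R) t (df : X -> R) x :
  udiff f t df -> is_derive t 1 (fun s => f s x) (df x).
Proof.
move=> [_ [_ H]].
have c : (fun d : R => d^-1 *: (((fun s => f s x) \o shift t) (d *: 1) - f t x))
    @ 0^' --> df x.
  apply/cvgrPdist_le => e e0; apply: filterS (H e e0) => d Hd.
  rewrite distrC; have := Hd x; congr (`|_ - _| <= _).
  by rewrite /= -[d *: 1]/(d * 1) mulr1 [d + t]addrC.
split; first by apply/cvg_ex; exists (df x).
exact: cvg_lim c.
Qed.

Lemma continuous_deriv_pos (h : R -> R) (n : nat) : C3_pos_nonneg h -> (n < 4)%N ->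
  forall r : R, 0 < r -> {for r, continuous (derive1n n h)}.
Proof.
move=> hh n4 r r0; have [_ dh ch] := hh r r0.
move: n4; rewrite ltnS leq_eqVlt => /predU1P[->//|n3].
by apply: differentiable_continuous; apply/derivable1_diffP; exact: dh.
Qed.

Lemma Ck_pressure (h : R -> R) (f : E -> R) : C3_pos_nonneg h -> Ck 1 f ->
  (forall x, 0 < f x) -> Ck 1 (fun x => derive1 h (f x)).
Proof.
move=> hh Cf f0; apply: Ck1_comp => // x.
  by have [_ dh _] := hh (f x) (f0 x); exact: (dh 1%N isT).
have := continuous_deriv_pos hh (n := 2) isT (f0 x).
by rewrite derive1nS derive1n1.
Qed.

Lemma partial_pressure (h : R -> R) (f : E -> R) i x : C3_pos_nonneg h -> Ck 1 f ->
  (forall x, 0 < f x) ->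
  partial i (fun x => derive1 h (f x)) x = derive1n 2 h (f x) * partial i f x.
Proof.
move=> hh Cf f0.
have dh : derivable (derive1 h) (f x) 1.
  by have [_ dh _] := hh (f x) (f0 x); exact: (dh 1%N isT).
have [_ ->] := partial_comp (Ck_derivable (x := x) (i := i) Cf) dh.
by rewrite derive1nS derive1n1.
Qed.

(** On a compact set of positive densities $h''$ is bounded by continuity, and Lipschitz
    by the mean value theorem, since $h'''$ is bounded there. *)
Lemma second_derivative_bounds (h : R -> R) (c C : R) : C3_pos_nonneg h -> 0 < c ->
  exists2 G : R, 0 <= G & forall a b, c <= a <= C -> c <= b <= C ->
    `|derive1n 2 h a| <= G /\ `|derive1n 2 h a - derive1n 2 h b| <= G * `|a - b|.
Proof.
move=> hh c0.
have bnd n : (n < 4)%N -> exists2 M : R, 0 <= M &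
    forall a, c <= a <= C -> `|derive1n n h a| <= M.
  move=> n4.
  have cont : {within `[c, C], continuous (derive1n n h)}.
    apply: continuous_in_subspaceT => r; rewrite inE/= in_itv/= => /andP[cr _].
    by apply: continuous_deriv_pos => //; exact: lt_le_trans cr.
  have /compact_bounded[M [Mr H]] := continuous_compact cont (@segment_compact _ c C).
  exists (`|M| + 1); first by rewrite addr_ge0.
  move=> a ac; apply: (H (`|M| + 1)); first by rewrite ltr_pwDr// ler_norm.
  by exists a => //=; rewrite in_itv.
have [M2 M20 H2] := bnd 2%N isT; have [M3 M30 H3] := bnd 3%N isT.
exists (M2 + M3); first exact: addr_ge0.
move=> a b ac bc; split; first by rewrite (le_trans (H2 a ac))// lerDl.
wlog ab : a b ac bc / a <= b.
  move=> W; have [|/ltW] := leP a b; first exact: W.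
  by move=> ba; rewrite distrC [`|a - b|]distrC; exact: W.
have [x xab e] : exists2 x, x \in `[a, b] &
    derive1n 2 h b - derive1n 2 h a = derive1n 3 h x * (b - a).
  apply: (@MVT_segment _ (derive1n 2 h) (derive1n 3 h) a b ab).
    move=> x; rewrite in_itv/= => /andP[ax xb].
    have x0 : 0 < x by rewrite (lt_trans _ ax)// (lt_le_trans c0)//; case/andP: ac.
    have [_ dh _] := hh x x0.
    by apply: DeriveDef; [exact: (dh 2%N isT)|exact: esym (derive1E _ _)].
  apply: continuous_in_subspaceT => r; rewrite inE/= in_itv/= => /andP[ar _].
  have r0 : 0 < r by rewrite (lt_le_trans c0)// (le_trans _ ar)//; case/andP: ac.
  exact: (continuous_deriv_pos hh (n := 2) isT r0).
rewrite distrC e normrM [`|b - a|]distrC ler_wpM2r//.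
apply: le_trans (H3 x _) _; last by rewrite lerDr.
move: xab; rewrite in_itv/= => /andP[ax xb]; case/andP: ac => ca _; case/andP: bc => _ bC.
by rewrite (le_trans ca)//= (le_trans xb).
Qed.

Section OneSolution.
Variables (h : R -> R) (Ckappa T : R).
Hypothesis hh : C3_pos_nonneg h.
Variables (rho : R -> E -> R) (u : R -> E -> E) (sig : R -> E -> R) (v : R -> E -> E).
Hypothesis Crho : C0_Ck T 3 rho.
Hypothesis rho_pos : forall t x, 0 <= t <= T -> 0 < rho t x.
Hypothesis Cu : C0_Ck T 1 u.
Hypothesis dsig : is_time_deriv T 1 rho sig.
Hypothesis dv : is_time_deriv T 0 u v.
Hypothesis massE : mass_eq T rho u.
Hypothesis momE : momentum_eq h Ckappa T rho u.

Let itv0 t : 0 < t < T -> 0 <= t <= T.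
Proof. by move=> /andP[? ?]; rewrite !ltW. Qed.

Lemma Ck_velocity t j : 0 <= t <= T -> Ck 1 (fun x => u t x 0 j).
Proof. by move=> tT; have [Cu' _] := Cu; have [] := Ck_coord j (Cu' t tT). Qed.

Lemma Ck_acceleration t j : 0 < t < T -> Ck 0 (fun x => v t x 0 j).
Proof. by move=> tT; have [_ Cv _] := dv tT; have [] := Ck_coord j Cv. Qed.

Let coordB j (a b : E) : (a - b) 0 j = a 0 j - b 0 j. Proof. by rewrite !mxE. Qed.
Let coordZ j (c : R) (a : E) : (c *: a) 0 j = c * a 0 j. Proof. by rewrite mxE. Qed.
Let coord_le j (a : E) : `|a 0 j| <= `|a|.
Proof. rewrite [leRHS]/Num.Def.normr/= mx_normrE; exact: (le_bigmax _ _ (0, j)). Qed.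

Lemma udiff_density t : 0 < t < T -> udiff rho t (sig t).
Proof.
move=> tT; exact: (udiff_time_deriv (phi := id) (fun _ _ => erefl) (fun _ _ => erefl)
  (fun=> lexx _) dsig tT (s := [::]) isT).
Qed.

Lemma udiff_grad_density t i : 0 < t < T ->
  udiff (fun s => partial i (rho s)) t (partial i (sig t)).
Proof.
move=> tT; exact: (udiff_time_deriv (phi := id) (fun _ _ => erefl) (fun _ _ => erefl)
  (fun=> lexx _) dsig tT (s := [:: i]) isT).
Qed.

Lemma udiff_velocity t j : 0 < t < T ->
  udiff (fun s x => u s x 0 j) t (fun x => v t x 0 j).
Proof.
move=> tT; exact: (udiff_time_deriv (phi := fun a : E => a 0 j) (coordB j) (coordZ j)
  (coord_le j) dv tT (s := [::]) isT).
Qed.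

Lemma ulim_density t0 : 0 <= t0 <= T ->
  ulim (within `[0, T] (nbhs t0)) rho (rho t0).
Proof.
move=> tT; exact: (ulim_C0_Ck (phi := id) (fun _ _ => erefl)
  (fun=> lexx _) Crho tT (s := [::]) isT).
Qed.

Lemma ulim_grad_density t0 i : 0 <= t0 <= T ->
  ulim (within `[0, T] (nbhs t0)) (fun t => partial i (rho t)) (partial i (rho t0)).
Proof.
move=> tT; exact: (ulim_C0_Ck (phi := id) (fun _ _ => erefl)
  (fun=> lexx _) Crho tT (s := [:: i]) isT).
Qed.

Lemma ulim_velocity t0 j : 0 <= t0 <= T ->
  ulim (within `[0, T] (nbhs t0)) (fun t x => u t x 0 j) (fun x => u t0 x 0 j).
Proof.
move=> tT; exact: (ulim_C0_Ck (phi := fun a : E => a 0 j) (coordB j)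
  (coord_le j) Cu tT (s := [::]) isT).
Qed.

Lemma mass_pointwise t x : 0 < t < T ->
  sig t x + divv (fun i y => rho t y * u t y 0 i) x = 0.
Proof.
move=> tT; have := massE x tT.
have H := udiff_is_derive x (udiff_density tT).
rewrite derive1E (@derive_val _ _ _ _ _ _ _ H); congr (_ + _ = _).
rewrite /divergence /divv; apply: eq_bigr => i _; congr partial.
by apply/funext => y; rewrite /momentum mxE.
Qed.

Lemma lapE (f : E -> R) : laplacian f = lap f.
Proof.
apply/funext => x; rewrite /laplacian /divergence /lap; apply: eq_bigr => i _.
by congr partial; apply/funext => y; rewrite mxE.
Qed.

(** The derivative of the momentum is split by the product rule into those of the
    density and of the velocity, which [velocity_eq] needs separately. *)
Lemma momentum_pointwise t x j : 0 < t < T ->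
  sig t x * u t x 0 j + rho t x * v t x 0 j
    + \sum_i partial i (fun y => rho t y * u t y 0 j * u t y 0 i) x
  = - (rho t x * (partial j (fun y => derive1 h (rho t y)) x
                  - Ckappa * partial j (lap (rho t)) x)).
Proof.
move=> tT; have tT' := itv0 tT.
have Hr := udiff_is_derive x (udiff_density tT).
have Hu k := udiff_is_derive x (udiff_velocity k tT).
have Hm k : is_derive t 1 (fun s => momentum (rho s) (u s) x 0 k)
    (sig t x * u t x 0 k + rho t x * v t x 0 k).
  have -> : (fun s => momentum (rho s) (u s) x 0 k) = (fun s => rho s x) * (fun s => u s x 0 k).
    by apply/funext => s; rewrite /momentum mxE.
  apply: (is_derive_eq (is_deriveM Hr (Hu k))).
  by rewrite -![_ *: _]/(_ * _) addrC mulrC.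
have dm : derivable (fun s => momentum (rho s) (u s) x) t 1.
  by apply/derivable_mxP => i k; rewrite (ord1 i); case: (Hm k).
have := momE x tT; rewrite derive1E (derive_mx dm) => /rowP/(_ j).
rewrite !mxE (@derive_val _ _ _ _ _ _ _ (Hm j)) lapE => e.
have C3 : Ck 3 (rho t) by have [+ _] := Crho; apply.
have Cl : Ck 1 (lap (rho t)) by rewrite /lap; ck.
have C1 : Ck 1 (rho t) by exact: CkW C3.
have CP := Ck_pressure hh C1 (fun x => rho_pos x tT').
have hP : has_partial j (fun y => derive1 h (rho t y) - Ckappa * lap (rho t) y)
    (fun y => partial j (fun y => derive1 h (rho t y)) y
      - (0 * lap (rho t) y + Ckappa * partial j (lap (rho t)) y)).
  apply: has_partialD; first exact: has_partialW.
  apply: has_partialN; apply: has_partialM; [exact: has_partial_cst|exact: has_partialW].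
move: e; rewrite (has_partialE x hP) mul0r add0r => <-; congr (_ + _).
apply: eq_bigr => i _; congr partial; apply/funext => y.
by rewrite !mxE big_ord1 !mxE mulrA.
Qed.

End OneSolution.

End SolutionFields.

(** * The energy estimate *)

Section EnergyDerivative.
Context {R : realType}.
Local Notation E := 'rV[R]_3.
Variables (Ckappa c t : R).
Variables (rho rhob : R -> E -> R) (u ub : 'I_3 -> R -> E -> R).

Let en s := energy Ckappa (rho s) (rhob s) (fun j => u j s) (fun j => ub j s).

(** The formal product rule behind [energy_t] is legitimate. *)
Lemma udiff_energy (sig sigb : E -> R) (v vb : 'I_3 -> E -> R) :
  0 < c -> (forall x, c <= rhob t x) -> (\forall d \near 0^', forall x, c <= rhob (t + d) x) ->
  udiff rho t sig -> (forall i, udiff (fun s => partial i (rho s)) t (partial i sig)) ->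
  udiff rhob t sigb -> (forall i, udiff (fun s => partial i (rhob s)) t (partial i sigb)) ->
  (forall j, udiff (u j) t (v j)) -> (forall j, udiff (ub j) t (vb j)) ->
  udiff en t (energy_t Ckappa (rho t) (rhob t) sig sigb (fun j => u j t) (fun j => ub j t) v vb).
Proof.
move=> c0 ct cn hr hdr hrb hdrb hu hub.
have hK := udiffV c0 ct cn hrb.
have hc (k : R) : udiff (fun (_ : R) (_ : E) => k) t (fun=> 0).
  by apply: udiff_cst; exists `|k|.
have hZ i := udiffD (udiffM hrb (hdr i)) (udiffN (udiffM hr (hdrb i))).
have hq := udiffD (udiffM hr hK) (udiffN (hc 1)).
have hw j := udiffD (hu j) (udiffN (hub j)).
have hN := udiff_sum (fun j => udiff_sqr (hw j)).
have hG := udiff_sum (fun i => udiff_sqr (udiffM hK (hZ i))).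
have H := udiffD (udiffD (udiffM (hc (Ckappa / 2)) hG)
  (udiffM (udiffM hr (hc 2^-1)) hN)) (udiffM (udiffM hrb (hc 2^-1)) (udiff_sqr hq)).
apply: (udiff_eq H) => x.
rewrite /energy_t /speed2 /rdvel /dvel /reldens /reldens_t /flux_t /flux !sum3.
have rb0 : rhob t x != 0 by rewrite gt_eqF// (lt_le_trans c0).
gen_partials; field; exact: rb0.
Qed.

End EnergyDerivative.

Local Notation coords u := (fun (j : 'I_3) x => u x 0 j).

Section EnergyEstimate.
Context {R : realType}.
Local Notation E := 'rV[R]_3.

(** Both $\rho-\bar\rho=\bar\rho q$ and $\nabla(\rho-\bar\rho)=\bar\rho\nabla
    q+q\nabla\bar\rho$ are controlled by $q$ and its gradient. *)
Lemma pressure_difference_le (h : R -> R) (c C M G : R) (rho rhob : E -> R) j x :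
  C3_pos_nonneg h -> 0 < c ->
  (forall a b, c <= a <= C -> c <= b <= C ->
    `|derive1n 2 h a| <= G /\ `|derive1n 2 h a - derive1n 2 h b| <= G * `|a - b|) ->
  Ck 3 rho -> Ck 3 rhob ->
  (forall y, c <= rho y <= C) -> (forall y, c <= rhob y <= C) ->
  `|partial j rhob x| <= M ->
  `|partial j (fun y => derive1 h (rho y)) x - partial j (fun y => derive1 h (rhob y)) x| <=
  G * (C * M + C + M) * (`|partial j (reldens rho rhob) x| + `|reldens rho rhob x|).
Proof.
move=> hh c0 hG Crho Crhob bnd bndb dM.
have pos (f : E -> R) : (forall y, c <= f y <= C) -> forall y, 0 < f y.
  by move=> H y; have /andP[+ _] := H y; exact: lt_le_trans.
have rb0 y : rhob y != 0 by rewrite gt_eqF// pos.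
have [G2 G2L] := hG _ _ (bnd x) (bndb x).
have [C1 C1b] : Ck 1 rho /\ Ck 1 rhob by split; ck.
rewrite (partial_pressure j x hh C1 (pos _ bnd)) (partial_pressure j x hh C1b (pos _ bndb)).
rewrite (partial_reldens Crho Crhob rb0 j x).
have G0 : 0 <= G by exact: le_trans (normr_ge0 _) G2.
have M0 : 0 <= M by exact: le_trans (normr_ge0 _) dM.
have bC : `|rhob x| <= C by case/andP: (bndb x) => _ ?; rewrite gtr0_norm ?pos.
have C0 : 0 <= C by exact: le_trans (normr_ge0 _) bC.
have e1 : rho x - rhob x = rhob x * reldens rho rhob x.
  by rewrite /reldens; field; exact: rb0.
have e2 : partial j rho x = partial j rhob x
    + (rhob x * ((rhob x)^-1 ^+ 2 * flux rho rhob j x) + reldens rho rhob x * partial j rhob x).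
  by rewrite /reldens /flux; gen_partials; field; exact: rb0.
rewrite e1 in G2L; rewrite e2.
move: G2 G2L dM bC; move: (derive1n 2 h (rho x)) (derive1n 2 h (rhob x)).
move: (rhob x) ((rhob x)^-1 ^+ 2 * _) (partial j rhob x) (reldens rho rhob x).
move=> r p d q H Hb HG HL dM rC.
have -> : H * (d + (r * p + q * d)) - Hb * d = (H - Hb) * d + H * (r * p + q * d) by ring.
have t1 : `|(H - Hb) * d| <= G * (C * `|q|) * M.
  by apply: le_normrM => //; rewrite (le_trans HL)// ler_wpM2l// normrM ler_wpM2r.
have t2 : `|H * (r * p + q * d)| <= G * (C * `|p| + `|q| * M).
  by apply: le_normrM => //; apply: le_normrD2; rewrite normrM ?ler_wpM2r ?ler_wpM2l.
apply: (le_trans (le_normrD2 t1 t2)).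
rewrite -subr_ge0.
have -> : G * (C * M + C + M) * (`|p| + `|q|) - (G * (C * `|q|) * M + G * (C * `|p| + `|q| * M))
   = G * (C * M * `|p| + M * `|p| + C * `|q|) by ring.
by rewrite mulr_ge0// !addr_ge0// !mulr_ge0.
Qed.

(** All the derivatives of the reference solution that enter the growth rate are
    controlled by its norm in $C^0([0,T],C^3)\times C^0([0,T],C^1)$; for the time
    derivative of the density this uses the mass balance, since that derivative need
    not stay bounded in $C^1$ up to the initial time. *)
Lemma reference_bounds (T : R) (rho sig : R -> E -> R) (u : R -> E -> E) :
  C0_Ck T 3 rho -> C0_Ck T 1 u -> is_time_deriv T 1 rho sig -> mass_eq T rho u ->
  exists M : R, forall t x, 0 < t < T ->
    [/\ `|sig t x| <= M,
        forall j, `|u t x 0 j| <= M /\ forall i, `|partial i (coords (u t) j) x| <= M,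
        forall i, `|partial i (rho t) x| <= M,
        forall i, `|partial i (partial i (rho t)) x| <= M
      & forall i j, `|partial j (partial i (partial i (rho t))) x| <= M].
Proof.
move=> Crho Cu dsig massE.
have [M1 H1] := C0_Ck_bounded Crho; have [M2 H2] := C0_Ck_bounded Cu.
pose N := `|M1| + `|M2|; have N0 : 0 <= N by rewrite addr_ge0.
have coord_le j (a : E) : `|a 0 j| <= `|a|.
  by rewrite [leRHS]/Num.Def.normr/= mx_normrE; exact: (le_bigmax _ _ (0, j)).
(* The second summand bounds the divergence of the momentum. *)
exists (N + 3 * (N * N + N * N)) => t x t0T.
have tT : 0 <= t <= T by case/andP: t0T => ? ?; rewrite !ltW.
have NM : N <= N + 3 * (N * N + N * N) by rewrite lerDl mulr_ge0// addr_ge0// mulr_ge0.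
have R1 s : (size s <= 3)%N -> `|partials s (rho t) x| <= N.
  by move=> s3; rewrite (le_trans (H1 _ _ _ tT s3))// (le_trans (ler_norm _))// lerDl.
have U1 s : (size s <= 1)%N -> `|partials s (u t) x| <= N.
  by move=> s1; rewrite (le_trans (H2 _ _ _ tT s1))// (le_trans (ler_norm _))// lerDr.
have Cut : Ck 1 (u t) by have [+ _] := Cu; exact.
have u0 j : `|u t x 0 j| <= N by exact: le_trans (coord_le j _) (U1 [::] isT).
have u1 i j : `|partial i (coords (u t) j) x| <= N.
  by rewrite (partial_coord i j x Cut); exact: le_trans (coord_le j _) (U1 [:: i] isT).
have r1 i : `|partial i (rho t) x| <= N := R1 [:: i] isT.
split.
- have := mass_pointwise dsig massE x t0T => /eqP; rewrite addr_eq0 => /eqP ->.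
  rewrite normrN; apply: (@le_trans _ _ (3 * (N * N + N * N))); last by rewrite lerDr.
  apply: le_normr_sum3 => i.
  have [Cr Cuj] : Ck 1 (rho t) /\ Ck 1 (coords (u t) i).
    by split; [have [+ _] := Crho => /(_ t tT) ?; ck|have [] := Ck_coord i Cut].
  have hp1 : has_partial i (fun y => rho t y * u t y 0 i)
     (fun y => partial i (rho t) y * u t y 0 i + rho t y * partial i (coords (u t) i) y).
    exact: (has_partialM (has_partialW i Cr) (has_partialW i Cuj)).
  rewrite (has_partialE x hp1).
  exact: (le_normrD2 (le_normrM (r1 i) (u0 i)) (le_normrM (R1 [::] isT) (u1 i i))).
- by move=> j; split=> [|i]; exact: le_trans NM.
- by move=> i; exact: le_trans NM.
- by move=> i; exact: le_trans (R1 [:: i; i] isT) NM.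
- by move=> i j; exact: le_trans (R1 [:: j; i; i] isT) NM.
Qed.

Lemma Ck_energy Ckappa (rho rhob : E -> R) (u ub : 'I_3 -> E -> R) :
  Ck 3 rho -> Ck 3 rhob -> (forall j, Ck 1 (u j)) -> (forall j, Ck 1 (ub j)) ->
  (forall x, rhob x != 0) -> Ck 0 (energy Ckappa rho rhob u ub).
Proof.
move=> Crho Crhob Cu Cub rb0; have Cr := CkV rb0 Crhob.
have Cr0 : Ck 0 (fun x => (rhob x)^-1) by exact: CkW Cr.
have CZ i : Ck 0 (flux rho rhob i) by rewrite /flux; ck.
have CN : Ck 0 (speed2 u ub) by rewrite /speed2 /dvel; ck.
have Cq : Ck 0 (reldens rho rhob) by rewrite /reldens; ck.
rewrite /energy; ck.
Qed.

Lemma Ck_energy_t Ckappa (rho rhob sig sigb : E -> R) (u ub v vb : 'I_3 -> E -> R) :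
  Ck 3 rho -> Ck 3 rhob -> Ck 1 sig -> Ck 1 sigb ->
  (forall j, Ck 1 (u j)) -> (forall j, Ck 1 (ub j)) ->
  (forall j, Ck 0 (v j)) -> (forall j, Ck 0 (vb j)) ->
  (forall x, rhob x != 0) -> Ck 0 (energy_t Ckappa rho rhob sig sigb u ub v vb).
Proof.
move=> Crho Crhob Csig Csigb Cu Cub Cv Cvb rb0; have Cr := CkV rb0 Crhob.
have Cr0 : Ck 0 (fun x => (rhob x)^-1) by exact: CkW Cr.
have CZ i : Ck 0 (flux rho rhob i) by rewrite /flux; ck.
have CZt i : Ck 0 (flux_t rho rhob sig sigb i) by rewrite /flux_t; ck.
have CN : Ck 0 (speed2 u ub) by rewrite /speed2 /dvel; ck.
have CW j : Ck 0 (rdvel rho u ub j) by rewrite /rdvel /dvel; ck.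
have Cq : Ck 0 (reldens rho rhob) by rewrite /reldens; ck.
have Cqt : Ck 0 (reldens_t rho rhob sig sigb) by rewrite /reldens_t; ck.
have [Cs Csb] : Ck 0 sig /\ Ck 0 sigb by split; ck.
have [Cx Cxb] : Ck 0 rho /\ Ck 0 rhob by split; ck.
rewrite /energy_t; ck.
Qed.

Lemma ulim_energy (F : set_system R) {FF : Filter F} (Ckappa c : R)
    (rho rhob : R -> E -> R) (u ub : 'I_3 -> R -> E -> R)
    (rho0 rhob0 : E -> R) (u0 ub0 : 'I_3 -> E -> R) :
  0 < c -> (forall x, c <= rhob0 x) -> (\forall t \near F, forall x, c <= rhob t x) ->
  ulim F rho rho0 -> (forall i, ulim F (fun t => partial i (rho t)) (partial i rho0)) ->
  ulim F rhob rhob0 -> (forall i, ulim F (fun t => partial i (rhob t)) (partial i rhob0)) ->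
  (forall j, ulim F (u j) (u0 j)) -> (forall j, ulim F (ub j) (ub0 j)) ->
  ulim F (fun t => energy Ckappa (rho t) (rhob t) (fun j => u j t) (fun j => ub j t))
    (energy Ckappa rho0 rhob0 u0 ub0).
Proof.
move=> c0 ct cn hr hdr hrb hdrb hu hub.
have uM f g lf lg : ulim F f lf -> ulim F g lg ->
    ulim F (fun t (x : E) => f t x * g t x) (fun x => lf x * lg x) by exact: ulimM.
have uB f g lf lg : ulim F f lf -> ulim F g lg ->
    ulim F (fun t (x : E) => f t x - g t x) (fun x => lf x - lg x).
  by move=> hf hg; apply: ulimD => //; exact: ulimN.
have uS n f lf : (forall l : 'I_n, ulim F (f l) (lf l)) ->
    ulim F (fun t (x : E) => \sum_l f l t x ^+ 2) (fun x => \sum_l lf l x ^+ 2).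
  move=> H; apply: (ulim_sum (f := fun l t x => f l t x ^+ 2)) => l.
  exact: (uM _ _ _ _ (H l) (H l)).
have hK : ulim F _ _ := @ulimV _ _ _ FF _ _ _ c0 ct cn hrb.
have hc (k : R) : ulim F (fun (_ : R) (_ : E) => k) (fun=> k).
  by apply: ulim_cst; exists `|k|.
have hZ i := uB _ _ _ _ (uM _ _ _ _ hrb (hdr i)) (uM _ _ _ _ hr (hdrb i)).
have hG := uS _ _ _ (fun i => uM _ _ _ _ hK (hZ i)).
have hN := uS _ _ _ (fun j => uB _ _ _ _ (hu j) (hub j)).
have hq := uB _ _ _ _ (uM _ _ _ _ hr hK) (hc 1).
have G2 := uM _ _ _ _ (hc (Ckappa / 2)) hG.
have N2 := uM _ _ _ _ (uM _ _ _ _ hr (hc 2^-1)) hN.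
have q2 := uM _ _ _ _ (uM _ _ _ _ hrb (hc 2^-1)) (uM _ _ _ _ hq hq).
have GN : ulim F _ _ := @ulimD _ _ _ FF _ _ _ _ G2 N2.
exact: (@ulimD _ _ _ FF _ _ _ _ GN q2).
Qed.

End EnergyEstimate.

Section MainEstimate.
Context {R : realType}.
Local Notation E := 'rV[R]_3.
Variables (h : R -> R) (Ckappa T c C : R).
Hypotheses (hh : C3_pos_nonneg h) (Ckappa0 : 0 < Ckappa) (T0 : 0 < T) (c0 : 0 < c).

Definition density_bounds (rho : R -> E -> R) :=
  forall t x, 0 <= t <= T -> c <= rho t x <= C.

Lemma energy_ge0 (rho rhob : E -> R) (u ub : 'I_3 -> E -> R) x :
  0 <= rho x -> 0 <= rhob x -> 0 <= energy Ckappa rho rhob u ub x.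
Proof.
move=> r0 rb0; have k0 := ltW Ckappa0.
rewrite /energy !addr_ge0// mulr_ge0 ?divr_ge0 ?sqr_ge0//.
  by apply: sumr_ge0 => i _; exact: sqr_ge0.
by apply: sumr_ge0 => i _; exact: sqr_ge0.
Qed.

(** The constant is chosen before the first solution: it depends on that solution
    through the density bounds only. This uniformity is what allows several
    solutions to be compared with the same one. *)
Lemma energy_estimate (rhob : R -> E -> R) (ub : R -> E -> E) rhob0 ub0 :
  strong_solution h Ckappa T rhob0 ub0 rhob ub -> density_bounds rhob ->
  exists2 A : R, 0 <= A & forall rho u rho0 u0,
    strong_solution h Ckappa T rho0 u0 rho u -> density_bounds rho ->
    forall t, 0 < t < T ->
      tint (energy Ckappa (rho t) (rhob t) (coords (u t)) (coords (ub t))) <=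
      A * tint (energy Ckappa rho0 rhob0 (coords u0) (coords ub0)).
Proof.
move=> [[[Crhob [sigb dsigb _]] posb [Cub [vb dvb _]]] massb momb ib1 ib2] bndb.
have [M HM] := reference_bounds Crhob Cub dsigb massb.
have [G G0 HG] := second_derivative_bounds C hh c0.
pose H := G * (C * `|M| + C + `|M|).
have C0 : 0 <= C.
  have /andP[h1 h2] := bndb 0 0 (introT andP (conj (lexx 0) (ltW T0))).
  exact: le_trans (ltW c0) (le_trans h1 h2).
have H0 : 0 <= H by rewrite mulr_ge0// !addr_ge0// mulr_ge0.
pose K := `|growth_rate Ckappa c C `|M| H|.
exists (expR (K * T)) => [|rho u rho0 u0]; first exact: expR_ge0.
move=> [[[Crho [sig dsig _]] pos [Cu [v dv _]]] mass mom i1 i2] bnd t tT.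
have rho00 : rho 0 = rho0 by apply/funext.
have rhob00 : rhob 0 = rhob0 by apply/funext.
have u00 : u 0 = u0 by apply/funext.
have ub00 : ub 0 = ub0 by apply/funext.
have itv s : 0 < s < T -> 0 <= s <= T by move=> /andP[? ?]; rewrite !ltW.
have in0 : 0 <= (0 : R) <= T by rewrite lexx ltW.
pose en s := energy Ckappa (rho s) (rhob s) (coords (u s)) (coords (ub s)).
pose en' s := energy_t Ckappa (rho s) (rhob s) (sig s) (sigb s)
  (coords (u s)) (coords (ub s)) (coords (v s)) (coords (vb s)).
have rb0 s : 0 <= s <= T -> forall x, rhob s x != 0 by move=> sT x; rewrite gt_eqF// posb.
have r0 s : 0 <= s <= T -> forall x, rho s x != 0 by move=> sT x; rewrite gt_eqF// pos.
have [Cr Crb] : (forall s, 0 <= s <= T -> Ck 3 (rho s)) /\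
    (forall s, 0 <= s <= T -> Ck 3 (rhob s)) by case: Crho Crhob => [+ _] [+ _].
have Cen s : 0 <= s <= T -> Ck 0 (en s).
  move=> sT; apply: Ck_energy; [exact: Cr|exact: Crb| | |exact: rb0].
    by move=> j; exact: (Ck_velocity Cu j sT).
  by move=> j; exact: (Ck_velocity Cub j sT).
have Cen' s : 0 < s < T -> Ck 0 (en' s).
  move=> sT; have sT' := itv s sT; apply: Ck_energy_t; [exact: Cr|exact: Crb| | | | | | |exact: rb0].
  - by have [] := dsig s sT.
  - by have [] := dsigb s sT.
  - by move=> j; exact: (Ck_velocity Cu j sT').
  - by move=> j; exact: (Ck_velocity Cub j sT').
  - by move=> j; exact: (Ck_acceleration dv j sT).
  - by move=> j; exact: (Ck_acceleration dvb j sT).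
have den s : 0 < s < T -> is_derive s 1 (fun r => tint (en r)) (tint (en' s)).
  move=> sT; have sT' := itv s sT; apply: is_derive_tint.
  - apply: (@udiff_energy R Ckappa c s rho rhob (fun j r x => u r x 0 j)
      (fun j r x => ub r x 0 j) _ _ (coords (v s)) (coords (vb s))) => //.
    + by move=> x; have /andP[] := bndb s x sT'.
    + by apply: filterS (near_shift_itv sT) => d /itv dT x; have /andP[] := bndb _ x dT.
    + exact: (udiff_density dsig sT).
    + by move=> i; exact: (udiff_grad_density dsig i sT).
    + exact: (udiff_density dsigb sT).
    + by move=> i; exact: (udiff_grad_density dsigb i sT).
    + by move=> j; exact: (udiff_velocity dv j sT).
    + by move=> j; exact: (udiff_velocity dvb j sT).
  - exact: Cen.
  - exact: Cen'.
  - by apply: filterS (near_shift_itv sT) => d /itv dT; exact: Cen.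
have en0 s x : 0 <= s <= T -> 0 <= en s x.
  by move=> sT; apply: energy_ge0; apply: ltW; [exact: pos|exact: posb].
have dle s : 0 < s < T -> tint (en' s) <= K * tint (en s).
  move=> sT; have sT' := itv s sT.
  have [Cs Csb] : Ck 1 (sig s) /\ Ck 1 (sigb s).
    by split; [have [] := dsig s sT|have [] := dsigb s sT].
  have Cr1 : Ck 1 (rho s) by exact: CkW (Cr s sT').
  have Crb1 : Ck 1 (rhob s) by exact: CkW (Crb s sT').
  have P1 := Ck_pressure hh Cr1 (fun x => pos s x sT').
  have P2 := Ck_pressure hh Crb1 (fun x => posb s x sT').
  have Cuj j : Ck 1 (coords (u s) j) := Ck_velocity Cu j sT'.
  have Cubj j : Ck 1 (coords (ub s) j) := Ck_velocity Cub j sT'.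
  rewrite (tint_energy_t (Cr s sT') (Crb s sT') Cs Csb P1 P2 Cuj Cubj (r0 s sT') (rb0 s sT')
    (fun x => mass_pointwise dsig mass x sT) (fun x => mass_pointwise dsigb massb x sT)
    (fun x j => momentum_pointwise hh Crho pos dsig dv mom x j sT)
    (fun x j => momentum_pointwise hh Crhob posb dsigb dvb momb x j sT)).
  rewrite -tintZ; last exact: Cen.
  apply: le_tint; [|exact: (CkZ K (Cen s sT'))|].
    by apply: Ck_remainder => //; [exact: Cr|exact: Crb|exact: rb0].
  move=> x; have [b1 b2 b3 b4 b5] := HM s x sT.
  have MM := ler_norm M.
  apply: (@le_trans _ _ (growth_rate Ckappa c C `|M| H * en s x)); last first.
    by apply: ler_wpM2r; [exact: en0|exact: ler_norm].
  apply: (@remainder_le R Ckappa c C `|M| H Ckappa0 c0 H0 (rho s) (rhob s) (sigb s) _ _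
    (coords (u s)) (coords (ub s)) x (Cr s sT') (Crb s sT') Cubj (rb0 s sT')).
  - exact: bnd.
  - exact: bndb.
  - exact: le_trans MM.
  - by move=> j; have [h1 _] := b2 j; exact: le_trans MM.
  - by move=> i j; have [_ h1] := b2 j; exact: le_trans (h1 i) MM.
  - by move=> i; exact: le_trans (b3 i) MM.
  - by move=> i; exact: le_trans (b4 i) MM.
  - by move=> i j; exact: le_trans (b5 i j) MM.
  - move=> j; have b3' : `|partial j (rhob s) x| <= `|M| by exact: le_trans (b3 j) MM.
    exact: (@pressure_difference_le R h c C `|M| G (rho s) (rhob s) j x hh c0 HG (Cr s sT')
      (Crb s sT') (fun y => bnd s y sT') (fun y => bndb s y sT') b3').
have cont0 : tint (en r) @[r --> within `[0, T] (nbhs 0)] --> tint (en 0).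
  have near0 : \forall r \near within `[0, T] (nbhs 0), 0 <= r <= T.
    have near0 : \forall r \near within `[0, T] (nbhs (0 : R)), `[0, T]%classic r.
      exact: withinT.
    by apply: filterS near0 => r /=; rewrite in_itv.
  apply: tint_cvg; [| |exact: Cen].
    apply: (@ulim_energy R _ _ Ckappa c rho rhob (fun j r x => u r x 0 j)
      (fun j r x => ub r x 0 j) _ _ (coords (u 0)) (coords (ub 0))) => //.
    + by move=> x; have /andP[] := bndb 0 x in0.
    + by apply: filterS near0 => r rT x; have /andP[] := bndb r x rT.
    + exact: (ulim_density Crho in0).
    + by move=> i; exact: (ulim_grad_density Crho i in0).
    + exact: (ulim_density Crhob in0).
    + by move=> i; exact: (ulim_grad_density Crhob i in0).
    + by move=> j; exact: (ulim_velocity Cu j in0).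
    + by move=> j; exact: (ulim_velocity Cub j in0).
  by apply: filterS near0 => r; exact: Cen.
have := gronwall den dle cont0 tT.
rewrite -rho00 -rhob00 -u00 -ub00 -!/(en _) => gr.
apply: (le_trans gr); apply: ler_wpM2r.
  by apply: tint_ge0 => x; exact: en0.
by rewrite ler_expR ler_wpM2l ?normr_ge0//; case/andP: tT => _ /ltW.
Qed.

End MainEstimate.

(** * Energy, reduced relative energy and distance *)

Section Comparisons.
Context {R : realType}.
Local Notation E := 'rV[R]_3.

Lemma ler_sqrD2 (a b : R) : (a + b) ^+ 2 <= 2 * a ^+ 2 + 2 * b ^+ 2.
Proof.
by rewrite -subr_ge0 (_ : _ - _ = (a - b) ^+ 2) ?sqr_ge0//; ring.
Qed.

Definition distance2 (rho rhob : E -> R) (u ub : 'I_3 -> E -> R) x :=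
  (rho x - rhob x) ^+ 2 + \sum_i (partial i rho x - partial i rhob x) ^+ 2
  + speed2 u ub x.

Lemma Ck_distance2 (rho rhob : E -> R) (u ub : 'I_3 -> E -> R) :
  Ck 1 rho -> Ck 1 rhob -> (forall j, Ck 1 (u j)) -> (forall j, Ck 1 (ub j)) ->
  Ck 0 (distance2 rho rhob u ub).
Proof. by move=> ? ? ? ?; rewrite /distance2 /speed2 /dvel; ck. Qed.

Lemma distance2_triangle (rho rhob rhos : E -> R) (u ub us : 'I_3 -> E -> R) x :
  distance2 rho rhob u ub x <=
  2 * distance2 rho rhos u us x + 2 * distance2 rhob rhos ub us x.
Proof.
have H (a b s : R) : (a - b) ^+ 2 <= 2 * (a - s) ^+ 2 + 2 * (b - s) ^+ 2.
  have := ler_sqrD2 (a - s) (s - b).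
  by rewrite addrA subrK -[(s - b) ^+ 2]sqrrN opprB.
have S (f g k : 'I_3 -> R) : \sum_i (f i - g i) ^+ 2 <=
    2 * (\sum_i (f i - k i) ^+ 2) + 2 * (\sum_i (g i - k i) ^+ 2).
  by rewrite !mulr_sumr -big_split/=; apply: ler_sum => i _; exact: H.
rewrite /distance2 /speed2 /dvel.
have s1 := H (rho x) (rhob x) (rhos x).
have s2 := S (fun i => partial i rho x) (fun i => partial i rhob x) (fun i => partial i rhos x).
have s3 := S (fun i => u i x) (fun i => ub i x) (fun i => us i x).
move: s1 s2 s3; cbv beta.
move: ((rho x - rhob x) ^+ 2) ((rho x - rhos x) ^+ 2) ((rhob x - rhos x) ^+ 2).
move: (\sum_i (partial i rho x - partial i rhob x) ^+ 2)
  (\sum_i (partial i rho x - partial i rhos x) ^+ 2)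
  (\sum_i (partial i rhob x - partial i rhos x) ^+ 2).
move: (\sum_i (u i x - ub i x) ^+ 2) (\sum_i (u i x - us i x) ^+ 2)
  (\sum_i (ub i x - us i x) ^+ 2).
move=> a1 a2 a3 b1 b2 b3 d1 d2 d3; lra.
Qed.

Section Pointwise.
Variables (Ckappa c C M : R) (rho rhob : E -> R) (u ub : 'I_3 -> E -> R) (x : E).
Hypotheses (Ckappa0 : 0 < Ckappa) (c0 : 0 < c).
Hypotheses (bnd : c <= rho x) (bndb : c <= rhob x <= C).
Hypothesis dM : forall i, `|partial i rhob x| <= M.

Let q := reldens rho rhob x.
Let z i := (rhob x)^-1 * flux rho rhob i x.
Let d i := partial i rho x - partial i rhob x.

Let rb0 : 0 < rhob x. Proof. by case/andP: bndb => + _; exact: lt_le_trans. Qed.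
Let r0 : 0 < rho x. Proof. exact: lt_le_trans bnd. Qed.

Let rE : rho x - rhob x = rhob x * q.
Proof. by rewrite /q /reldens; field; rewrite gt_eqF. Qed.

Let dE i : d i = z i + q * partial i rhob x.
Proof. by rewrite /d /z /q /reldens /flux; gen_partials; field; rewrite gt_eqF. Qed.

Let qM i : (q * partial i rhob x) ^+ 2 <= M ^+ 2 * q ^+ 2.
Proof.
rewrite exprMn [leRHS]mulrC ler_wpM2l ?sqr_ge0// -real_normK ?num_real//.
by rewrite lerXn2r// nnegrE (le_trans (normr_ge0 _) (dM i)).
Qed.

Let sum_le (a b : 'I_3 -> R) K : (forall i, a i <= 2 * b i + K) ->
  \sum_i a i <= 2 * (\sum_i b i) + 3 * K.
Proof.
by move=> H; rewrite !sum3; have := H o0; have := H o1; have := H o2; lra.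
Qed.

(** Here $\rho-\bar\rho=\bar\rho q$ and
    $\partial_i(\rho-\bar\rho)=\bar\rho\,\partial_iq+q\,\partial_i\bar\rho$. *)
Lemma distance2_le_energy : distance2 rho rhob u ub x <=
  (4 / Ckappa + 2 / c + (C ^+ 2 + 6 * M ^+ 2) * (2 / c)) * energy Ckappa rho rhob u ub x.
Proof.
have sd : \sum_i d i ^+ 2 <= 2 * (\sum_i z i ^+ 2) + 3 * (2 * (M ^+ 2 * q ^+ 2)).
  apply: sum_le => i; rewrite dE (le_trans (ler_sqrD2 _ _))// lerD2l.
  by rewrite ler_pM2l.
have sr : (rho x - rhob x) ^+ 2 <= C ^+ 2 * q ^+ 2.
  rewrite rE exprMn ler_wpM2r ?sqr_ge0//; case/andP: bndb => _ rC.
  by rewrite lerXn2r// nnegrE ltW// (lt_le_trans rb0).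
rewrite /distance2 /energy -/q -/(z _).
have N0 : 0 <= speed2 u ub x by apply: sumr_ge0 => i _; exact: sqr_ge0.
have Z0 : 0 <= \sum_i z i ^+ 2 by apply: sumr_ge0 => i _; exact: sqr_ge0.
have Q0 : 0 <= q ^+ 2 by exact: sqr_ge0.
have k0 : 0 <= Ckappa^-1 by rewrite invr_ge0 ltW.
have ci0 : 0 <= c^-1 by rewrite invr_ge0 ltW.
have tZ : 2 * (\sum_i z i ^+ 2) = 4 / Ckappa * (Ckappa / 2 * \sum_i z i ^+ 2).
  by field; rewrite gt_eqF.
have le1 (y r : R) : 0 <= y -> c <= r -> y <= 2 / c * (r / 2 * y).
  move=> y0 cr; have -> : 2 / c * (r / 2 * y) = r / c * y by field; rewrite gt_eqF.
  by rewrite ler_peMl// ler_pdivlMr// mul1r.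
have tN : speed2 u ub x <= 2 / c * (rho x / 2 * speed2 u ub x) by exact: le1.
have tq : q ^+ 2 <= 2 / c * (rhob x / 2 * q ^+ 2).
  by apply: le1 => //; case/andP: bndb.
set eZ := Ckappa / 2 * _; set eN := rho x / 2 * _; set eq := rhob x / 2 * _.
have eZ0 : 0 <= eZ by rewrite mulr_ge0// divr_ge0// ltW.
have eN0 : 0 <= eN by rewrite mulr_ge0// divr_ge0// ltW.
have eq0 : 0 <= eq by rewrite mulr_ge0// divr_ge0// ltW.
pose B := C ^+ 2 + 6 * M ^+ 2.
have B0 : 0 <= B by rewrite addr_ge0 ?sqr_ge0// mulr_ge0// sqr_ge0.
have tB : B * q ^+ 2 <= B * (2 / c) * eq by rewrite -mulrA ler_wpM2l.
have split_le : 4 / Ckappa * eZ + 2 / c * eN + B * (2 / c) * eq <=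
    (4 / Ckappa + 2 / c + B * (2 / c)) * (eZ + eN + eq).
  rewrite -subr_ge0 (_ : _ - _ = 4 / Ckappa * (eN + eq) + 2 / c * (eZ + eq)
    + B * (2 / c) * (eZ + eN)); last by ring.
  have h4 : 0 <= 4 / Ckappa by exact: mulr_ge0.
  have h2 : 0 <= 2 / c by exact: mulr_ge0.
  have hB : 0 <= B * (2 / c) by exact: mulr_ge0.
  by rewrite !addr_ge0// mulr_ge0// addr_ge0.
apply: le_trans split_le; rewrite -tZ.
have eB : B * q ^+ 2 = C ^+ 2 * q ^+ 2 + 3 * (2 * (M ^+ 2 * q ^+ 2)) by rewrite /B; ring.
rewrite eB in tB; move: sd sr tN tB; rewrite /d.
move: (2 / c * eN) (B * (2 / c) * eq) (C ^+ 2 * q ^+ 2) (3 * (2 * (M ^+ 2 * q ^+ 2))).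
move: (\sum_i z i ^+ 2) (\sum_i _) (speed2 u ub x) ((rho x - rhob x) ^+ 2).
move=> a1 a2 a3 a4 a5 a6 a7 a8; lra.
Qed.

(** The converse comparison, from
    $\bar\rho\,\partial_iq=\partial_i(\rho-\bar\rho)-q\,\partial_i\bar\rho$. *)
Lemma energy_le_reduced : energy Ckappa rho rhob u ub x <=
  2 * (Ckappa / 2 * \sum_i d i ^+ 2 + rho x / 2 * speed2 u ub x)
  + (3 * Ckappa * M ^+ 2 / c ^+ 2 + 1 / (2 * c)) * (rho x - rhob x) ^+ 2.
Proof.
have sz : \sum_i z i ^+ 2 <= 2 * (\sum_i d i ^+ 2) + 3 * (2 * (M ^+ 2 * q ^+ 2)).
  apply: sum_le => i.
  have -> : z i = d i + - (q * partial i rhob x) by rewrite dE addrK.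
  by rewrite (le_trans (ler_sqrD2 _ _))// lerD2l ler_pM2l// sqrrN.
have [h1 _] := andP bndb.
have sq : q ^+ 2 <= (rho x - rhob x) ^+ 2 / c ^+ 2.
  rewrite rE exprMn ler_pdivlMr ?exprn_gt0// mulrC ler_wpM2r ?sqr_ge0//.
  by rewrite lerXn2r// nnegrE ltW.
have sb : rhob x / 2 * q ^+ 2 <= 1 / (2 * c) * (rho x - rhob x) ^+ 2.
  rewrite rE exprMn; have -> : 1 / (2 * c) * (rhob x ^+ 2 * q ^+ 2) =
    (rhob x / c) * (rhob x / 2 * q ^+ 2) by field; rewrite gt_eqF.
  rewrite ler_peMl//; first by rewrite mulr_ge0 ?sqr_ge0// divr_ge0// ltW.
  by rewrite ler_pdivlMr// mul1r.
have N0 : 0 <= speed2 u ub x by apply: sumr_ge0 => i _; exact: sqr_ge0.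
have eN0 : 0 <= rho x / 2 * speed2 u ub x by rewrite mulr_ge0// divr_ge0// ltW.
have sM : M ^+ 2 * q ^+ 2 <= M ^+ 2 * ((rho x - rhob x) ^+ 2 / c ^+ 2).
  by rewrite ler_wpM2l// sqr_ge0.
have k0 : 0 <= Ckappa / 2 by rewrite divr_ge0// ltW.
rewrite /energy -/q -/(z _).
have sk : Ckappa / 2 * (\sum_i z i ^+ 2) <= Ckappa / 2 * (2 * (\sum_i d i ^+ 2)
    + 3 * (2 * (M ^+ 2 * ((rho x - rhob x) ^+ 2 / c ^+ 2)))).
  rewrite ler_wpM2l// (le_trans sz)// lerD2l; move: sM.
  by move: (M ^+ 2 * q ^+ 2) (M ^+ 2 * _) => a b; lra.
have -> : (3 * Ckappa * M ^+ 2 / c ^+ 2 + 1 / (2 * c)) * (rho x - rhob x) ^+ 2 =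
  Ckappa / 2 * (3 * (2 * (M ^+ 2 * ((rho x - rhob x) ^+ 2 / c ^+ 2))))
  + 1 / (2 * c) * (rho x - rhob x) ^+ 2 by field; rewrite gt_eqF.
move: sk sb eN0; rewrite [Ckappa / 2 * (_ + _)]mulrDr [Ckappa / 2 * (2 * _)]mulrCA.
move: (Ckappa / 2 * (\sum_i z i ^+ 2)) (Ckappa / 2 * \sum_i d i ^+ 2)
  (Ckappa / 2 * (3 * _)) (rhob x / 2 * _) (1 / (2 * c) * _) (rho x / 2 * _).
by move=> a1 a2 a3 a4 a5 a6; lra.
Qed.

End Pointwise.

Lemma etaR_momentum Ckappa (rho rhob : E -> R) (u ub : E -> E) x :
  Ck 1 rho -> Ck 1 rhob -> rho x != 0 -> rhob x != 0 ->
  etaR Ckappa rho (momentum rho u) rhob (momentum rhob ub) x =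
  Ckappa / 2 * \sum_i (partial i rho x - partial i rhob x) ^+ 2
  + rho x / 2 * speed2 (coords u) (coords ub) x.
Proof.
move=> Cr Crb r0 rb0; rewrite /etaR /momentum !scalerA !mulVf// !scale1r.
congr (_ * _ + _ * _); apply: eq_bigr => i _; rewrite !mxE//.
congr (_ ^+ 2).
have h : has_partial i (fun y => rho y - rhob y) (fun y => partial i rho y - partial i rhob y).
  by hp.
exact: (has_partialE x h).
Qed.

Lemma Ck_etaR Ckappa (rho rhob : E -> R) (u ub : E -> E) :
  Ck 1 rho -> Ck 1 rhob -> Ck 1 u -> Ck 1 ub ->
  (forall x, rho x != 0) -> (forall x, rhob x != 0) ->
  Ck 0 (etaR Ckappa rho (momentum rho u) rhob (momentum rhob ub)).
Proof.
move=> Cr Crb Cu Cub r0 rb0.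
have [Cuj Cubj] : (forall j, Ck 1 (coords u j)) /\ (forall j, Ck 1 (coords ub j)).
  by split=> j; [have [] := Ck_coord j Cu|have [] := Ck_coord j Cub].
have -> : etaR Ckappa rho (momentum rho u) rhob (momentum rhob ub) =
    (fun x => Ckappa / 2 * \sum_i (partial i rho x - partial i rhob x) ^+ 2
      + rho x / 2 * speed2 (coords u) (coords ub) x).
  by apply/funext => x; exact: etaR_momentum.
have CN (a b : 'I_3 -> E -> R) : (forall j, Ck 1 (a j)) -> (forall j, Ck 1 (b j)) ->
  Ck 0 (speed2 a b) by move=> ? ?; rewrite /speed2 /dvel; ck.
have {}CN := CN _ _ Cuj Cubj; ck.
Qed.

(** The density part of the energy involves $\rho-\bar\rho$ itself, which the reduced
    relative energy only sees through its gradient: Poincare's inequality closes the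
    gap, because the two masses agree. *)
Lemma tint_energy_le_etaR (Ckappa c C M : R) (rho rhob : E -> R) (u ub : E -> E) :
  0 < Ckappa -> 0 < c ->
  Ck 3 rho -> Ck 3 rhob -> Ck 1 u -> Ck 1 ub ->
  (forall x, c <= rho x <= C) -> (forall x, c <= rhob x <= C) ->
  (forall i x, `|partial i rhob x| <= M) ->
  tint (fun x => rho x - rhob x) = 0 ->
  tint (energy Ckappa rho rhob (coords u) (coords ub)) <=
  (2 + 6 * (3 * Ckappa * M ^+ 2 / c ^+ 2 + 1 / (2 * c)) / Ckappa) *
    tint (etaR Ckappa rho (momentum rho u) rhob (momentum rhob ub)).
Proof.
move=> k0 c0 Cr Crb Cu Cub bnd bndb dM mean0.
set B := (X in 6 * X / _).
have B0 : 0 <= B.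
  have k0' := ltW k0; have c0' := ltW c0.
  apply: addr_ge0; apply: divr_ge0 => //; [|exact: sqr_ge0|exact: mulr_ge0].
  by apply: mulr_ge0; [exact: mulr_ge0|exact: sqr_ge0].
have [C1 C1b] : Ck 1 rho /\ Ck 1 rhob by split; ck.
have r0 x : 0 < rho x by have /andP[+ _] := bnd x; exact: lt_le_trans.
have rb0 x : 0 < rhob x by have /andP[+ _] := bndb x; exact: lt_le_trans.
have r0' x : rho x != 0 by rewrite gt_eqF.
have rb0' x : rhob x != 0 by rewrite gt_eqF.
have [Cuj Cubj] : (forall j, Ck 1 (coords u j)) /\ (forall j, Ck 1 (coords ub j)).
  by split=> j; [have [] := Ck_coord j Cu|have [] := Ck_coord j Cub].
have Ceta := Ck_etaR Ckappa C1 C1b Cu Cub r0' rb0'.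
have Cd : Ck 1 (fun x => rho x - rhob x) by ck.
have Cd2 : Ck 0 (fun x => (rho x - rhob x) ^+ 2) by ck.
set G := fun x => \sum_i (partial i rho x - partial i rhob x) ^+ 2.
have CG : Ck 0 G by rewrite /G; ck.
have step1 : tint (energy Ckappa rho rhob (coords u) (coords ub)) <=
    2 * tint (etaR Ckappa rho (momentum rho u) rhob (momentum rhob ub))
    + B * tint (fun x => (rho x - rhob x) ^+ 2).
  rewrite -tintZ// -tintZ// -tintD; [|exact: (CkZ 2 Ceta)|exact: (CkZ B Cd2)].
  apply: le_tint; [exact: Ck_energy|by apply: CkD; [exact: (CkZ 2 Ceta)|exact: (CkZ B Cd2)]|].
  move=> x; rewrite etaR_momentum//.
  by apply: (energy_le_reduced (C := C)) => //; have /andP[] := bnd x.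
have step2 : tint (fun x => (rho x - rhob x) ^+ 2) <= 3 * tint G.
  rewrite (le_trans (poincare Cd mean0))// (_ : (fun x => _) = G)//.
  apply/funext => x; apply: eq_bigr => i _; congr (_ ^+ 2).
  have h : has_partial i (fun y => rho y - rhob y) (fun y => partial i rho y - partial i rhob y).
    by hp.
  exact: (has_partialE x h).
have step3 : Ckappa / 2 * tint G <= tint (etaR Ckappa rho (momentum rho u) rhob (momentum rhob ub)).
  rewrite -tintZ//; apply: le_tint => //; first exact: (CkZ (Ckappa / 2) CG).
  move=> x; rewrite etaR_momentum// lerDl; apply: mulr_ge0; first by rewrite divr_ge0// ltW.
  by apply: sumr_ge0 => i _; exact: sqr_ge0.
apply: (le_trans step1).
have -> : forall y, (2 + 6 * B / Ckappa) * y = 2 * y + B * (3 * (2 / Ckappa * y)).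
  by move=> y; field; rewrite gt_eqF.
rewrite lerD2l ler_wpM2l// (le_trans step2)// ler_pM2l//.
have := ler_wpM2l (ltW (divr_gt0 (ltr0n R 2) k0)) step3.
by rewrite mulrA (_ : 2 / Ckappa * (Ckappa / 2) = 1) ?mul1r//; field; rewrite gt_eqF.
Qed.

Lemma energy_diag Ckappa (rho : E -> R) (u : 'I_3 -> E -> R) x : rho x != 0 ->
  energy Ckappa rho rho u u x = 0.
Proof.
move=> r0; rewrite /energy /speed2 /dvel /flux /reldens !sum3.
by gen_partials; field; exact: r0.
Qed.

End Comparisons.

(** * Norms and stability *)

Section Norms.
Context {R : realType}.
Local Notation E := 'rV[R]_3.

(** Only the square of $f$ is assumed continuous: this covers Euclidean lengths of
    fields. *)
Lemma L2normE (f g : E -> R) : (forall x, f x ^+ 2 = g x) -> Ck 0 g ->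
  L2norm f = (Num.sqrt (tint g))%:E.
Proof.
move=> fg Cg; rewrite /L2norm Lnorm.unlock.
have -> : (\int[lebesgue_measure \x lebesgue_measure \x lebesgue_measure]_x
    `|((fun x => (f (torus_point x))%:E) \_ cube) x| `^ 2)%E = (tint g)%:E.
  rewrite -integral_torusE// /integral_torus [RHS]integral_mkcond.
  apply: eq_integral => x _; rewrite /patch/=; case: ifPn => xc.
    by rewrite poweR_EFin powR_mulrn// -fg real_normK ?num_real.
  by rewrite -[point]/(0%:E) abse0 poweR_EFin powR0.
by rewrite poweR_EFin -powR12_sqrt//; apply: tint_ge0 => x; rewrite -fg sqr_ge0.
Qed.

Lemma norm2_sqr (v : E) : norm2 v ^+ 2 = \sum_j v 0 j ^+ 2.
Proof. by rewrite sqr_sqrtr//; apply: sumr_ge0 => i _; exact: sqr_ge0. Qed.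

Lemma L2norm_sqr (f g : E -> R) : (forall x, f x ^+ 2 = g x) -> Ck 0 g ->
  (L2norm f ^+ 2)%E = (tint g)%:E.
Proof.
move=> fg Cg; rewrite (L2normE fg Cg) -EFin_expe sqr_sqrtr//.
by apply: tint_ge0 => x; rewrite -fg sqr_ge0.
Qed.

Lemma H1normE (f : E -> R) : Ck 1 f ->
  H1norm f = (Num.sqrt (tint (fun x => f x ^+ 2 + \sum_i partial i f x ^+ 2)))%:E.
Proof.
move=> Cf; have Cf2 : Ck 0 (fun x => f x ^+ 2) by ck.
have Cg2 : Ck 0 (fun x => \sum_i partial i f x ^+ 2) by ck.
rewrite /H1norm (L2norm_sqr (fun=> erefl) Cf2) /L2norm_vec.
rewrite (L2norm_sqr (g := fun x => \sum_i partial i f x ^+ 2) _ Cg2); last first.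
  by move=> x; rewrite norm2_sqr; apply: eq_bigr => i _; rewrite mxE.
rewrite -EFinD -tintD// poweR_EFin powR12_sqrt//; apply: tint_ge0 => x.
by rewrite addr_ge0 ?sqr_ge0//; apply: sumr_ge0 => i _; exact: sqr_ge0.
Qed.

Lemma Loo_time_sqr_le {X : Type} (T S : R) (N : X -> \bar R) (f : R -> X) :
  0 <= S -> (forall t, 0 < t < T -> (0 <= N (f t) <= (Num.sqrt S)%:E)%E) ->
  (Loo_time T N f ^+ 2 <= S%:E)%E.
Proof.
move=> S0 H.
have le1 : (Loo_time T N f <= (Num.sqrt S)%:E)%E.
  rewrite /Loo_time Lnorm.unlock; case: ifPn => _; last by rewrite lee_fin sqrtr_ge0.
  apply/ess_supP; apply: nearW => t /=; rewrite /patch; case: ifPn => [|_].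
    by rewrite inE/= in_itv/= => /H /andP[h1 h2]; rewrite gee0_abs.
  by rewrite -[point]/(0%:E) abse0 lee_fin sqrtr_ge0.
have ge0 : (0 <= Loo_time T N f)%E by exact: Lnorm_ge0.
rewrite expe2; apply: (le_trans (lee_pmul ge0 ge0 le1 le1)).
by rewrite -EFinM -expr2 sqr_sqrtr.
Qed.

End Norms.

Section Stability.
Context {R : realType}.
Local Notation E := 'rV[R]_3.
Variables (h : R -> R) (Ckappa T c C : R).
Hypotheses (hh : C3_pos_nonneg h) (Ckappa0 : 0 < Ckappa) (T0 : 0 < T) (c0 : 0 < c).
Variables (rhob0 : E -> R) (ub0 : E -> E).
Variables (rhos : R -> E -> R) (us : R -> E -> E).
Hypothesis sols : strong_solution h Ckappa T rhob0 ub0 rhos us.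
Hypothesis bnds : density_bounds T c C rhos.

(** The reference solution serves as a pivot: the estimate also compares it with
    any second solution with the same data, which therefore coincides with it, so
    that the constant depends on the reference data only. *)
Lemma stability : exists2 L : R, 0 <= L &
  forall rho u rho0 u0 rhob ub,
    strong_solution h Ckappa T rho0 u0 rho u ->
    strong_solution h Ckappa T rhob0 ub0 rhob ub ->
    density_bounds T c C rho -> density_bounds T c C rhob ->
    integral_torus (rho0 - rhob0) = 0%E ->
    forall t, 0 < t < T ->
      tint (distance2 (rho t) (rhob t) (coords (u t)) (coords (ub t))) <=
      L * tint (etaR Ckappa rho0 (momentum rho0 u0) rhob0 (momentum rhob0 ub0)).
Proof.
have [A A0 HA] := energy_estimate hh Ckappa0 T0 c0 sols bnds.
have [[[Crhos _] poss [Cus _]] _ _ is1 is2] := sols.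
have [M HM] := C0_Ck_bounded Crhos.
have dM t i x : 0 <= t <= T -> `|partial i (rhos t) x| <= M.
  by move=> tT; exact: (HM t [:: i] x tT isT).
have in0 : 0 <= (0 : R) <= T by rewrite lexx ltW.
have rhos0 : rhos 0 = rhob0 by apply/funext.
have us0 : us 0 = ub0 by apply/funext.
pose L1 := 4 / Ckappa + 2 / c + (C ^+ 2 + 6 * M ^+ 2) * (2 / c).
pose L2 := 2 + 6 * (3 * Ckappa * M ^+ 2 / c ^+ 2 + 1 / (2 * c)) / Ckappa.
have [L10 L20] : 0 <= L1 /\ 0 <= L2.
  have k0' := ltW Ckappa0; have c0' := ltW c0.
  split; repeat (apply: addr_ge0 || exact: sqr_ge0 || apply: divr_ge0 ||
    apply: mulr_ge0 || by []).
exists (2 * (L1 * (A * L2))) => [|rho u rho0 u0 rhob ub sol solb bnd bndb mean0 t tT].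
  by rewrite !mulr_ge0.
have tT' : 0 <= t <= T by case/andP: tT => ? ?; rewrite !ltW.
have rs0 x : rhos t x != 0 by rewrite gt_eqF// poss.
have close r v r0 v0 : strong_solution h Ckappa T r0 v0 r v -> density_bounds T c C r ->
    tint (distance2 (r t) (rhos t) (coords (v t)) (coords (us t))) <=
    L1 * (A * tint (energy Ckappa r0 rhob0 (coords v0) (coords ub0))).
  move=> solr bndr; have [[[Cr _] _ [Cv _]] _ _ _ _] := solr.
  have [C3 C3s] : Ck 3 (r t) /\ Ck 3 (rhos t) by split; [case: Cr|case: Crhos] => + _; exact.
  have Cvj j : Ck 1 (coords (v t) j) := Ck_velocity Cv j tT'.
  have Cuj j : Ck 1 (coords (us t) j) := Ck_velocity Cus j tT'.
  have Cen := Ck_energy Ckappa C3 C3s Cvj Cuj rs0.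
  apply: (@le_trans _ _ (L1 * tint (energy Ckappa (r t) (rhos t) (coords (v t)) (coords (us t))))).
    rewrite -tintZ//; apply: le_tint; [by apply: Ck_distance2 => //; ck|exact: (CkZ L1 Cen)|].
    move=> x; apply: (distance2_le_energy _ _ Ckappa0 c0) => //.
    - by have /andP[] := bndr t x tT'.
    - exact: bnds.
    - by move=> i; exact: dM.
  by rewrite ler_wpM2l//; exact: HA.
have [[[Cr _] pos [Cu _]] _ _ i1 i2] := sol.
have [[[Crb _] posb [Cub _]] _ _ _ _] := solb.
have rho00 : rho 0 = rho0 by apply/funext.
have u00 : u 0 = u0 by apply/funext.
have [C30 C3b0] : Ck 3 rho0 /\ Ck 3 rhob0.
  by rewrite -rho00 -rhos0; split; [case: Cr|case: Crhos] => + _; exact.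
have [Cu0 Cub0] : Ck 1 u0 /\ Ck 1 ub0.
  by rewrite -u00 -us0; split; [case: Cu|case: Cus] => + _; exact.
have diag : tint (energy Ckappa rhob0 rhob0 (coords ub0) (coords ub0)) = 0.
  rewrite -(tint_cst (0 : R)); congr tint; apply/funext => x.
  by apply: energy_diag; rewrite -rhos0 gt_eqF// poss.
have mean : tint (fun x => rho0 x - rhob0 x) = 0.
  have Cd : Ck 0 (fun x => rho0 x - rhob0 x) by ck.
  by apply: EFin_inj; rewrite -integral_torusE.
have init : tint (energy Ckappa rho0 rhob0 (coords u0) (coords ub0)) <=
    L2 * tint (etaR Ckappa rho0 (momentum rho0 u0) rhob0 (momentum rhob0 ub0)).
  apply: (tint_energy_le_etaR (C := C)) => //.
  - by move=> x; rewrite -rho00; exact: bnd.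
  - by move=> x; rewrite -rhos0; exact: bnds.
  - by move=> i x; rewrite -rhos0; exact: dM.
have d1 := close _ _ _ _ sol bnd.
have d2 := close _ _ _ _ solb bndb; rewrite diag !mulr0 in d2.
have Cd (r1 : R -> E -> R) (v1 : R -> E -> E) (r2 : R -> E -> R) (v2 : R -> E -> E) :
    C0_Ck T 3 r1 -> C0_Ck T 1 v1 -> C0_Ck T 3 r2 -> C0_Ck T 1 v2 ->
    Ck 0 (distance2 (r1 t) (r2 t) (coords (v1 t)) (coords (v2 t))).
  move=> [Cr1 _] Cv1 [Cr2 _] Cv2; apply: Ck_distance2.
  - exact: CkW (Cr1 t tT').
  - exact: CkW (Cr2 t tT').
  - by move=> j; exact: (Ck_velocity Cv1 j tT').
  - by move=> j; exact: (Ck_velocity Cv2 j tT').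
have Cd1 := Cd _ _ _ _ Cr Cu Crhos Cus; have Cd2 := Cd _ _ _ _ Crb Cub Crhos Cus.
apply: (@le_trans _ _ (2 * tint (distance2 (rho t) (rhos t) (coords (u t)) (coords (us t)))
    + 2 * tint (distance2 (rhob t) (rhos t) (coords (ub t)) (coords (us t))))).
  rewrite -tintZ// -tintZ// -tintD; [|exact: (CkZ 2 Cd1)|exact: (CkZ 2 Cd2)].
  apply: le_tint; [exact: Cd|apply: CkD; [exact: (CkZ 2 Cd1)|exact: (CkZ 2 Cd2)]|].
  by move=> x; exact: distance2_triangle.
have d1' := le_trans d1 (ler_wpM2l L10 (ler_wpM2l A0 init)).
rewrite !mulrA in d1' *; move: d1' d2; lra.
Qed.

End Stability.

Theorem theorem4p5 (R : realType) (h : R -> R) (hh : C3_pos_nonneg h)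
    (T Ckappa : R) (hT : 0 < T) (hCkappa : 0 < Ckappa)
    (rhob0 : 'rV[R]_3 -> R) (ub0 : 'rV[R]_3 -> 'rV[R]_3)
    (c_rho C_rho c_m : R) (hc_rho : 0 < c_rho) (hC_rho : 0 < C_rho) (hc_m : 0 < c_m) :
  exists2 C : R, 0 < C &
    forall (rho rhob : R -> 'rV[R]_3 -> R) (u ub : R -> 'rV[R]_3 -> 'rV[R]_3)
           (rho0 : 'rV[R]_3 -> R) (u0 : 'rV[R]_3 -> 'rV[R]_3),
      strong_solution h Ckappa T rho0 u0 rho u ->
      strong_solution h Ckappa T rhob0 ub0 rhob ub ->
      (forall (t : R) x, 0 <= t <= T ->
         (c_rho <= rho t x <= C_rho) /\ (c_rho <= rhob t x <= C_rho)) ->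
      (maxe (Loo_vec T (fun t => momentum (rho t) (u t)))
            (Loo_vec T (fun t => momentum (rhob t) (ub t))) <= c_m%:E)%E ->
      integral_torus (rho0 - rhob0) = 0%E ->
      ((Ckappa / 2)%:E * Loo_time T H1norm (fun t => (rho t - rhob t)%R) ^+ 2
       + (c_rho / 2)%:E * Loo_time T L2norm_vec (fun t => (u t - ub t)%R) ^+ 2
       <= C%:E * integral_torus
                   (etaR Ckappa rho0 (momentum rho0 u0)
                         rhob0 (momentum rhob0 ub0)))%E.
Proof.
(* The constant may depend on the data, but not on the solution that takes them: it is
   computed from one such solution, fixed here. If there is none, the claim is vacuous. *)
pose solves (s : (R -> 'rV[R]_3 -> R) * (R -> 'rV[R]_3 -> 'rV[R]_3)) :=
  strong_solution h Ckappa T rhob0 ub0 s.1 s.2 /\ density_bounds T c_rho C_rho s.1.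
have [[[rhos us] /= [sols bnds]]|none] := EM (exists s, solves s); last first.
  exists 1 => // rho rhob u ub rho0 u0 _ solb bnd; case: none; exists (rhob, ub).
  by split=> // t x tT; have [] := bnd t x tT.
have [L L0 HL] := stability hh hCkappa hT hc_rho sols bnds.
have K0 : 0 <= Ckappa / 2 + c_rho / 2 by rewrite addr_ge0// divr_ge0// ltW.
exists ((Ckappa / 2 + c_rho / 2) * L + 1); first by rewrite ltr_wpDl// mulr_ge0.
move=> rho rhob u ub rho0 u0 sol solb bnd _ mean0.
have [bnda bndb] : density_bounds T c_rho C_rho rho /\ density_bounds T c_rho C_rho rhob.
  by split=> t x tT; have [] := bnd t x tT.
have {}HL := HL _ _ _ _ _ _ sol solb bnda bndb mean0.
set eta := etaR _ _ _ _ _ in HL *.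
have [[[Cr _] pos [Cu _]] _ _ i1 i2] := sol.
have [[[Crb _] posb [Cub _]] _ _ ib1 ib2] := solb.
have in0 : 0 <= (0 : R) <= T by rewrite lexx ltW.
have rho00 : rho 0 = rho0 by apply/funext.
have u00 : u 0 = u0 by apply/funext.
have rhob00 : rhob 0 = rhob0 by apply/funext.
have ub00 : ub 0 = ub0 by apply/funext.
have Ceta : Ck 0 eta.
  rewrite /eta -rho00 -u00 -rhob00 -ub00; apply: Ck_etaR.
  - by apply: CkW (Cr.1 _ in0).
  - by apply: CkW (Crb.1 _ in0).
  - exact: (Cu.1 _ in0).
  - exact: (Cub.1 _ in0).
  - by move=> x; rewrite gt_eqF// pos.
  - by move=> x; rewrite gt_eqF// posb.
have eta0 : 0 <= tint eta.
  apply: tint_ge0 => x; rewrite /eta /etaR /sqnorm2 addr_ge0 ?mulr_ge0 ?divr_ge0 ?(ltW hCkappa)//.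
  - by apply: sumr_ge0 => i _; exact: sqr_ge0.
  - by rewrite -rho00 ltW// pos.
  - by apply: sumr_ge0 => i _; exact: sqr_ge0.
pose S := L * tint eta.
have S0 : 0 <= S by exact: mulr_ge0.
have fields t : 0 < t < T -> [/\ Ck 1 (rho t), Ck 1 (rhob t),
    forall j, Ck 1 (fun x => u t x 0 j) & forall j, Ck 1 (fun x => ub t x 0 j)].
  move=> tT; have tT' : 0 <= t <= T by case/andP: tT => ? ?; rewrite !ltW.
  split; [exact: CkW (Cr.1 t tT')|exact: CkW (Crb.1 t tT')| |] => j.
    exact: (Ck_velocity Cu j tT').
  exact: (Ck_velocity Cub j tT').
have H1 : (Loo_time T H1norm (fun t => (rho t - rhob t)%R) ^+ 2 <= S%:E)%E.
  apply: Loo_time_sqr_le => // t tT; have [C1 C1b Cv Cvb] := fields t tT.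
  have Cd : Ck 1 (fun x => rho t x - rhob t x) by exact: CkB.
  have hd i : has_partial i (fun x => rho t x - rhob t x)
      (fun x => partial i (rho t) x - partial i (rhob t) x).
    exact: (has_partialD (has_partialW i C1) (has_partialN (has_partialW i C1b))).
  rewrite (H1normE Cd) !lee_fin sqrtr_ge0/=; apply: ler_wsqrtr.
  apply: le_trans (HL t tT); apply: le_tint; [ck|exact: Ck_distance2|] => x.
  under eq_bigr do rewrite (has_partialE x (hd _)).
  by rewrite /distance2 lerDl; apply: sumr_ge0 => i _; exact: sqr_ge0.
have H2 : (Loo_time T L2norm_vec (fun t => (u t - ub t)%R) ^+ 2 <= S%:E)%E.
  apply: Loo_time_sqr_le => // t tT; have [C1 C1b Cv Cvb] := fields t tT.
  have CN : Ck 0 (fun x => \sum_j (u t x 0 j - ub t x 0 j) ^+ 2).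
    apply: Ck_sum => j; apply: Ck_sqr; apply: CkB; [exact: CkW (Cv j)|exact: CkW (Cvb j)].
  rewrite /L2norm_vec (L2normE _ CN); last first.
    by move=> x; rewrite norm2_sqr; apply: eq_bigr => j _; rewrite !mxE.
  rewrite !lee_fin sqrtr_ge0/=; apply: ler_wsqrtr.
  apply: le_trans (HL t tT); apply: le_tint; [exact: CN|exact: Ck_distance2|] => x.
  rewrite /distance2 /speed2 lerDr addr_ge0 ?sqr_ge0//.
  by apply: sumr_ge0 => i _; exact: sqr_ge0.
rewrite (integral_torusE Ceta) -EFinM.
apply: (@le_trans _ _ (((Ckappa / 2) * S + (c_rho / 2) * S)%:E)).
  rewrite EFinD !EFinM; apply: leeD; apply: lee_wpmul2l => //;
  by rewrite lee_fin divr_ge0// ltW.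
have -> : ((Ckappa / 2 + c_rho / 2) * L + 1) * tint eta =
  Ckappa / 2 * S + c_rho / 2 * S + tint eta by rewrite /S; ring.
by rewrite lee_fin lerDl.
Qed.
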